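(* Let $d\ge 2$ be standard. 1. $\mathsf{RCA}_0^{\ast}$ proves $\mathrm{WPH}^{d,f}$ for $f(x)=\log^{(d-1)}(x)$. 2. For every standard $n$, $\mathsf{RCA}_0^{\ast}+\mathsf{I}\Sigma^0_{d-1}$ does not prove $\mathrm{WPH}^{d,f_n}$, where $f_n(x)=\sqrt[n]{\log^{(d-2)}(x)}$. Moreover, in both parts $\mathsf{RCA}_0^{\ast}$ can be replaced by $\mathsf{EFA}$.
   Context: $\mathsf{RCA}_0^{\ast}$ is the subsystem of second order arithmetic, in the usual language augmented by a binary function symbol $\exp$ (written $m^n$), whose axioms are: the basic axioms of second order arithmetic (the usual quantifier-free axioms for $0,1,+,\cdot,<$); the exponentiation axioms $m^0=1$, $m^{n+1}=m\cdot m^n$; the induction scheme for all $\Sigma^0_0$ formulas (possibly containing $\exp$); and the comprehension scheme for all $\Delta^0_1$ formulas (possibly containing $\exp$). $\mathsf{I}\Sigma^0_k$ is the induction scheme for $\Sigma^0_k$ formulas. $\mathsf{EFA}$ (elementary function arithmetic) is the first order theory with the basic axioms, the exponentiation axioms, and induction for bounded formulas possibly containing $\exp$. $\mathbb{N}$ is the set of nonnegative integers, and $c\in\mathbb{N}$ is identified with $\{0,\dots,c-1\}$. $[a,R]=\{n\in\mathbb{N}:a\le n\le R\}$ and $[a,R]^d=\{(x_0,\dots,x_{d-1})\in\mathbb{N}^d:a\le x_0<\cdots<x_{d-1}\le R\}$. For a coloring $C\colon[a,R]^d\to c$, a set $H=\{h_0<h_1<\cdots\}\subseteq[a,R]$ is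 $C$-weakly homogeneous if $C(h_i,\dots,h_{i+d-1})=C(h_{i+1},\dots,h_{i+d})$ for all $h_i,h_{i+1},\dots,h_{i+d}$ in $H$. For $f\colon\mathbb{N}\to\mathbb{N}$, $\mathrm{WPH}^{d,f}$ states: for all $c$ and $a$ there exists $R$ such that for every $C\colon[a,R]^d\to c$ there exists a (nonempty) $C$-weakly homogeneous $H\subseteq[a,R]$ such that $|H|>f(\min H)$. $\log^{(k)}$ is the $k$-fold iterate of the base $2$ logarithm ($\log^{(0)}(x)=x$); logarithms and roots are taken as functions $\mathbb{N}\to\mathbb{N}$ by rounding down (with $\log 0=0$), and $\sqrt[0]{x}=x$ by convention. Standard means an actual natural number of the metatheory. *)

(* Defs.v *)
#[warnings="-notation-overridden"]
From mathcomp Require Import all_boot.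
From Stdlib Require List.

Set Implicit Arguments.
Unset Strict Implicit.
Unset Printing Implicit Defensive.

Declare Scope tm_scope.
Declare Scope fm_scope.
Delimit Scope tm_scope with tm.
Delimit Scope fm_scope with fm.

(** * Syntax

    De Bruijn indices throughout, with two independent index spaces: one for
    number variables and one for set variables. *)

Inductive term : Type :=
| Var of nat
| Zero
| One
| Add of term & term
| Mul of term & term
| Exp of term & term.

Bind Scope tm_scope with term.

(** [formula true] is the two-sorted language of second order arithmetic with
    [exp].  In [formula false] the two constructors mentioning sets have no
    instance, so it is the language of first order arithmetic with [exp]. *)
Inductive formula (so : bool) : Type :=
| Bot
| Eq of term & term
| Lt of term & term
| Elem of so & term & nat
| Imp of formula so & formula so
| All of formula so
| AllS of so & formula so.

Bind Scope fm_scope with formula.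

Arguments Bot {so}.
Arguments Eq {so} (_ _)%_tm_scope.
Arguments Lt {so} (_ _)%_tm_scope.
Arguments Elem {so} _ _%_tm_scope _%_nat_scope.
Arguments Imp {so} (_ _)%_fm_scope.
Arguments All {so} _%_fm_scope.
Arguments AllS {so} _ _%_fm_scope.

Notation "# i" := (Var i) (at level 1, i at level 0, format "# i") : tm_scope.
Notation "0" := Zero : tm_scope.
Notation "1" := One : tm_scope.
Notation "2" := (Add One One) : tm_scope.
Notation "t + u" := (Add t u) : tm_scope.
Notation "t * u" := (Mul t u) : tm_scope.
Notation "t ^ u" := (Exp t u) : tm_scope.

Definition Num (n : nat) : term := iter n (fun t => (t + 1)%tm) Zero.

(** The logic is classical, so the other connectives are abbreviations. *)
Section Connectives.
Variable so : bool.
Implicit Types A B : formula so.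

Definition Not A := Imp A Bot.
Definition Top : formula so := Not Bot.
Definition Or A B := Imp (Not A) B.
Definition And A B := Not (Imp A (Not B)).
Definition Iff A B := And (Imp A B) (Imp B A).
Definition Ex A := Not (All (Not A)).
Definition ExS (h : so) A := Not (AllS h (Not A)).
Definition Le (t u : term) : formula so := Or (Lt t u) (Eq t u).
Definition Conj (As : seq (formula so)) := foldr And Top As.

End Connectives.

Arguments Top {so}.
Arguments Le {so}.

Notation "~ A" := (Not A) : fm_scope.
Notation "A /\ B" := (And A B) : fm_scope.
Notation "A \/ B" := (Or A B) : fm_scope.
Notation "A <-> B" := (Iff A B) : fm_scope.
Notation "A ⊃ B" := (Imp A B) (at level 90, right associativity) : fm_scope.
Notation "t = u" := (Eq t u) : fm_scope.
Notation "t < u" := (Lt t u) : fm_scope.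
Notation "t <= u" := (Le t u) : fm_scope.

Definition scons (t : term) (s : nat -> term) (i : nat) : term :=
  if i is j.+1 then s j else t.

Fixpoint tsubst (s : nat -> term) (t : term) : term :=
  match t with
  | Var i => s i
  | Zero => Zero
  | One => One
  | Add t u => Add (tsubst s t) (tsubst s u)
  | Mul t u => Mul (tsubst s t) (tsubst s u)
  | Exp t u => Exp (tsubst s t) (tsubst s u)
  end.

Definition tlift (k : nat) : term -> term := tsubst (fun i => Var (k + i)).

Notation "t ⇑ k" := (tlift k t) (at level 2, k at level 0, format "t ⇑ k")
  : tm_scope.

Definition up (s : nat -> term) : nat -> term :=
  scons (Var 0) (fun i => tlift 1 (s i)).

Definition upr (r : nat -> nat) (i : nat) : nat :=
  if i is j.+1 then (r j).+1 else 0.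

(** [s] acts on number variables and [r] renames set variables. *)
Fixpoint fsubst so (s : nat -> term) (r : nat -> nat) (A : formula so) :
    formula so :=
  match A with
  | Bot => Bot
  | Eq t u => Eq (tsubst s t) (tsubst s u)
  | Lt t u => Lt (tsubst s t) (tsubst s u)
  | Elem h t X => Elem h (tsubst s t) (r X)
  | Imp A B => Imp (fsubst s r A) (fsubst s r B)
  | All A => All (fsubst (up s) r A)
  | AllS h A => AllS h (fsubst s (upr r) A)
  end.

Section Substitution.
Variable so : bool.
Implicit Types A : formula so.

Definition inst A (t : term) := fsubst (scons t Var) id A.
Definition flift A := fsubst (fun i => Var i.+1) id A.
Definition instS A (X : nat) :=
  fsubst Var (fun i => if i is j.+1 then j else X) A.
Definition fliftS A := fsubst Var S A.

End Substitution.

(** * Classical natural deduction with equality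

    Axioms of [T] may have free variables; since [All_I] shifts only the
    context, they act as their universal closures. *)
Inductive derives so (T : formula so -> Prop) :
    seq (formula so) -> formula so -> Prop :=
| Ax G A : T A -> derives T G A
| Hyp G A : List.In A G -> derives T G A
| Imp_I G A B : derives T (A :: G) B -> derives T G (Imp A B)
| Imp_E G A B : derives T G (Imp A B) -> derives T G A -> derives T G B
| Raa G A : derives T (Not A :: G) Bot -> derives T G A
| All_I G A : derives T (map (@flift so) G) A -> derives T G (All A)
| All_E G A t : derives T G (All A) -> derives T G (inst A t)
| AllS_I (h : so) G A :
    derives T (map (@fliftS so) G) A -> derives T G (AllS h A)
| AllS_E (h : so) G A X : derives T G (AllS h A) -> derives T G (instS A X)
| Eq_I G t : derives T G (Eq t t)
| Eq_E G A t u :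
    derives T G (Eq t u) -> derives T G (inst A t) -> derives T G (inst A u).

Definition proves so (T : formula so -> Prop) (A : formula so) : Prop :=
  derives T [::] A.

(** * Theories *)

(** In a bounded quantifier, the shift makes the bound [t] independent of the
    quantified variable. *)
Inductive bounded so : formula so -> Prop :=
| bounded_Bot : bounded Bot
| bounded_Eq t u : bounded (Eq t u)
| bounded_Lt t u : bounded (Lt t u)
| bounded_Elem h t X : bounded (Elem h t X)
| bounded_Imp A B : bounded A -> bounded B -> bounded (Imp A B)
| bounded_All t A : bounded A -> bounded (All (#0 < t⇑1 ⊃ A))
| bounded_Ex t A : bounded A -> bounded (Ex (#0 < t⇑1 /\ A)).

Inductive Sigma so : nat -> formula so -> Prop :=
| Sigma_0 A : bounded A -> Sigma 0 A
| Sigma_S k A : Pi k A -> Sigma k.+1 (Ex A)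
with Pi so : nat -> formula so -> Prop :=
| Pi_0 A : bounded A -> Pi 0 A
| Pi_S k A : Sigma k A -> Pi k.+1 (All A).

Inductive basic_axiom so : formula so -> Prop :=
| ax_succ_neq0 : basic_axiom (~ (#0 + 1 = 0))
| ax_succ_inj : basic_axiom (#0 + 1 = #1 + 1 ⊃ #0 = #1)
| ax_add0 : basic_axiom (#0 + 0 = #0)
| ax_addS : basic_axiom (#0 + (#1 + 1) = (#0 + #1) + 1)
| ax_mul0 : basic_axiom (#0 * 0 = 0)
| ax_mulS : basic_axiom (#0 * (#1 + 1) = #0 * #1 + #0)
| ax_lt0 : basic_axiom (~ (#0 < 0))
| ax_ltS : basic_axiom ((#0 < #1 + 1) <-> (#0 < #1 \/ #0 = #1)).

Inductive exp_axiom so : formula so -> Prop :=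
| ax_exp0 : exp_axiom (#0 ^ 0 = 1)
| ax_expS : exp_axiom (#0 ^ (#1 + 1) = #0 * #0 ^ #1).

(** Induction on the variable [#0] of [A]; the other free variables are
    parameters. *)
Definition induction_axiom so (A : formula so) : formula so :=
  (inst A 0
     /\ All (A ⊃ fsubst (scons (#0 + 1) (fun i => #(i.+1)%tm)) id A)
   ⊃ All A)%fm.

Definition ISigma so (k : nat) (F : formula so) : Prop :=
  exists2 A, Sigma k A & F = induction_axiom A.

(** The characteristic property of [X] is stated for the number variable [#0];
    [fliftS] ensures that [X] is not free in [A]. *)
Definition comprehension_axiom (A B : formula true) : formula true :=
  (All (A <-> B) ⊃ ExS isT (All (Elem isT #0 0 <-> fliftS A)))%fm.

Definition Delta1_comprehension (F : formula true) : Prop :=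
  exists A B, [/\ Sigma 1 A, Pi 1 B & F = comprehension_axiom A B].

Definition theory_union so (T U : formula so -> Prop) (F : formula so) : Prop :=
  T F \/ U F.

Definition elementary_arithmetic so : formula so -> Prop :=
  theory_union (theory_union (@basic_axiom so) (@exp_axiom so)) (ISigma 0).

Definition EFA : formula false -> Prop := @elementary_arithmetic false.

Definition RCA0star : formula true -> Prop :=
  theory_union (@elementary_arithmetic true) Delta1_comprehension.

(** * The arithmetized principle

    Finite sets, and hence finite functions, are coded by numbers. *)

Section Arithmetization.
Variable so : bool.
Local Open Scope tm_scope.
Local Notation fm := (formula so).

(** [t] belongs to the finite set coded by [s]: bit [t] of [s] is 1, i.e.
    [s = (2q + 1) 2^t + r] with [r < 2^t], where [q = #1] and [r = #0]. *)
Definition InSet (t s : term) : fm :=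
  Ex (Ex (#0 < 2 ^ t⇑2 /\ s⇑2 = (2 * #1 + 1) * 2 ^ t⇑2 + #0)).

(** An injection of pairs of numbers into numbers. *)
Definition Pair (t u : term) : term := (t + u) * (t + u) + t.

(** The tuple [(xs, v)] belongs to the graph coded by [F]. *)
Definition App (F : term) (xs : seq term) (v : term) : fm :=
  InSet (foldr Pair v xs) F.

(** [v] is the only value that [F] takes at [xs]. *)
Definition Value (F : term) (xs : seq term) (v : term) : fm :=
  All (App F⇑1 (map (tlift 1) xs) #0 <-> #0 = v⇑1).

Definition AllN (k : nat) (A : fm) : fm := iter k (@All so) A.

Definition vars (k : nat) : seq term := map Var (iota 0 k).

Fixpoint increasing_to (x : term) (xs : seq term) (R : term) : fm :=
  if xs is y :: ys then (x < y /\ increasing_to y ys R)%fm else (x <= R)%fm.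

(** [a <= x_0 < ... < x_(d-1) <= R] *)
Definition Simplex (a : term) (xs : seq term) (R : term) : fm :=
  if xs is x :: xs' then (a <= x /\ increasing_to x xs' R)%fm else Top.

(** [C] codes a function from [[a,R]^d] to [c]; elements of the coded set
    other than the tuples [(xs, v)] with [xs] in [[a,R]^d] are irrelevant. *)
Definition Coloring (d : nat) (C c a R : term) : fm :=
  AllN d (Simplex a⇑d (vars d) R⇑d
    ⊃ Ex (#0 < c⇑(d.+1) /\ Value C⇑(d.+1) (map (tlift 1) (vars d)) #0)).

Definition SubInterval (H a R : term) : fm :=
  All (InSet #0 H⇑1 ⊃ a⇑1 <= #0 /\ #0 <= R⇑1).

(** [s] codes the increasing bijection [i |-> h_i] from [{0,...,k-1}] onto the
    set coded by [H]; in particular [H] has exactly [k] elements. *)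
Definition Enumerates (s k H : term) : fm :=
  (All (#0 < k⇑1 ⊃ Ex (InSet #0 H⇑2 /\ Value s⇑2 [:: #1] #0))
   /\ (AllN 4 (#0 < #1 ⊃ #1 < k⇑4
                ⊃ App s⇑4 [:: #0] #2 ⊃ App s⇑4 [:: #1] #3 ⊃ #2 < #3)
   /\ All (InSet #0 H⇑1 ⊃ Ex (#0 < k⇑2 /\ App s⇑2 [:: #0] #1))))%fm.

(** For all [i] with [i + d < k], the values [h_i, ..., h_(i+d)] of [s]
    satisfy [C(h_i,...,h_(i+d-1)) = C(h_(i+1),...,h_(i+d))].  Under the
    quantifiers [AllN d.+2], [h_(i+j)] is [#j] for [j <= d], and [i] is
    [#(d.+1)]. *)
Definition WeaklyHomogeneous (d : nat) (C s k : term) : fm :=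
  AllN d.+2 (#(d.+1) + Num d < k⇑(d.+2)
    ⊃ Conj [seq App s⇑(d.+2) [:: #(d.+1) + Num j] #j | j <- iota 0 d.+1]
    ⊃ Ex (App C⇑(d.+3) (map (tlift 1) (take d (vars d.+1))) #0
          /\ App C⇑(d.+3) (map (tlift 1) (drop 1 (vars d.+1))) #0)).

Definition IsMin (m H : term) : fm :=
  (InSet m H /\ All (InSet #0 H⇑1 ⊃ m⇑1 <= #0))%fm.

(** A definable function is given by its graph: [f x y] says [f(x) = y]. *)
Definition graph := term -> term -> fm.

(** [f(min H) < k] *)
Definition Large (f : graph) (H k : term) : fm :=
  Ex (Ex (IsMin #1 H⇑2 /\ (f #1 #0 /\ #0 < k⇑2))).

(** For all [c] and [a] there is [R] such that for all [C] there are [H],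
    [k = |H|] and an increasing enumeration [s] of [H] as required.  Under
    all quantifiers [c, a, R, C, H, k, s] are [#6, ..., #0]. *)
Definition WPH (d : nat) (f : graph) : fm :=
  All (All (Ex (All (Coloring d #0 #3 #2 #1 ⊃
    Ex (Ex (Ex (SubInterval #2 #5 #4
      /\ (Enumerates #0 #1 #2
      /\ (WeaklyHomogeneous d #3 #0 #1
      /\ Large f #2 #1))))))))).

(** Base 2 logarithm rounded down, with [log 0 = 0]. *)
Definition Log : graph := fun x y =>
  ((x = 0 /\ y = 0) \/ (2 ^ y <= x /\ x < 2 ^ (y + 1)))%fm.

Fixpoint LogIter (k : nat) : graph := fun x y =>
  if k is k'.+1 then Ex (LogIter k' x⇑1 #0 /\ Log #0 y⇑1) else (x = y)%fm.

(** [n]-th root rounded down; the 0-th root is the identity by convention. *)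
Definition Root (n : nat) : graph := fun x y =>
  if n is 0%N then (x = y)%fm
  else (y ^ Num n <= x /\ x < (y + 1) ^ Num n)%fm.

(** [n]-th root of [log^(k)] *)
Definition RootLogIter (n k : nat) : graph := fun x y =>
  Ex (LogIter k x⇑1 #0 /\ Root n #0 y⇑1).

End Arithmetization.

(* Main.v *)
Require Import Defs.
From mathcomp Require Import all_boot.
From mathcomp Require Import boolp zify.
From mathcomp Require classical_sets filter.
From Stdlib Require Import Ring.

Set Implicit Arguments.
Unset Strict Implicit.
Unset Printing Implicit Defensive.

(** Unprovability.  If the theory proved the principle, the principle would hold
    in every initial segment of an ultrapower of [nat] (with its Delta_1 sets) that
    satisfies Sigma_(d-1) induction.  Given a matrix [theta], call an increasing
    finite sequence scattered at level [j] if a witness for a Sigma_j statement about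
    numbers below one element is found, if at all, below the next element.  Scattered
    sequences are obtained from the numbers z, 2^(3z), ... by thinning out d-1 times.
    Stepping up turns the comparison of the thinned initial parts of such sequences
    into a coloring of d-tuples, with the following property: a weakly homogeneous set
    with more elements than a root of log^(d-2) of its minimum, contained in [a, R],
    forces a long sequence scattered at all levels below [R].  For each nu take the
    least [R] for which the principle holds of that coloring, where the matrix codes
    the first nu formulas.  In the ultraproduct the first omega terms of the sequences
    so obtained are cofinal in a cut with Sigma_(d-1) induction and collection.  The
    principle in this cut gives a bound smaller than [R], contradicting minimality.
    That [R] exists at all follows from the same argument for the standard cut.

    Provability.  In a model of EFA let [C] color the d-tuples of [a, R] with [c]
    colors, and let l(sigma, v) be the largest number of windows of color [v] in a
    weakly homogeneous sequence ending in the (d-1)-tuple [sigma].  Appending a window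
    increases l, so sigma |-> l(sigma, _) properly colors the shift graph.  If always
    l < 2^w, this uses 2^(cw) colors; passing to sets of colors d-2 times yields an
    injection of [a, R] into the numbers below a tower of d-1 twos with cw on top,
    which the pigeonhole principle refutes if [R] is the tower with cw + a on top.
    Hence some l reaches 2^w > cw + a >= log^(d-1) R.  By completeness EFA proves the
    principle, and first order derivations are derivations in RCA0*. *)

(** * Semantics *)

(** The colorings may depend on [R], but the number of colors and the left end of the interval must
    lie in the cut that they produce, or the principle in the cut says nothing about them. So sizes
    of common parts are recorded only up to [nu], each stepping up merely triples the colors, and
    everything that grows with [nu] is absorbed in the first term of the sequences. Numbers whose
    initial parts coincide would form long weakly homogeneous sets for a trivial reason. They are
    separated by the value of [g], and for constant [g] by digits, with a number of colors
    independent of that value. All bounds obtained for unwanted sets are linear in [g] of the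
    minimum; doubling the order of the root makes the principle promise more than the square. In a
    model of EFA the obstacle is that induction covers bounded formulas only. Path lengths are
    therefore capped by [2 ^ w], codes of paths have a bound fixed beforehand, and the function l
    enters a color through its binary digits. *)

Record struc := Struc {
  car :> Type;
  eqv : car -> car -> Prop;
  zer : car; uno : car;
  add : car -> car -> car;
  mul : car -> car -> car;
  pow : car -> car -> car;
  ltr : car -> car -> Prop;
  sets : Type;
  mem : car -> sets -> Prop }.

Arguments eqv {s}. Arguments zer {s}. Arguments uno {s}. Arguments add {s}.
Arguments mul {s}. Arguments pow {s}. Arguments ltr {s}. Arguments mem {s}.

Definition econs T (x : T) (e : nat -> T) (i : nat) : T :=
  if i is j.+1 then e j else x.

Definition ecat T (xs : seq T) (e : nat -> T) : nat -> T := foldr (@econs T) e xs.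

Section Eval.
Variable S : struc.
Implicit Types (e : nat -> S) (E : nat -> sets S).

Fixpoint tev e (t : term) : S :=
  match t with
  | Var i => e i
  | Zero => zer
  | One => uno
  | Add t u => add (tev e t) (tev e u)
  | Mul t u => mul (tev e t) (tev e u)
  | Exp t u => pow (tev e t) (tev e u)
  end.

Fixpoint ev so e E (A : formula so) : Prop :=
  match A with
  | Bot => False
  | Eq t u => eqv (tev e t) (tev e u)
  | Lt t u => ltr (tev e t) (tev e u)
  | Elem _ t X => mem (tev e t) (E X)
  | Imp A B => ev e E A -> ev e E B
  | All A => forall x, ev (econs x e) E A
  | AllS _ A => forall X, ev e (econs X E) A
  end.

Lemma tev_tsubst e s t : tev e (tsubst s t) = tev (fun i => tev e (s i)) t.
Proof. by elim: t => //= t -> u ->. Qed.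

Lemma tev_up e s x :
  (fun i => tev (econs x e) (up s i)) = econs x (fun i => tev e (s i)).
Proof. by apply: funext => -[|i] //=; rewrite /tlift tev_tsubst. Qed.

Lemma ev_fsubst so (A : formula so) s r e E :
  ev e E (fsubst s r A) <-> ev (fun i => tev e (s i)) (fun i => E (r i)) A.
Proof.
elim: A s r e E => //= [t u|t u|h t X|A IHA B IHB|A IHA|h A IHA] s r e E.
- by rewrite !tev_tsubst.
- by rewrite !tev_tsubst.
- by rewrite !tev_tsubst.
- by rewrite IHA IHB.
- by split=> H x; move: (H x); rewrite IHA tev_up.
- have Er X : (fun i => econs X E (upr r i)) = econs X (fun i => E (r i)).
    by apply: funext => -[|i].
  by split=> H x; move: (H x); rewrite IHA Er.
Qed.

Lemma ev_inst so (A : formula so) t e E :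
  ev e E (inst A t) <-> ev (econs (tev e t) e) E A.
Proof.
rewrite ev_fsubst; have -> // : (fun i => tev e (scons t Var i)) = econs (tev e t) e.
by apply: funext => -[|i].
Qed.

Lemma ev_flift so (A : formula so) x e E : ev (econs x e) E (flift A) <-> ev e E A.
Proof. by rewrite ev_fsubst. Qed.

Lemma ev_fliftS so (A : formula so) X e E : ev e (econs X E) (fliftS A) <-> ev e E A.
Proof. by rewrite ev_fsubst. Qed.

Lemma ev_instS so (A : formula so) X e E :
  ev e E (instS A X) <-> ev e (econs (E X) E) A.
Proof.
rewrite ev_fsubst.
have -> // : (fun i => E (if i is j.+1 then j else X)) = econs (E X) E.
by apply: funext => -[|i].
Qed.

Lemma ev_Imp so (A B : formula so) e E : ev e E (Imp A B) <-> (ev e E A -> ev e E B).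
Proof. by []. Qed.

Lemma ev_Imp2 so (A B C : formula so) e E :
  ev e E (Imp A (Imp B C)) <-> (ev e E A -> ev e E B -> ev e E C).
Proof. by []. Qed.

Lemma ev_Imp4 so (A B C D F : formula so) e E :
  ev e E (Imp A (Imp B (Imp C (Imp D F)))) <->
  (ev e E A -> ev e E B -> ev e E C -> ev e E D -> ev e E F).
Proof. by []. Qed.

Lemma ev_All so (A : formula so) e E : ev e E (All A) <-> forall x, ev (econs x e) E A.
Proof. by []. Qed.

Lemma ev_Lt so t u e E : ev e E (Lt t u : formula so) <-> ltr (tev e t) (tev e u).
Proof. by []. Qed.

Lemma ev_Not so (A : formula so) e E : ev e E (Not A) <-> ~ ev e E A.
Proof. by []. Qed.

Lemma ev_And so (A B : formula so) e E : ev e E (And A B) <-> ev e E A /\ ev e E B.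
Proof.
split=> [/= H|[/= HA HB]]; last by apply.
by split; apply: contrapT => HN; apply: H => // HA HB.
Qed.

Lemma ev_Or so (A B : formula so) e E : ev e E (Or A B) <-> ev e E A \/ ev e E B.
Proof.
split=> [/= H|[HA|HB]]; [|by move=> HN; case: (HN HA)|by []].
by case: (pselect (ev e E A)) => HA; [left|right; apply: H].
Qed.

Lemma ev_Iff so (A B : formula so) e E : ev e E (Iff A B) <-> (ev e E A <-> ev e E B).
Proof. by rewrite ev_And /=; split=> [[]|[]]; split. Qed.

Lemma ev_Ex so (A : formula so) e E : ev e E (Ex A) <-> exists x, ev (econs x e) E A.
Proof.
split=> [/= H|[x Hx] /= H]; last exact: H Hx.
by apply: contrapT => HN; apply: H => x Hx; apply: HN; exists x.
Qed.

Lemma ev_ExS (so : bool) (h : so) (A : formula so) e E :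
  ev e E (ExS h A) <-> exists X, ev e (econs X E) A.
Proof.
split=> [/= H|[x Hx] /= H]; last exact: H Hx.
by apply: contrapT => HN; apply: H => x Hx; apply: HN; exists x.
Qed.

Lemma ev_Le so (t u : term) e E :
  ev e E (Le t u : formula so) <-> ltr (tev e t) (tev e u) \/ eqv (tev e t) (tev e u).
Proof. by rewrite ev_Or. Qed.

Lemma ev_Top so e E : ev e E (Top : formula so).
Proof. by []. Qed.

Lemma ev_AllN so k (A : formula so) e E :
  ev e E (AllN k A) <-> forall xs, size xs = k -> ev (ecat xs e) E A.
Proof.
elim: k e => [|k IH] e /=.
  by split=> [H [] //|H]; apply: (H [::]).
split=> [H xs|H x].
  (* The outermost quantifier binds the last entry of the tuple, so tuples are taken apart from the
     right. *)
  case/lastP: xs => // xs x; rewrite size_rcons => -[Hs].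
  by rewrite /ecat foldr_rcons; apply: (proj1 (IH _) (H x)).
rewrite IH => xs Hs; move: (H (rcons xs x)); rewrite size_rcons Hs.
by rewrite /ecat foldr_rcons; apply.
Qed.

Lemma ecat_lt (xs : seq S) e x0 i : i < size xs -> ecat xs e i = nth x0 xs i.
Proof. by elim: xs i => // x xs IH [|i] //= /IH. Qed.

Lemma ecat_ge (xs : seq S) e i : ecat xs e (size xs + i) = e i.
Proof. by elim: xs. Qed.

Lemma tev_lift (xs : seq S) e k t : size xs = k -> tev (ecat xs e) (tlift k t) = tev e t.
Proof.
move=> <-; rewrite /tlift tev_tsubst; congr tev.
by apply: funext => i /=; rewrite ecat_ge.
Qed.

Lemma tev_vars (xs : seq S) e k : size xs = k -> map (tev (ecat xs e)) (vars k) = xs.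
Proof.
move=> <-; case: xs => // x xs0; set xs := x :: xs0.
rewrite -map_comp -[RHS](mkseq_nth x); apply/eq_in_map => i.
by rewrite mem_iota => H; apply: ecat_lt.
Qed.

End Eval.

(** Equality is not identity in general: the elements of a cut of the ultrapower are representing
    functions, compared almost everywhere. *)
Definition congruent (S : struc) : Prop :=
  [/\ (forall x : S, eqv x x), (forall x y : S, eqv x y -> eqv y x),
      (forall x y z : S, eqv x y -> eqv y z -> eqv x z) &
  [/\ (forall x x' y y' : S, eqv x x' -> eqv y y' -> eqv (add x y) (add x' y')),
      (forall x x' y y' : S, eqv x x' -> eqv y y' -> eqv (mul x y) (mul x' y')),
      (forall x x' y y' : S, eqv x x' -> eqv y y' -> eqv (pow x y) (pow x' y')),
      (forall x x' y y' : S, eqv x x' -> eqv y y' -> ltr x y -> ltr x' y') &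
      (forall (x x' : S) X, eqv x x' -> mem x X -> mem x' X)]].

Section Soundness.
Variable S : struc.
Hypothesis cS : congruent S.
Implicit Types (e : nat -> S) (E : nat -> sets S).

Lemma tev_congr e e' t : (forall i, eqv (e i) (e' i)) -> eqv (tev e t) (tev e' t).
Proof. by case: cS => rf sm tr [cA cM cP cL cX] H; elim: t => /=; auto. Qed.

Lemma ev_congr so (A : formula so) e e' E : (forall i, eqv (e i) (e' i)) ->
  ev e E A -> ev e' E A.
Proof.
case: (cS) => rf sm tr [cA cM cP cL cX].
elim: A e e' E => //= [t u|t u|h t X|A IHA B IHB|A IHA|h A IHA] e e' E H.
- move=> Hq; apply: (tr _ (tev e u)); last exact: tev_congr.
  by apply: (tr _ (tev e t)) => //; apply: sm; apply: tev_congr.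
- by apply: cL; apply: tev_congr.
- by apply: cX; apply: tev_congr.
- by move=> HI HA; apply: (IHB _ _ _ H); apply: HI; apply: IHA HA => i; apply: sm.
- by move=> HA x; apply: IHA (HA x) => -[|i] /=.
- by move=> HA X; apply: IHA (HA X).
Qed.

Theorem soundness (so : bool) (T : formula so -> Prop) G A :
  (forall B, T B -> forall e E, ev e E B) ->
  derives T G A ->
  forall e E, (forall B, List.In B G -> ev e E B) -> ev e E A.
Proof.
move=> HT; elim=> {G A}.
- by move=> G A /HT HA e E _.
- by move=> G A HA e E; apply.
- by move=> G A B _ IH e E HG /= HA; apply: IH => C /= [<-|/HG].
- by move=> G A B _ IH1 _ IH2 e E HG; apply: (IH1 e E HG); apply: IH2.
- move=> G A _ IH e E HG; apply: contrapT => HA.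
  by apply: (IH e E) => C /= [<-|/HG].
- move=> G A _ IH e E HG x; apply: IH => B /List.in_map_iff [C [<- /HG HC]].
  by rewrite ev_flift.
- by move=> G A t _ IH e E HG; rewrite ev_inst; apply: (IH e E HG).
- move=> h G A _ IH e E HG X; apply: IH => B /List.in_map_iff [C [<- /HG HC]].
  by rewrite ev_fliftS.
- by move=> h G A X _ IH e E HG; rewrite ev_instS; apply: (IH e E HG).
- by move=> G t e E _ /=; case: cS.
- move=> G A t u _ IH1 _ IH2 e E HG; have := IH2 e E HG.
  by rewrite !ev_inst; apply: ev_congr => -[|i] /=; [exact: (IH1 e E HG)|case: cS].
Qed.

End Soundness.

(** * Meaning of the arithmetized principle *)

Section WPHSem.
Variables (so : bool) (S : struc).
Implicit Types (e : nat -> S) (E : nat -> sets S) (x y : S).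

Definition lee x y := ltr x y \/ eqv x y.
Definition two : S := add uno uno.
Definition inset (t s : S) := exists q r, ltr r (pow two t) /\
  eqv s (add (mul (add (mul two q) uno) (pow two t)) r).
Definition pairs (t u : S) := add (mul (add t u) (add t u)) t.
Definition app F (xs : seq S) v := inset (foldr pairs v xs) F.
Definition value F (xs : seq S) v := forall w, app F xs w <-> eqv w v.
Fixpoint increasing x (xs : seq S) R :=
  if xs is y :: ys then ltr x y /\ increasing y ys R else lee x R.
Definition simplex a (xs : seq S) R :=
  if xs is x :: xs' then lee a x /\ increasing x xs' R else True.
Definition coloring d C c a R := forall xs, size xs = d -> simplex a xs R ->
  exists v, ltr v c /\ value C xs v.
Definition subint H a R := forall x, inset x H -> lee a x /\ lee x R.
Definition enumerates s k H :=
  [/\ (forall i, ltr i k -> exists h, inset h H /\ value s [:: i] h),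
      (forall i j x y, ltr i j -> ltr j k -> app s [:: i] x -> app s [:: j] y -> ltr x y) &
      (forall x, inset x H -> exists i, ltr i k /\ app s [:: i] x)].
Definition num n : S := iter n (fun x => add x uno) zer.
Definition wkhom d C s k := forall i xs, size xs = d.+1 -> ltr (add i (num d)) k ->
  (forall j, j < d.+1 -> app s [:: add i (num j)] (nth i xs j)) ->
  exists v, app C (take d xs) v /\ app C (drop 1 xs) v.
Definition ismin m H := inset m H /\ forall x, inset x H -> lee m x.
Definition large (f : S -> S -> Prop) H k :=
  exists m y, [/\ ismin m H, f m y & ltr y k].
Definition wph d f := forall c a, exists R, forall C, coloring d C c a R ->
  exists H k s, [/\ subint H a R, enumerates s k H, wkhom d C s k & large f H k].

Definition logg x y :=
  (eqv x zer /\ eqv y zer) \/ (lee (pow two y) x /\ ltr x (pow two (add y uno))).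
Fixpoint logiter k x y :=
  if k is k'.+1 then exists z, logiter k' x z /\ logg z y else eqv x y.
Definition root n x y :=
  if n is 0 then eqv x y
  else lee (pow y (num n)) x /\ ltr x (pow (add y uno) (num n)).
Definition rootlog n k x y := exists z, logiter k x z /\ root n z y.

Lemma tev_Num e n : tev e (Defs.Num n) = num n.
Proof. by elim: n => //= n ->. Qed.

Lemma tlift1E x e t : tev (econs x e) (tlift 1 t) = tev e t.
Proof. exact: (@tev_lift S [:: x]). Qed.
Lemma tlift2E x y e t : tev (econs x (econs y e)) (tlift 2 t) = tev e t.
Proof. exact: (@tev_lift S [:: x; y]). Qed.

Lemma ev_InSet e E t s : ev e E (InSet so t s) <-> inset (tev e t) (tev e s).
Proof.
rewrite /InSet ev_Ex; split=> [[q]|[q [r [H1 H2]]]].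
  by rewrite ev_Ex => -[r]; rewrite ev_And /= !tlift2E => -[H1 H2]; exists q, r.
by exists q; rewrite ev_Ex; exists r; rewrite ev_And /= !tlift2E.
Qed.

Lemma tev_foldr e v xs : tev e (foldr Pair v xs) = foldr pairs (tev e v) (map (tev e) xs).
Proof. by elim: xs => //= x xs ->. Qed.

Lemma ev_App e E F xs v :
  ev e E (App so F xs v) <-> app (tev e F) (map (tev e) xs) (tev e v).
Proof. by rewrite /App ev_InSet tev_foldr. Qed.

Lemma map_lift k xs e ts : size xs = k ->
  map (tev (ecat xs e)) (map (tlift k) ts) = map (tev e) ts :> seq S.
Proof. by move=> Hk; rewrite -map_comp; apply: eq_map => t /=; rewrite tev_lift. Qed.

Lemma map_lift1 x e ts :
  map (tev (econs x e)) (map (tlift 1) ts) = map (tev e) ts :> seq S.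
Proof. exact: (@map_lift 1 [:: x]). Qed.

Lemma ev_Value e E F xs v :
  ev e E (Value so F xs v) <-> value (tev e F) (map (tev e) xs) (tev e v).
Proof.
rewrite /Value ev_All; split=> H w; have := H w;
  by rewrite ev_Iff ev_App /= !tlift1E map_lift1.
Qed.

Lemma ev_Simplex e E a xs R : ev e E (Simplex so a xs R) <->
  simplex (tev e a) (map (tev e) xs) (tev e R).
Proof.
case: xs => [|x xs]; first by split=> // _; apply: ev_Top.
rewrite /Simplex ev_And ev_Le /=.
suff -> : ev e E (increasing_to so x xs R) <->
  increasing (tev e x) (map (tev e) xs) (tev e R) by [].
by elim: xs x => [|y xs IH] x; rewrite /increasing_to ?ev_Le // ev_And IH.
Qed.

Lemma ev_Coloring e E d C c a R : ev e E (Coloring so d C c a R) <->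
  coloring d (tev e C) (tev e c) (tev e a) (tev e R).
Proof.
rewrite /Coloring ev_AllN.
suff key xs : size xs = d -> ev (ecat xs e) E (Simplex so a⇑d (vars d) R⇑d
    ⊃ Ex (#0 < c⇑(d.+1) /\ Value so C⇑(d.+1) (map (tlift 1) (vars d)) #0))%fm <->
  (simplex (tev e a) xs (tev e R) -> exists v, ltr v (tev e c) /\ value (tev e C) xs v).
  by split=> H xs Hs; have := H xs Hs; rewrite key.
move=> Hs; rewrite ev_Imp ev_Simplex (tev_vars _ Hs) !tev_lift // ev_Ex.
have El v t : tev (econs v (ecat xs e)) (tlift d.+1 t) = tev e t.
  by apply: (@tev_lift S (v :: xs)); rewrite /= Hs.
split=> H /H [v]; rewrite ?ev_And ?ev_Value => Hv; exists v; move: Hv;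
  by rewrite ?ev_And ?ev_Value map_lift1 (tev_vars _ Hs) /= !El.
Qed.

Lemma ev_SubInterval e E H a R : ev e E (SubInterval so H a R) <->
  subint (tev e H) (tev e a) (tev e R).
Proof.
rewrite /SubInterval ev_All; split=> HH x; have := HH x;
  by rewrite ev_Imp ev_And ev_InSet !ev_Le /= !tlift1E.
Qed.

Lemma ev_Enumerates e E s k H : ev e E (Enumerates so s k H) <->
  enumerates (tev e s) (tev e k) (tev e H).
Proof.
rewrite /Enumerates !ev_And ev_AllN !ev_All.
split=> [[H1 [H2 H3]]|[H1 H2 H3]].
  split.
  - move=> i Hi; have := H1 i; rewrite ev_Imp ev_Ex ev_Lt tlift1E => /(_ Hi) [h].
    by rewrite ev_And ev_InSet ev_Value /= !tlift2E; exists h.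
  - move=> i j x y; have := H2 [:: i; j; x; y] erefl.
    by rewrite ev_Imp4 !ev_App /= !(@tev_lift S [:: i; j; x; y]).
  - move=> x; have := H3 x; rewrite ev_Imp ev_Ex ev_InSet tlift1E => {}H3 /H3 [i].
    by rewrite ev_And ev_App /= !tlift2E; exists i.
split; last split.
- move=> i; rewrite ev_Imp ev_Ex ev_Lt tlift1E => /H1 [h Hh]; exists h.
  by rewrite ev_And ev_InSet ev_Value /= !tlift2E.
- case=> [|i [|j [|x [|y [|z l]]]]] Hs; try by discriminate Hs.
  have := H2 i j x y.
  by rewrite ev_Imp4 !ev_App /= !(@tev_lift S [:: i; j; x; y]).
- move=> x; rewrite ev_Imp ev_Ex ev_InSet tlift1E => /H3 [i Hi].
  by exists i; rewrite ev_And ev_App /= !tlift2E.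
Qed.

Lemma ev_Conj e E (As : seq (formula so)) : ev e E (Conj As) <->
  forall j, j < size As -> ev e E (nth Top As j).
Proof.
elim: As => [|A As IH]; first by split=> // _; apply: ev_Top.
rewrite [Conj _]/(And A (Conj As)) ev_And IH.
split=> [[HA H] [|j] // Hj|H]; first exact: H.
by split=> [|j Hj]; [apply: (H 0)|apply: (H j.+1)].
Qed.

Lemma ev_WeaklyHomogeneous e E d C s k : ev e E (WeaklyHomogeneous so d C s k) <->
  wkhom d (tev e C) (tev e s) (tev e k).
Proof.
rewrite /WeaklyHomogeneous ev_AllN.
have key xs i : size xs = d.+1 ->
    ev (ecat (rcons xs i) e) E (#(d.+1) + Defs.Num d < k⇑(d.+2)
      ⊃ Conj [seq App so s⇑(d.+2) [:: #(d.+1) + Defs.Num j]%tm #j | j <- iota 0 d.+1]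
      ⊃ Ex (App so C⇑(d.+3) (map (tlift 1) (take d (vars d.+1))) #0
          /\ App so C⇑(d.+3) (map (tlift 1) (drop 1 (vars d.+1))) #0))%fm <->
    (ltr (add i (num d)) (tev e k) ->
     (forall j, j < d.+1 -> app (tev e s) [:: add i (num j)] (nth i xs j)) ->
     exists v, app (tev e C) (take d xs) v /\ app (tev e C) (drop 1 xs) v).
  move=> Hs; set e' := ecat _ e.
  have Hs2 : size (rcons xs i) = d.+2 by rewrite size_rcons Hs.
  have E1 : e' d.+1 = i.
    by rewrite /e' (ecat_lt _ i) ?Hs2 // nth_rcons Hs ltnn eqxx.
  have E2 t : tev e' t⇑(d.+2) = tev e t by apply: tev_lift.
  have E3 j : j < d.+1 -> e' j = nth i xs j.
    move=> Hj; rewrite /e' (ecat_lt _ i) ?Hs2 1?ltnW // nth_rcons Hs Hj //.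
  have E4 v t : tev (econs v e') t⇑(d.+3) = tev e t.
    by apply: (@tev_lift S (v :: rcons xs i)); rewrite /= Hs2.
  have E5 : map (tev e') (vars d.+1) = xs.
    rewrite -[RHS](mkseq_nth i) Hs -map_comp; apply/eq_in_map => j.
    by rewrite mem_iota => /= /E3.
  have EC : ev e' E (Conj [seq App so s⇑(d.+2) [:: #(d.+1) + Defs.Num j]%tm #j | j <- iota 0 d.+1])
    <-> (forall j, j < d.+1 -> app (tev e s) [:: add i (num j)] (nth i xs j)).
    rewrite ev_Conj size_map size_iota; split=> H j Hj; have := H j Hj.
      rewrite (nth_map 0) ?size_iota // nth_iota // ev_App /= E2 E1 tev_Num add0n.
      by rewrite E3.
    rewrite (nth_map 0) ?size_iota // nth_iota // ev_App /= E2 E1 tev_Num add0n.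
    by rewrite E3.
  have E0 : tev e' (#(d.+1) + Defs.Num d)%tm = add i (num d) by rewrite /= E1 tev_Num.
  rewrite ev_Imp2 EC ev_Ex ev_Lt E0 E2.
  split=> H H1 H2; have [v] := H H1 H2; rewrite ?ev_And => Hv; exists v; move: Hv;
    by rewrite ?ev_And !ev_App !map_lift1 E4 map_take map_drop E5.
split=> [H i xs Hs|H xs].
  by apply/key => //; apply: H; rewrite size_rcons Hs.
case/lastP: xs => // xs i; rewrite size_rcons => -[Hs].
by apply/key => //; apply: H.
Qed.

Lemma ev_IsMin e E m H : ev e E (IsMin so m H) <-> ismin (tev e m) (tev e H).
Proof.
rewrite /IsMin ev_And ev_InSet ev_All; split=> -[H1 H2]; split=> // x; have := H2 x;
  by rewrite ev_Imp ev_InSet ev_Le /= !tlift1E.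
Qed.

Section Graph.
Variables (f : graph so) (g : S -> S -> Prop).
Hypothesis fg : forall e E t u, ev e E (f t u) <-> g (tev e t) (tev e u).

Lemma ev_Large e E H k : ev e E (Large f H k) <-> large g (tev e H) (tev e k).
Proof.
rewrite /Large ev_Ex; split.
  case=> m; rewrite ev_Ex => -[y]; rewrite ev_And ev_IsMin ev_And fg /= !tlift2E.
  by move=> [? [? ?]]; exists m, y.
case=> m [y [H1 H2 H3]]; exists m; rewrite ev_Ex; exists y.
by rewrite ev_And ev_IsMin ev_And fg /= !tlift2E.
Qed.

Lemma ev_WPH e E d : ev e E (WPH d f) <-> wph d g.
Proof.
have key c a R C : ev (econs C (econs R (econs a (econs c e)))) E
    (Coloring so d #0 #3 #2 #1 ⊃ Ex (Ex (Ex (SubInterval so #2 #5 #4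
      /\ (Enumerates so #0 #1 #2
      /\ (WeaklyHomogeneous so d #3 #0 #1
      /\ Large f #2 #1))))))%fm <->
    (coloring d C c a R ->
     exists H k s, [/\ subint H a R, enumerates s k H, wkhom d C s k & large g H k]).
  rewrite ev_Imp ev_Coloring ev_Ex; split=> H /H.
    move=> [X]; rewrite ev_Ex => -[k]; rewrite ev_Ex => -[s].
    rewrite ev_And ev_SubInterval ev_And ev_Enumerates ev_And ev_WeaklyHomogeneous.
    by rewrite ev_Large; move=> [? [? [? ?]]]; exists X, k, s.
  move=> [X [k [s [H1 H2 H3 H4]]]]; exists X; rewrite ev_Ex; exists k; rewrite ev_Ex.
  exists s; rewrite ev_And ev_SubInterval ev_And ev_Enumerates ev_And.
  by rewrite ev_WeaklyHomogeneous ev_Large.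
rewrite /WPH ev_All; split=> H c.
  have := H c; rewrite ev_All => {}H a; have := H a; rewrite ev_Ex => -[R].
  by rewrite ev_All => {}H; exists R => C; apply/key.
rewrite ev_All => a; rewrite ev_Ex; have [R HR] := H c a; exists R.
by rewrite ev_All => C; apply/key; apply: HR.
Qed.

End Graph.

Lemma ev_Log e E t u : ev e E (Log so t u) <-> logg (tev e t) (tev e u).
Proof. by rewrite /Log ev_Or !ev_And ev_Le. Qed.

Lemma ev_LogIter k e E t u : ev e E (LogIter so k t u) <-> logiter k (tev e t) (tev e u).
Proof.
elim: k e t u => [//|k IH] e t u.
rewrite -[LogIter so k.+1 t u]/(Ex (And (LogIter so k (tlift 1 t) (Var 0)) (Log so (Var 0) (tlift 1 u)))) ev_Ex.
split=> -[z].
  by rewrite ev_And IH ev_Log /= !tlift1E; exists z.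
by move=> H; exists z; rewrite ev_And IH ev_Log /= !tlift1E.
Qed.

Lemma ev_Root n e E t u : ev e E (Root so n t u) <-> root n (tev e t) (tev e u).
Proof. by case: n => // n; rewrite /Root ev_And ev_Le /= tev_Num. Qed.

Lemma ev_RootLogIter n k e E t u :
  ev e E (RootLogIter so n k t u) <-> rootlog n k (tev e t) (tev e u).
Proof.
rewrite /RootLogIter ev_Ex; split=> -[z].
  by rewrite ev_And ev_LogIter ev_Root /= !tlift1E; exists z.
by move=> H; exists z; rewrite ev_And ev_LogIter ev_Root /= !tlift1E.
Qed.

End WPHSem.

(** * Stepping up colorings *)

Section Windows.
Variable T : Type.
Implicit Types (h : nat -> T) (K : (nat -> T) -> nat).

Definition win h i : nat -> T := fun j => h (i + j).
Definition chain (r : T -> T -> Prop) h L := forall i, i.+1 < L -> r (h i) (h i.+1).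
Definition whom d K h L := forall i, i + d < L -> K (win h i) = K (win h i.+1).
(** A coloring of [d]-tuples is a function of infinite sequences that depends only
    on the first [d] entries. *)
Definition localc d K := forall h h', (forall j, j < d -> h j = h' j) -> K h = K h'.

(** [Succ] is the alternative that the coloring is designed to force. *)
Definition bounds (r : T -> T -> Prop) d K (b : T -> nat) C (Succ : Prop) :=
  forall h L, chain r h L -> whom d K h L -> Succ \/ L <= b (h 0) + C.

Lemma whom_const d K h L i : whom d K h L -> i + d <= L -> K (win h i) = K (win h 0).
Proof. by move=> H; elim: i => // i IH Hi; rewrite -H ?IH; lia. Qed.

Lemma chain_le r h L L' : L' <= L -> chain r h L -> chain r h L'.
Proof. by move=> H Hc i Hi; apply: Hc; apply: leq_trans H. Qed.

End Windows.

Section StepUp.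
Variables (X Y : Type) (rX : X -> X -> Prop) (rY : Y -> Y -> Prop).
Variables (Delta : X -> X -> Y) (m : nat) (K : (nat -> Y) -> nat).
Hypothesis m_gt1 : 1 < m.

Definition diffs (w : nat -> X) j := Delta (w j) (w j.+1).

(** On a weakly homogeneous sequence the differences increase throughout, decrease
    throughout, or are never related; [K] bounds the first two cases. *)
Definition stepc (w : nat -> X) : nat :=
  let D := diffs w in
  if `[< rY (D 0) (D 1) >] then 3 * K D
  else if `[< rY (D 1) (D 0) >] then 3 * K (fun j => D (m.-1 - j)) + 1 else 2.

Lemma stepc_lt N : (forall w, K w < N) -> forall w, stepc w < 3 * N.
Proof.
move=> HK w; rewrite /stepc; set D := diffs w.
have := HK D; have := HK (fun j => D (m.-1 - j)).
by case: ifP => _; [lia|case: ifP => _; lia].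
Qed.

Hypothesis Kloc : localc m K.

Lemma stepc_local : localc m.+1 stepc.
Proof.
move=> h h' H.
have HD j : j < m -> diffs h j = diffs h' j by move=> Hj; rewrite /diffs !H // ltnS ltnW.
rewrite /stepc (HD 0) 1?(HD 1) ?(Kloc HD) //; last exact: ltnW.
case: ifP => // _; case: ifP => // _; congr (3 * _ + 1); apply: Kloc => j Hj.
by apply: HD; lia.
Qed.

Variables (bX : X -> nat) (bY : Y -> nat) (C C2 : nat) (Succ : Prop).
Hypothesis HY : bounds rY m K bY C Succ.
Hypothesis bXY : forall x y, rX x y -> bY (Delta x y) <= bX x.
Hypothesis bmono : forall d d', rY d d' -> bY d <= bY d'.
Hypothesis Heq : forall h L, chain rX h L ->
  (forall i, i.+2 < L -> ~ rY (diffs h i) (diffs h i.+1) /\ ~ rY (diffs h i.+1) (diffs h i)) ->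
  Succ \/ L <= bX (h 0) + C2.

(** The summand [m] pays for the end of the sequence, where no full window starts; [C] and [C2]
    cover the related and the unrelated differences. *)
Lemma step_bounds : bounds rX m.+1 stepc bX (C + C2 + m).+2 Succ.
Proof.
move=> h L hc hw.
have [HL|HL] := leqP L m.+1; first by right; lia.
have HK i : i + m.+1 <= L -> stepc (win h i) = stepc (win h 0).
  exact: whom_const hw.
set D := diffs h.
have Dw i : diffs (win h i) = win D i.
  by apply: funext => j; rewrite /diffs /win addnS.
have r01 : rX (h 0) (h 1) by apply: hc; lia.
have hb : bY (D 0) <= bX (h 0) by apply: bXY.
have D0 i : win D i 0 = D i by rewrite /win addn0.
have D1 i : win D i 1 = D i.+1 by rewrite /win addn1.
have st i : stepc (win h i) = if `[< rY (D i) (D i.+1) >] then 3 * K (win D i)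
  else if `[< rY (D i.+1) (D i) >] then 3 * K (fun j => D (i + (m.-1 - j))) + 1 else 2.
  by rewrite /stepc Dw D0 D1.
(* Windows of [m.+1] entries compare only the first [L - m.-1] differences. *)
set L' := L - m.-1.
have := st 0; case: ifP => [_ E0|_].
  have Hr i : i + m.+1 <= L -> rY (D i) (D i.+1) /\ K (win D i) = K (win D 0).
    move=> /HK; rewrite E0 st; case: asboolP => [Hr|_]; first by split => //; lia.
    by case: ifP => _; lia.
  have [||HS|HS] := HY (h := D) (L := L').
  - by move=> i Hi; apply: (Hr i _).1; rewrite /L' in Hi; lia.
  - by move=> i Hi; rewrite (Hr i _).2 ?(Hr i.+1 _).2 //; rewrite /L' in Hi; lia.
  - by left.
  - by right; rewrite /L' in HS; lia.
case: ifP => [_ E0|_ E0].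
  have Hr i : i + m.+1 <= L -> rY (D i.+1) (D i) /\
      K (fun j => D (i + (m.-1 - j))) = K (fun j => D (0 + (m.-1 - j))).
    move=> /HK; rewrite E0 st; case: ifP => [_|_]; first by lia.
    by case: asboolP => [Hr|_]; [split => //; lia|lia].
  (* Read backwards, decreasing differences form a chain; [stepc] applies [K] to reversed windows
     for this reason. The first term is now the smallest difference, and [bmono] compares its bound
     with that of [D 0]. *)
  pose G t := D (L'.-1 - t).
  have HG i : i + m <= L' -> K (win G i) = K (fun j => D (0 + (m.-1 - j))).
    move=> Hi; rewrite -(Hr (L' - m - i) _).2; last by rewrite /L'; lia.
    apply: Kloc => j Hj; rewrite /win /G; congr D; lia.
  have [||HS|HS] := HY (h := G) (L := L').
  - move=> i Hi; rewrite /G.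
    have -> : L'.-1 - i = (L'.-1 - i.+1).+1 by lia.
    by apply: (Hr _ _).1; rewrite /L' in Hi *; lia.
  - by move=> i Hi; rewrite !HG //; lia.
  - by left.
  right; suff : bY (G 0) <= bY (D 0) by rewrite /L' in HS; lia.
  rewrite /G subn0; have : L'.-1 + m <= L by rewrite /L'; lia.
  elim: (L'.-1) => // t IH Ht; apply: leq_trans (IH _); last by lia.
  by apply: bmono; apply: (Hr _ _).1; lia.
have [||HS|HS] := Heq (h := h) (L := L - m.-1).
- by apply: chain_le hc; apply: leq_subr.
- move=> i Hi; have := HK i; rewrite E0 st => /(_ _) HH.
  have : i + m.+1 <= L by lia.
  move=> /HH; case: asboolP => [_|H1]; first by lia.
  by case: asboolP => [_|H2]; [lia|].
- by left.
- by right; lia.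
Qed.

End StepUp.

(** * Digits *)

Section Digits.
Variable b : nat.
Hypothesis b_gt1 : 1 < b.

(** For [x < y], the highest place where the base [b] expansions differ. *)
Definition topdiff x y := find (fun i => x %/ b ^ i.+1 == y %/ b ^ i.+1) (iota 0 y).

Lemma topdiff_le x y i : i < y -> x %/ b ^ i.+1 = y %/ b ^ i.+1 -> topdiff x y <= i.
Proof.
move=> Hi E; rewrite leqNgt; apply/negP => /(before_find 0).
by rewrite nth_iota // add0n E eqxx.
Qed.

Lemma topdiffP x y : x < y ->
  [/\ topdiff x y < y, x %/ b ^ (topdiff x y).+1 = y %/ b ^ (topdiff x y).+1 &
      x %/ b ^ topdiff x y < y %/ b ^ topdiff x y].
Proof.
move=> xy; have yb i : y <= i -> y < b ^ i by move=> H; apply: leq_ltn_trans H (ltn_expl _ b_gt1).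
have H : has (fun i => x %/ b ^ i.+1 == y %/ b ^ i.+1) (iota 0 y).
  apply/hasP; exists y.-1; first by rewrite mem_iota; lia.
  by rewrite !divn_small // prednK; try lia; have := yb y; lia.
have Hl : topdiff x y < y by move: H; rewrite has_find size_iota.
split=> //; first by move: (nth_find 0 H); rewrite nth_iota // add0n => /eqP.
rewrite ltn_neqAle leq_div2r ?(ltnW xy) // andbT; apply/eqP.
case E : (topdiff x y) => [|i]; first by rewrite !divn1; lia.
have : i < topdiff x y by rewrite E.
by move=> /(before_find 0); rewrite nth_iota ?add0n; [move=> /eqP|lia].
Qed.

Lemma topdiff_bound x y e : x < y -> y < b ^ e -> topdiff x y < e.
Proof.
move=> xy ye; case: e ye => [|e] ye; first by move: ye; rewrite expn0; lia.
have [e_y|y_e] := ltnP e y; last by have [] := topdiffP xy; lia.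
by rewrite ltnS; apply: topdiff_le => //; rewrite !divn_small //; lia.
Qed.

(** Above this place the expansions agree, so the order of the quotients is decided by their last
    digits. *)
Lemma topdiff_digit x y : x < y ->
  (x %/ b ^ topdiff x y) %% b < (y %/ b ^ topdiff x y) %% b.
Proof.
case/topdiffP => _; rewrite expnSr !divnMA => E.
by rewrite [X in X < _](divn_eq _ b) [X in _ < X](divn_eq _ b) E ltn_add2l.
Qed.

End Digits.

(** * Colorings of numbers below a tower by digits *)

Fixpoint tow j q := if j is i.+1 then 2 ^ tow i q else q.

Definition below Q j x y := x < y /\ y < tow j Q.

(** Limits weakly homogeneous sequences below a tower over [b ^ e] to length about [b], with a
    number of colors that depends on [e] and [j] only. In [col] the base [b] is a value of [g],
    hence unbounded, while [e] is fixed. *)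
Fixpoint fillc b e j : (nat -> nat) -> nat :=
  if j is i.+1 then stepc (below (b ^ e) i) (topdiff 2) i.+2 (fillc b e i)
  else fun w => minn (topdiff b (w 0) (w 1)) e.

Lemma fillc_local b e j : localc j.+2 (fillc b e j).
Proof.
elim: j => [h h' H|j IH]; first by rewrite /= !H.
exact: stepc_local.
Qed.

Lemma fillc_lt b e j w : fillc b e j w < 3 ^ j * e.+1.
Proof.
elim: j w => [|j IH] w; first by rewrite mul1n /= ltnS geq_minr.
by rewrite expnS -mulnA; apply: stepc_lt.
Qed.

(** Iterates the constant of [step_bounds] with [m = i.+2] and [C2 = s]. *)
Fixpoint cst s j := if j is i.+1 then (cst s i + s + i.+2).+2 else s.

(** For pairs, a constant top place makes the digits there strictly increase, and there are [b]
    digits; the place is below [e], so the truncation in the color loses nothing. In the step no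
    differences are unrelated: distinct ones both lie under the lower tower, and equal ones would
    let a binary digit increase twice. *)
Lemma fillc_bounds b e j (Succ : Prop) : 1 < b ->
  bounds (below (b ^ e) j) j.+2 (fillc b e j) (fun=> b) (cst 2 j) Succ.
Proof.
move=> b1; elim: j => [|j IH].
  move=> h L hc hw; right.
  have [//|HL] := leqP L 1; first by lia.
  set t := topdiff b (h 0) (h 1).
  have ht i : i.+1 < L -> topdiff b (h i) (h i.+1) = t.
    move=> Hi; have := whom_const (i := i) hw; rewrite /= /win !addn0 !addn1.
    have [H1 H2] := hc _ Hi; have [H3 H4] := hc _ HL.
    have := topdiff_bound b1 H1 H2; have := topdiff_bound b1 H3 H4; rewrite -/t.
    by move=> ? ? H; have := H _; lia.
  pose dg i := (h i %/ b ^ t) %% b.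
  have hd i : i.+1 < L -> dg i < dg i.+1.
    move=> Hi; have [H1 _] := hc _ Hi; have := topdiff_digit b1 H1.
    by rewrite ht.
  have hi i : i < L -> i <= dg i.
    by elim: i => // i IH Hi; have := hd i Hi; have := IH (ltnW Hi); lia.
  have := hi L.-1; have : dg L.-1 < b by rewrite /dg ltn_mod; lia.
  by lia.
apply: (@step_bounds _ _ _ _ _ j.+2 _ _ _ (fun=> b) (fun=> b) (cst 2 j) 2) => //.
- exact: fillc_local.
- move=> h L hc H; have [//|HL] := leqP L 2; first by right; lia.
  exfalso; have [H1 H2] := hc 0 (ltnW HL); have [H3 H4] := hc 1 HL.
  have [N1 N2] := H 0 HL; rewrite /diffs in N1 N2.
  have B1 := topdiff_bound (leqnn 2) H1 H2; have B2 := topdiff_bound (leqnn 2) H3 H4.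
  have D1 := topdiff_digit (leqnn 2) H1; have D2 := topdiff_digit (leqnn 2) H3.
  have [E|E|E] := ltngtP (topdiff 2 (h 0) (h 1)) (topdiff 2 (h 1) (h 2)).
  + by apply: N1.
  + by apply: N2.
  move: D1 D2; rewrite E.
  by have := ltn_pmod (h 2 %/ 2 ^ topdiff 2 (h 1) (h 2)) (isT : 0 < 2); lia.
Qed.

(** * Common prefixes *)

Section Lcp.
Implicit Types s t u : seq nat.

Fixpoint lcp s t : seq nat :=
  match s, t with
  | x :: s', y :: t' => if x == y then x :: lcp s' t' else [::]
  | _, _ => [::]
  end.

Definition sprefix s t := prefix s t && (size s < size t).

Lemma lcp_prefixl s t : prefix (lcp s t) s.
Proof. by elim: s t => [|x s IH] [|y t] //=; case: eqP => //= _; rewrite eqxx IH. Qed.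

Lemma lcp_prefixr s t : prefix (lcp s t) t.
Proof. by elim: s t => [|x s IH] [|y t] //=; case: eqP => //= ->; rewrite eqxx IH. Qed.

Lemma nth_lcp_neq s t : size (lcp s t) < size s -> size (lcp s t) < size t ->
  nth 0 s (size (lcp s t)) != nth 0 t (size (lcp s t)).
Proof.
by elim: s t => [|x s IH] [|y t] //=; case: eqP => //= [_|/eqP //]; rewrite !ltnS; apply: IH.
Qed.

Lemma prefix_nth s t i : prefix s t -> i < size s -> nth 0 s i = nth 0 t i.
Proof. by case/prefixP => u -> Hi; rewrite nth_cat Hi. Qed.

Lemma prefix_cmp s t u : prefix s u -> prefix t u -> size s <= size t -> prefix s t.
Proof.
by rewrite !prefixE => /eqP Hs /eqP Ht Hst; rewrite -{1}Ht take_takel // Hs.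
Qed.

Lemma prefix_size_eq s t : prefix s t -> size s = size t -> s = t.
Proof. by rewrite prefixE => /eqP {2}<- E; rewrite E take_size. Qed.

Lemma prefix_mem s t x : prefix s t -> x \in s -> x \in t.
Proof. by case/prefixP => u ->; rewrite mem_cat => ->. Qed.

Lemma prefix_sorted s t : prefix s t -> sorted ltn t -> sorted ltn s.
Proof. by rewrite prefixE => /eqP <-; apply: take_sorted. Qed.

End Lcp.

Definition lst (s : seq nat) := nth 0 s (size s).-1.

Section Sorted.
Implicit Types s : seq nat.

Lemma sorted_nth s i j : sorted ltn s -> j < size s -> i < j -> nth 0 s i < nth 0 s j.
Proof. by move=> Hs Hj Hi; apply: sorted_ltn_nth ltn_trans _ _ Hs _ _ _ _ _ => //; apply: ltn_trans Hj. Qed.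

Lemma sorted_nth_le s i j : sorted ltn s -> j < size s -> i <= j -> nth 0 s i <= nth 0 s j.
Proof.
move=> Hs Hj; rewrite leq_eqVlt => /orP [/eqP -> //|Hi].
by apply: ltnW; apply: sorted_nth.
Qed.

Lemma sorted_nth_inj s i j : sorted ltn s -> i < size s -> j < size s ->
  nth 0 s i = nth 0 s j -> i = j.
Proof.
move=> Hs Hi Hj E; have [H|H|//] := ltngtP i j.
  by have := sorted_nth Hs Hj H; lia.
by have := sorted_nth Hs Hi H; lia.
Qed.

Lemma sorted_lst s x : sorted ltn s -> x \in s -> x <= lst s.
Proof.
move=> Hs Hx; have s0 : 0 < size s by case: s Hx {Hs}.
rewrite /lst -(nth_index 0 Hx); apply: sorted_nth_le => //; first by rewrite prednK.
by rewrite -ltnS prednK // index_mem.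
Qed.

Lemma lst_mem s : s != [::] -> lst s \in s.
Proof. by move=> H; rewrite mem_nth // prednK //; case: s H. Qed.

Lemma sprefix_lst s t x : sorted ltn t -> sprefix s t -> x \in s -> x < lst t.
Proof.
move=> Ht /andP [Hp Hl] /(nthP 0) [i Hi <-].
rewrite (prefix_nth Hp Hi); apply: sorted_nth => //; move: (size s) (size t) Hi Hl => *; lia.
Qed.

End Sorted.

(** * Scattered sequences *)

Definition pr p u := 2 ^ p * u.*2.+1.

Lemma pr_log p u : logn 2 (pr p u) = p.
Proof.
rewrite lognM ?expn_gt0 // pfactorK // lognE /= dvdn2 /= odd_double /=.
by rewrite addn0.
Qed.

Section Scatter.
Variable theta : nat -> bool.
Implicit Types (D : seq nat).

(** The Sigma_j relation with matrix [theta], its quantifiers bounded by elements of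
    [D] at increasing positions after [i].  They skip every other element to leave
    room for the codes of pairs. *)
Fixpoint T j (D : seq nat) i q : bool :=
  if j is j'.+1 then has (fun u => ~~ T j' D i.+2 (pr q u)) (iota 0 (nth 0 D i.+1))
  else theta q.

(** The bound on [t + 2 * j] says that all entries consulted by [T j D t.+1] exist. Hence witnesses
    persist when [D] is extended. *)
Definition wit D j p t :=
  (t + 2 * j < size D) && ((p < nth 0 D t) &&
    has (fun u => ~~ T j D t.+1 (pr p u)) (iota 0 (nth 0 D t))).

Definition haswit D j p := has (wit D j p) (iota 0 (size D)).
Definition wpos D j p :=
  if haswit D j p then find (wit D j p) (iota 0 (size D)) else 0.

(** [nxt] jumps past the least witnesses for all [p] below the current element, so
    [B j D] is the part of [D] that is scattered at level [j.+1]. *)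
Definition nxt j D r := maxn r.+1 (\max_(p <- iota 0 (nth 0 D r)) wpos D j p).
Definition idx j D i := iter i (nxt j D) 0.
(** Jumps never pass the end of [D], since first witnesses are positions in [D]. So [B j D] ends
    with the last entry of [D], even if a longer sequence would skip this entry. *)
Definition len j D := (find (fun i => (size D).-1 <= idx j D i) (iota 0 (size D))).+1.
Definition B j D := mkseq (fun i => nth 0 D (idx j D i)) (len j D).

Lemma T_prefix j D D' i q : prefix D D' -> i + 2 * j <= size D -> T j D i q = T j D' i q.
Proof.
move=> HD; elim: j i q => //= j IH i q Hi.
rewrite (prefix_nth HD); last by lia.
by apply: eq_has => u; rewrite IH //; lia.
Qed.

Lemma wit_prefix j D D' p t : prefix D D' -> t + 2 * j < size D ->
  wit D j p t = wit D' j p t.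
Proof.
move=> HD Ht; rewrite /wit Ht (leq_trans Ht) ?(size_prefix HD) //=.
rewrite (prefix_nth HD); last by lia.
by congr (_ && _); apply: eq_has => u; rewrite (T_prefix _ HD) //; lia.
Qed.

Lemma wit_mono j D D' p t : prefix D D' -> wit D j p t -> wit D' j p t.
Proof. by move=> HD Hw; rewrite -(wit_prefix _ HD) //; case/andP: Hw. Qed.

Lemma haswitP j D p : reflect (exists t, wit D j p t) (haswit D j p).
Proof.
apply: (iffP hasP) => [[t _ Ht]|[t Ht]]; first by exists t.
by exists t => //; rewrite mem_iota; case/andP: Ht; lia.
Qed.

Lemma haswit_mono j D D' p : prefix D D' -> haswit D j p -> haswit D' j p.
Proof. by move=> HD /haswitP [t /(wit_mono HD) Ht]; apply/haswitP; exists t. Qed.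

Lemma wpos_wit j D p : haswit D j p -> wit D j p (wpos D j p).
Proof.
move=> H; rewrite /wpos H; have := nth_find 0 H.
by rewrite nth_iota // -[X in _ < X](size_iota 0 (size D)) -has_find.
Qed.

Lemma wpos_min j D p t : wit D j p t -> wpos D j p <= t.
Proof.
move=> Ht; rewrite /wpos; case: ifP => // _; rewrite leqNgt; apply/negP => H.
have := before_find 0 H; rewrite nth_iota ?add0n ?Ht //.
by case/andP: Ht; lia.
Qed.

Lemma wpos_lt j D p : D != [::] -> wpos D j p < size D.
Proof.
move=> HD; have [H|/negPf H] := boolP (haswit D j p).
  by have /andP[] := wpos_wit H; lia.
by rewrite /wpos H; case: D HD {H}.
Qed.

Lemma wpos_prefix j D D' p : prefix D D' -> haswit D j p = haswit D' j p ->
  wpos D j p = wpos D' j p.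
Proof.
move=> HD E; have [H|/negPf H] := boolP (haswit D j p); last by rewrite /wpos -E H.
have H' : haswit D' j p by rewrite -E.
have W := wpos_wit H; have W' := wpos_wit H'.
have := wpos_min (wit_mono HD W); have : wpos D j p <= wpos D' j p; last by lia.
(* A first witness of [D'] that fits into [D] is one of [D]; one that does not fit lies beyond the
   witness of [D]. *)
have [W2|W2] := ltnP (wpos D' j p + 2 * j) (size D).
  by apply: wpos_min; rewrite (wit_prefix _ HD).
by case/andP: W; lia.
Qed.

Lemma nxt_gt j D r : r < nxt j D r.
Proof. exact: leq_maxl. Qed.

Lemma nxt_lt j D r : r.+1 < size D -> nxt j D r < size D.
Proof.
move=> Hr; rewrite /nxt gtn_max Hr /=.
have D0 : D != [::] by case: D Hr.
elim: (iota _ _) => [|p s IH]; first by rewrite big_nil; lia.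
by rewrite big_cons gtn_max wpos_lt.
Qed.

Lemma nxt_wpos j D r p : p < nth 0 D r -> wpos D j p <= nxt j D r.
Proof.
move=> Hp; apply: leq_trans (leq_maxr _ _).
by apply: (@leq_bigmax_seq _ _ (fun=> true) (wpos D j)) => //; rewrite mem_iota.
Qed.

Lemma idxS j D i : idx j D i.+1 = nxt j D (idx j D i). Proof. by []. Qed.

Lemma idx_lt j D i i' : i < i' -> idx j D i < idx j D i'.
Proof.
elim: i' => // i' IH; rewrite ltnS leq_eqVlt idxS => /orP [/eqP -> |/IH H].
  exact: nxt_gt.
exact: ltn_trans H (nxt_gt _ _ _).
Qed.

Lemma idx_ge j D i : i <= idx j D i.
Proof. by elim: i => // i IH; rewrite idxS; have := nxt_gt j D (idx j D i); lia. Qed.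

Section Nonempty.
Variables (j : nat) (D : seq nat).
Hypotheses (D0 : D != [::]) (sD : sorted ltn D).

Let szD : 0 < size D. Proof. by case: D D0. Qed.

Lemma len_has : has (fun i => (size D).-1 <= idx j D i) (iota 0 (size D)).
Proof.
apply/hasP; exists (size D).-1; first by rewrite mem_iota; lia.
exact: idx_ge.
Qed.

Lemma idx_lt_len i : i.+1 < len j D -> idx j D i < (size D).-1.
Proof.
rewrite /len ltnS => Hi; have := before_find 0 Hi.
have Hs := Hi; rewrite nth_iota ?add0n; first by lia.
by move: len_has; rewrite has_find size_iota; lia.
Qed.

Lemma idx_last : idx j D (len j D).-1 = (size D).-1.
Proof.
rewrite /len /=; set i := find _ _.
have Hi : i < size D by move: len_has; rewrite has_find size_iota.
have : (size D).-1 <= idx j D i by have := nth_find 0 len_has; rewrite nth_iota.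
suff : idx j D i < size D by lia.
case E : i => [|i'] //; rewrite idxS; apply: nxt_lt.
by have := @idx_lt_len i'; rewrite /len -/i E; lia.
Qed.

Lemma idx_size i : i < len j D -> idx j D i < size D.
Proof.
move=> Hi; have : i <= (len j D).-1 by lia.
rewrite leq_eqVlt => /orP [/eqP ->|H]; first by rewrite idx_last; lia.
by have := @idx_lt_len i; rewrite -ltn_predRL => /(_ H); lia.
Qed.

Lemma size_B : size (B j D) = len j D. Proof. by rewrite size_mkseq. Qed.

Lemma nth_B i : i < len j D -> nth 0 (B j D) i = nth 0 D (idx j D i).
Proof. exact: nth_mkseq. Qed.

Lemma sorted_B : sorted ltn (B j D).
Proof.
apply/(sortedP 0) => i; rewrite size_B => Hi; rewrite !nth_B //; last exact: ltnW.
by apply: sorted_nth => //; [apply: idx_size|apply: idx_lt].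
Qed.

Lemma B_mem x : x \in B j D -> x \in D.
Proof.
move=> /(nthP 0) [i]; rewrite size_B => Hi <-; rewrite nth_B //.
by apply: mem_nth; apply: idx_size.
Qed.

Lemma head_B : nth 0 (B j D) 0 = nth 0 D 0.
Proof. by rewrite nth_B. Qed.

Lemma lst_B : lst (B j D) = lst D.
Proof. by rewrite /lst size_B nth_B ?idx_last // /len. Qed.

Lemma closed_B i p t : i.+1 < size (B j D) -> p < nth 0 (B j D) i -> wit D j p t ->
  exists2 t', wit D j p t' & nth 0 D t' <= nth 0 (B j D) i.+1.
Proof.
rewrite size_B => Hi; rewrite !nth_B //; last exact: ltnW.
move=> Hp Ht; exists (wpos D j p); first by apply: wpos_wit; apply/haswitP; exists t.
by apply: sorted_nth_le => //; [apply: idx_size|apply: nxt_wpos].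
Qed.

End Nonempty.

Lemma B_neq0 j D : B j D != [::].
Proof. by rewrite -size_eq0 size_mkseq. Qed.

Definition cnt j D v := count (fun p => ~~ haswit D j p) (iota 0 v).

Lemma cnt_le j D v : cnt j D v <= v.
Proof. by rewrite -[X in _ <= X](size_iota 0) count_size. Qed.

Section Change.
Variables (j : nat) (D D' : seq nat).
Hypotheses (D0 : D != [::]) (sD' : sorted ltn D') (DD : sprefix D D').
Let P := lcp (B j D) (B j D').

Let sD : sorted ltn D.
Proof. by apply: prefix_sorted sD'; case/andP: DD. Qed.
Let pD : prefix D D'. Proof. by case/andP: DD. Qed.
Let D'0 : D' != [::].
Proof. by case/andP: DD => _; case: D'. Qed.

Lemma lcpB_neq0 : P != [::].
Proof.
have H : nth 0 (B j D) 0 = nth 0 (B j D') 0.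
  by rewrite !head_B // (prefix_nth pD) //; case: D D0.
by rewrite /P; move: H (B_neq0 j D) (B_neq0 j D'); case: B => // x s; case: B => // y t /= ->; rewrite eqxx.
Qed.

(** The list [B j D'] ends with the last entry of [D'], which exceeds all entries of [D]; so it is
    no prefix of [B j D]. *)
Lemma lcpB_size : size P < size (B j D').
Proof.
rewrite ltnNge; apply/negP => H.
have E : P = B j D'.
  apply: prefix_size_eq (lcp_prefixr _ _) _; apply/eqP.
  by rewrite eqn_leq H size_prefix ?lcp_prefixr.
have : lst D' \in B j D.
  apply: (prefix_mem (lcp_prefixl _ (B j D'))); rewrite -/P E.
  by have := lst_mem (B_neq0 j D'); rewrite lst_B.
by move=> /(B_mem D0 sD) H2; have := sprefix_lst sD' DD H2; rewrite ltnn.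
Qed.

(** Extending [D] only adds witnesses.  If [B j D] and [B j D'] separate after [P],
    a number below the last element of [P] must have gained its first witness. *)
Lemma cnt_decr : size P < size (B j D) -> cnt j D' (lst P) < cnt j D (lst P).
Proof.
move=> HP; have HP' := lcpB_size; have P0 := lcpB_neq0.
have sP : 0 < size P by case: P P0.
(* An entry determines its position, since [D'] is strictly increasing and extends [D]. *)
have Eidx i : i < size P -> idx j D i = idx j D' i.
  move=> Hi.
  have H1 := prefix_nth (lcp_prefixl (B j D) (B j D')) Hi.
  have H2 := prefix_nth (lcp_prefixr (B j D) (B j D')) Hi.
  rewrite size_B in HP; rewrite size_B in HP'.
  have I1 : i < len j D by lia.
  have I2 : i < len j D' by lia.
  rewrite nth_B // in H1; rewrite nth_B // in H2.
  apply: (sorted_nth_inj sD').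
  - by apply: leq_trans (size_prefix pD); apply: idx_size.
  - exact: idx_size.
  by rewrite -H2 H1 -(prefix_nth pD) //; apply: idx_size.
have Ei := Eidx (size P).-1; rewrite ltn_predL in Ei; have {}Ei := Ei sP.
have Hr : idx j D (size P).-1 < size D.
  by apply: idx_size => //; rewrite size_B in HP; lia.
have EP : lst P = nth 0 D (idx j D (size P).-1).
  rewrite /lst (prefix_nth (lcp_prefixl (B j D) (B j D'))) -/P ?ltn_predL //.
  by rewrite nth_B //; rewrite size_B in HP; lia.
have sub p : ~~ haswit D' j p -> ~~ haswit D j p.
  by apply: contra; apply: haswit_mono.
have [/hasP [p Hp /andP [Np Wp]]|] :=
    boolP (has (fun p => ~~ haswit D j p && haswit D' j p) (iota 0 (lst P))).
  rewrite /cnt -!size_filter.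
  have : size [seq x <- iota 0 (lst P) | ~~ haswit D j x] =
    size [seq x <- iota 0 (lst P) | ~~ haswit D' j x] +
    size [seq x <- iota 0 (lst P) | ~~ haswit D j x && haswit D' j x].
    rewrite !size_filter -count_predUI.
    rewrite [X in _ + X](_ : _ = 0); last first.
      by apply/eqP; rewrite -leqn0 leqNgt -has_count; apply/hasP => -[x _ /=]; case: haswit; rewrite ?andbF.
    rewrite addn0; apply: eq_count => x /=.
    by case E : (haswit D' j x) => /=; [rewrite andbT|rewrite (sub x) ?E].
  have : 0 < size [seq x <- iota 0 (lst P) | ~~ haswit D j x && haswit D' j x].
    by rewrite size_filter -has_count; apply/hasP; exists p => //; rewrite Np Wp.
  by lia.
move=> /hasPn H; exfalso.
have Hh p : p < lst P -> wpos D j p = wpos D' j p.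
  move=> Hp; apply: wpos_prefix => //.
  have := H p; rewrite mem_iota => /(_ Hp).
  case E : (haswit D j p) => /=; first by rewrite (haswit_mono pD E).
  by move/negPf.
(* Without new witnesses the jump from the last entry of [P] is the same in both, so they would
   agree on one entry more than their common prefix. *)
have E1 : nxt j D (idx j D (size P).-1) = nxt j D' (idx j D' (size P).-1).
  rewrite -Ei /nxt -(prefix_nth pD) // -EP; congr maxn.
  apply: eq_big_seq => p; rewrite mem_iota => Hp; exact: Hh.
rewrite -!idxS prednK // in E1.
have := nth_lcp_neq HP HP'; rewrite -/P !nth_B -?size_B // E1 => /negP; apply.
by rewrite (prefix_nth pD) // -E1; apply: idx_size => //; rewrite -size_B.
Qed.

End Change.
End Scatter.

(** * The coloring of tuples of initial parts *)

Section Main.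
Variables (theta : nat -> bool) (z0 c : nat).
Implicit Types D E : seq nat.

(** This growth leaves room for pairs of smaller numbers ([pr_lt]) and closes the cuts under
    exponentiation. Yet the logarithm of the next term is only three times the present one, which
    bounds sequences that stay in one stage. *)
Definition Z i := iter i (fun z => 2 ^ (3 * z)) z0.

Lemma Z_ltS i : Z i < Z i.+1.
Proof. by apply: leq_ltn_trans (ltn_expl (3 * Z i) _) => //; lia. Qed.

Lemma Z_lt i j : i < j -> Z i < Z j.
Proof.
elim: j => // j IH; rewrite ltnS leq_eqVlt => /orP [/eqP -> |/IH H]; first exact: Z_ltS.
exact: ltn_trans H (Z_ltS j).
Qed.

Lemma Z_ge i : i <= Z i.
Proof. by elim: i => // i IH; apply: leq_ltn_trans IH (Z_ltS i). Qed.

Section Levels.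
Variable R : nat.

Fixpoint Good j E : Prop :=
  if j is j'.+1 then E != [::] /\ exists2 D, Good j' D & prefix E (B theta j' D)
  else exists2 n, E = mkseq Z n.+1 & Z n <= R.

Lemma Good_facts j D : Good j D -> [/\ D != [::], sorted ltn D, nth 0 D 0 = z0 &
  forall x : nat, x \in D -> (exists i, x = Z i) /\ x <= R].
Proof.
elim: j D => [|j IH] E.
  move=> [n -> Hn]; split=> //.
    apply/(sortedP 0) => i; rewrite size_mkseq => Hi.
    by rewrite !nth_mkseq //; [apply: Z_ltS|apply: ltnW].
  move=> x /mapP [i]; rewrite mem_iota => Hi ->; split; first by exists i.
  apply: leq_trans Hn; have [->//|H] := eqVneq i n.
  by apply: ltnW; apply: Z_lt; lia.
move=> [E0 [D /IH [D0 sD hD aD] HE]]; split=> //.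
- by apply: (prefix_sorted HE); apply: sorted_B.
- by rewrite (prefix_nth HE) ?head_B //; case: E E0 {HE}.
- by move=> x /(prefix_mem HE) /(B_mem D0 sD) /aD.
Qed.

Definition rG j D D' := [/\ Good j D, Good j D' & sprefix D D'].
Definition dB j D D' := lcp (B theta j D) (B theta j D').

Lemma dB_mem j D D' x : Good j D -> x \in dB j D D' -> x \in D.
Proof.
move=> /Good_facts [D0 sD _ _] /(prefix_mem (lcp_prefixl _ _)) H.
exact: B_mem H.
Qed.

Lemma rG_neq0 j D D' : rG j D D' -> dB j D D' != [::].
Proof.
move=> [/Good_facts [D0 sD _ _] /Good_facts [D'0 sD' _ _] S]; exact: lcpB_neq0.
Qed.

Lemma rG_lst j D D' : rG j D D' -> lst (dB j D D') <= lst D.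
Proof.
move=> H; have [G _ _] := H; have [_ sD _ _] := Good_facts G; apply: sorted_lst => //.
by apply: dB_mem G _; apply: lst_mem; apply: rG_neq0.
Qed.

Lemma rG_Good j D D' : rG j D D' -> Good j.+1 (dB j D D').
Proof.
move=> H; split; first exact: rG_neq0.
by have [G _ _] := H; exists D => //; apply: lcp_prefixl.
Qed.

(** Neighboring common parts are prefixes of one list, so equal sizes make them all the same list
    [P]. Each further term then gives a first witness to some number below [lst P] ([cnt_decr]),
    which happens at most [lst P] times. *)
Lemma rG_eq_chain j h L : chain (rG j) h L ->
  (forall i, i.+2 < L ->
     size (diffs (dB j) h i) = size (diffs (dB j) h i.+1)) ->
  L <= lst (h 0) + 3.
Proof.
move=> hc hs; have [|L3] := leqP L 3; first by lia.
pose P := dB j (h 0) (h 1).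
have hP i : i.+1 < L -> dB j (h i) (h i.+1) = P.
  elim: i => // i IH Hi; rewrite -IH ?(ltnW Hi) //.
  apply: prefix_size_eq; last by rewrite -(hs i).
  apply: (@prefix_cmp _ _ (B theta j (h i.+1))).
  - exact: lcp_prefixl.
  - exact: lcp_prefixr.
  - by rewrite -(hs i).
have h01 : rG j (h 0) (h 1) by apply: hc; lia.
have dec i : i.+2 < L ->
    cnt theta j (h i.+2) (lst P) < cnt theta j (h i.+1) (lst P).
  move=> Hi; have [G1 G2 S] := hc i (ltnW Hi); have [_ G3 S'] := hc i.+1 Hi.
  have [D10 s1 _ _] := Good_facts G1; have [D20 s2 _ _] := Good_facts G2.
  have [D30 s3 _ _] := Good_facts G3.
  rewrite -(hP i.+1 Hi); apply: cnt_decr => //.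
  have := lcpB_size theta j D10 s2 S.
  by rewrite -/(dB j _ _) -/(dB j _ _) (hP i (ltnW Hi)) (hP i.+1 Hi).
have le i : i.+1 < L -> cnt theta j (h i.+1) (lst P) + i <= lst P.
  elim: i => [|i IH] Hi; first by rewrite addn0; apply: cnt_le.
  by have := dec i Hi; have := IH (ltnW Hi); lia.
have := le L.-2; have := rG_lst h01; rewrite -/P.
by move=> H1 H2; have := H2 _; lia.
Qed.

Variable k1 : nat.

(** Lives at level [k1 - i], and each step up descends one level. Sizes may be cut off at [c], as a
    common part of size [c] is already a success. *)
Fixpoint mainc i : (nat -> seq nat) -> nat :=
  if i is i'.+1 then stepc (rG (k1 - i')) (dB (k1 - i)) i'.+2 (mainc i')
  else fun w => minn (size (dB k1 (w 0) (w 1))) c.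

Lemma mainc_local i : localc i.+2 (mainc i).
Proof. by elim: i => [h h' H|i IH]; [rewrite /= !H|apply: stepc_local]. Qed.

Lemma mainc_lt i w : mainc i w < 3 ^ i * c.+1.
Proof.
elim: i w => [|i IH] w; first by rewrite mul1n /= ltnS geq_minr.
by rewrite expnS -mulnA; apply: stepc_lt.
Qed.

Definition success := exists2 E, Good k1.+1 E & c <= size E.

(** Two consecutive common parts are prefixes of the thinned middle sequence and hence comparable.
    If unrelated they have equal size, and [rG_eq_chain] applies; so it does in the base case, where
    the color is the size. *)
Lemma mainc_bounds i : i <= k1 ->
  bounds (rG (k1 - i)) i.+2 (mainc i) lst (cst 3 i) success.
Proof.
elim: i => [_|i IH Hi].
  rewrite subn0 => h L hc hw; have [|L1] := leqP L 1; first by right; rewrite /=; lia.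
  have h01 := hc 0 L1.
  have [Hc|Hc] := leqP c (size (dB k1 (h 0) (h 1))).
    by left; exists (dB k1 (h 0) (h 1)) => //; apply: rG_Good.
  right; apply: (rG_eq_chain hc) => i Hi.
  have := whom_const (i := i) hw; have := whom_const (i := i.+1) hw.
  rewrite /= /win !addn0 !addn1 /diffs.
  by move=> H1 H2; have := H1 _; have := H2 _; lia.
have E : k1 - i = (k1 - i.+1).+1 by lia.
rewrite -[mainc i.+1]/(stepc (rG (k1 - i)) (dB (k1 - i.+1)) i.+2 (mainc i)).
apply: (@step_bounds _ _ _ _ _ i.+2 _ _ _ lst lst (cst 3 i) 3) => //.
- exact: mainc_local.
- exact: IH (ltnW Hi).
- by move=> x y; apply: rG_lst.
- move=> d d' [G G' S]; apply: ltnW.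
  have [d0 _ _ _] := Good_facts G; have [_ s' _ _] := Good_facts G'.
  by apply: (sprefix_lst s' S); apply: lst_mem.
move=> h L hc H; right; apply: (rG_eq_chain hc) => t Ht.
have [N1 N2] := H t Ht.
have G1 := rG_Good (hc t (ltnW Ht)); have G2 := rG_Good (hc t.+1 Ht).
have P1 : prefix (diffs (dB (k1 - i.+1)) h t) (B theta (k1 - i.+1) (h t.+1)).
  exact: lcp_prefixr.
have P2 : prefix (diffs (dB (k1 - i.+1)) h t.+1) (B theta (k1 - i.+1) (h t.+1)).
  exact: lcp_prefixl.
have [S|S|//] := ltngtP (size (diffs (dB (k1 - i.+1)) h t))
   (size (diffs (dB (k1 - i.+1)) h t.+1)).
- by case: N1; rewrite E; split=> //; rewrite /sprefix S andbT (prefix_cmp P1 P2) // ltnW.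
- by case: N2; rewrite E; split=> //; rewrite /sprefix S andbT (prefix_cmp P2 P1) // ltnW.
Qed.

End Levels.
End Main.

(** * The coloring of an interval *)

Definition rt n y := find (fun m => y < m.+1 ^ n) (iota 0 y.+1).

Lemma leq_self_exp x n : 0 < n -> x <= x ^ n.
Proof. by case: n x => // n [|x] // _; rewrite expnS leq_pmulr // expn_gt0. Qed.

Lemma trunc_log_le_self x : trunc_log 2 x <= x.
Proof.
case: x => [|x]; first by rewrite trunc_log0.
apply: leq_trans (ltnW (ltn_expl _ (isT : 1 < 2))) _.
exact: (@trunc_logP 2 x.+1).
Qed.

Lemma rtP n y : 0 < n -> rt n y ^ n <= y < (rt n y).+1 ^ n.
Proof.
move=> n0; have H : has (fun m => y < m.+1 ^ n) (iota 0 y.+1).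
  apply/hasP; exists y; first by rewrite mem_iota; lia.
  exact: leq_self_exp.
have Hl : rt n y < y.+1 by move: H; rewrite has_find size_iota.
apply/andP; split; last by have := nth_find 0 H; rewrite nth_iota.
case E : (rt n y) => [|i]; first by rewrite exp0n.
have Hi : i < rt n y by rewrite E.
by have := before_find 0 Hi; rewrite nth_iota ?add0n; [lia|lia].
Qed.

Lemma rt_mono n x y : 0 < n -> x <= y -> rt n x <= rt n y.
Proof.
move=> n0 xy; have /andP[H1 _] := rtP x n0; have /andP[_ H2] := rtP y n0.
by rewrite -ltnS -(ltn_exp2r _ _ n0); lia.
Qed.

Lemma rtK n m : 0 < n -> rt n (m ^ n) = m.
Proof.
move=> n0; have /andP[] := rtP (m ^ n) n0; rewrite leq_exp2r // ltn_exp2r //; lia.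
Qed.

Section Coloring.
Variables (theta : nat -> bool) (z0 c R n0 N : nat).
Hypothesis N0 : 0 < N.

Definition lg x := iter n0 (trunc_log 2) x.
(** The order of the root is [2 * N] so that [g x ^ 2] is at most the [N]-th root of [lg x]. *)
Definition g x := rt (2 * N) (lg x).
Definition start := tow n0 (z0 ^ (2 * N)).

Lemma lg_mono x y : x <= y -> lg x <= lg y.
Proof. by rewrite /lg; elim: n0 => // i IH /IH H; rewrite !iterS; apply: leq_trunc_log. Qed.

Lemma lg_tow x q : lg x < q -> x < tow n0 q.
Proof.
rewrite /lg; elim: n0 x => // i IH x; rewrite iterSr => /IH H.
by apply: leq_trans (trunc_log_ltn x (isT : 1 < 2)) _; rewrite leq_exp2l.
Qed.

Lemma lg_start q : lg (tow n0 q) = q.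
Proof. by rewrite /lg; elim: n0 => // i IH; rewrite iterSr /= trunc_expnK. Qed.

Lemma g_mono x y : x <= y -> g x <= g y.
Proof. by move=> H; apply: rt_mono; [lia|apply: lg_mono]. Qed.

Lemma g_start : g start = z0.
Proof. by rewrite /g lg_start rtK //; lia. Qed.

Definition st x := find (fun n => g x < Z z0 n.+1) (iota 0 (g x).+1).

Lemma stP x : start <= x -> Z z0 (st x) <= g x < Z z0 (st x).+1.
Proof.
move=> /g_mono; rewrite g_start => H0.
have H : has (fun n => g x < Z z0 n.+1) (iota 0 (g x).+1).
  by apply/hasP; exists (g x); rewrite ?mem_iota ?Z_ge //; lia.
have Hl : st x < (g x).+1 by move: H; rewrite has_find size_iota.
apply/andP; split; last by have := nth_find 0 H; rewrite nth_iota.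
case E : (st x) => [|i] //.
have Hi : i < st x by rewrite E.
by have := before_find 0 Hi; rewrite nth_iota ?add0n; [lia|lia].
Qed.

Lemma st_mono x y : start <= x -> x <= y -> st x <= st y.
Proof.
move=> Hx xy; have /andP[H1 _] := stP Hx; have /andP[_ H2] := stP (leq_trans Hx xy).
rewrite leqNgt; apply/negP => H; have := g_mono xy.
have : Z z0 (st y).+1 <= Z z0 (st x); last by lia.
by move: H; rewrite leq_eqVlt => /orP [/eqP -> //|/(Z_lt z0) /ltnW].
Qed.

Definition stages x := mkseq (Z z0) (st x).+1.

(** The residue modulo 4 records which case applies; weakly homogeneous sequences stay
    in one case, and only the first case can be long. *)
Definition col (w : nat -> nat) : nat :=
  if st (w 0) != st (w 1) then 4 * mainc theta z0 c R n0 n0 (fun j => stages (w j))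
  else if trunc_log 2 (g (w 0)) != trunc_log 2 (g (w 1)) then 1
  else if g (w 0) != g (w 1) then 2
  else 4 * fillc (g (w 0)) (4 * N) n0 w + 3.

Lemma col_local : localc n0.+2 col.
Proof.
move=> h h' H; rewrite /col (H 0) // (H 1) //.
rewrite (@mainc_local theta z0 c R n0 n0 _ (fun j => stages (h' j))); last by move=> j /H ->.
by rewrite (@fillc_local _ _ n0 h h').
Qed.

Definition ncol := 4 * (3 ^ n0 * (c.+1 + (4 * N).+1)).

Lemma col_lt w : col w < ncol.
Proof.
have H1 := mainc_lt theta z0 c R n0 n0 (fun j => stages (w j)).
have H2 := fillc_lt (g (w 0)) (4 * N) n0 w.
have H3 : 0 < 3 ^ n0 by rewrite expn_gt0.
rewrite /col /ncol mulnDr.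
case: ifP => _; first by lia.
case: ifP => _; first by nia.
by case: ifP => _; [nia|lia].
Qed.

(** Every case, the first one unless it succeeds, bounds [L] linearly in [m = g (h 0)], against
    [m ^ 2 < L]. As [z0 <= m], the lower bound on [z0] makes [m] large enough to absorb the additive
    constants. *)
Theorem col_success h L : cst 3 n0 + n0 + 8 <= z0 ->
  (forall i, i < L -> start <= h i <= R) ->
  (forall i, i.+1 < L -> h i < h i.+1) ->
  whom n0.+2 col h L -> (g (h 0)) ^ 2 < L -> success theta z0 c R n0.
Proof.
move=> Hz hR hc hw HL.
have z_le i : i < L -> z0 <= g (h i).
  by move=> /hR /andP [/g_mono H _]; rewrite g_start in H.
have L0 : 0 < L by lia.
have gz := z_le 0 L0; have h0s : start <= h 0 by have /andP[] := hR _ L0.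
set m := g (h 0) in gz HL *.
have Hm : 3 * m + cst 3 n0 + n0 + 2 < m ^ 2 by nia.
have hs i : i < L -> start <= h i by move=> /hR /andP[].
have hK i : i + n0.+2 <= L -> col (win h i) = col (win h 0) by apply: whom_const.
have w0 i : win h i 0 = h i by rewrite /win addn0.
have w1 i : win h i 1 = h i.+1 by rewrite /win addn1.
(* Colors are controlled at [i] only if a window of [n0.+2] entries starts there, that is, for
   [i.+1 < L']. *)
pose L' := L - n0.
have incr (p : nat -> nat) M : (forall i, i.+1 < L' -> p i < p i.+1) ->
    (forall i, i < L' -> p i < M) -> L' <= M.
  move=> H1 H2; have le i : i < L' -> i <= p i.
    by elim: i => // i IH Hi; have := H1 i Hi; have := IH (ltnW Hi); lia.
  by have := le L'.-1; have := H2 L'.-1; lia.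
have gm i : i.+1 < L' -> g (h i) <= g (h i.+1).
  by move=> Hi; apply: g_mono; apply: ltnW; apply: hc; rewrite /L' in Hi; lia.
have CL : col (win h 0) = col (win h 0) by [].
have eC i : i.+1 < L' -> col (win h i) = col (win h 0).
  by move=> Hi; apply: hK; rewrite /L' in Hi; lia.
rewrite [in RHS]/col in CL; case: ifP CL => [H|/negbFE/eqP Est] CL.
  have tp i : i.+1 < L' -> st (h i) != st (h i.+1) /\
     mainc theta z0 c R n0 n0 (fun j => stages (win h i j)) =
     mainc theta z0 c R n0 n0 (fun j => stages (win h 0 j)).
    move=> /eC; rewrite CL /col !w0 !w1; case: ifP => _; first by lia.
    case: ifP => _; first by lia.
    by case: ifP => _; lia.
  have := @mainc_bounds theta z0 c R n0 n0 (leqnn _) (fun i => stages (h i)) L'.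
  case=> [||//|HB].
  - move=> i Hi; rewrite subnn; have [Hst _] := tp i Hi.
    have Hi1 : i.+1 < L by rewrite /L' in Hi; lia.
    have G t : t < L -> Good theta z0 R 0 (stages (h t)).
      move=> Ht; exists (st (h t)) => //; have /andP[H1 _] := stP (hs t Ht).
      have /andP[_ H2] := hR t Ht; apply: leq_trans H1 (leq_trans _ H2).
      have /andP[H3 _] := rtP (lg (h t)) (isT : 0 < 1).
      apply: leq_trans (_ : lg (h t) <= _).
        have N2 : 0 < 2 * N by lia.
        have /andP[H4 _] := rtP (lg (h t)) N2; apply: leq_trans H4.
        exact: leq_self_exp.
      rewrite /lg; elim: (n0) => // u IH; rewrite iterS; apply: leq_trans IH.
      exact: trunc_log_le_self.
    split; [by apply: G; lia|exact: G|].
    have Hlt : st (h i) < st (h i.+1).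
      by rewrite ltn_neqAle Hst st_mono ?hs ?(ltnW (hc i Hi1)) //; lia.
    rewrite /sprefix /stages !size_mkseq ltnS Hlt andbT.
    rewrite prefixE size_mkseq; apply/eqP; rewrite /mkseq -map_take take_iota.
    by congr (map _ (iota _ _)); lia.
  - move=> i Hi; rewrite -[LHS](_ : mainc theta z0 c R n0 n0 (fun j => stages (win h i j)) = _) //.
    rewrite (tp i _).2; last by lia.
    by rewrite -(tp i.+1 _).2; last by lia.
  exfalso; have /andP[H1 _] := stP h0s.
  have : lst (stages (h 0)) <= m.
    by rewrite /lst size_mkseq nth_mkseq.
  by rewrite /L' in HB; lia.
case: ifP CL => [H|/negbFE/eqP Elog] CL.
  exfalso; have tp i : i.+1 < L' -> st (h i) = st (h i.+1) /\
     trunc_log 2 (g (h i)) != trunc_log 2 (g (h i.+1)).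
    move=> /eC; rewrite CL /col !w0 !w1; case: eqP => [->|_] /=; last by lia.
    case: ifP => // _; case: ifP => _; lia.
  have sc i : i < L' -> st (h i) = st (h 0).
    by elim: i => // i IH Hi; have [<- _] := tp i Hi; apply: IH; apply: ltnW.
  suff HM : L' <= (3 * m).+1 by rewrite /L' in HM; lia.
  (* In one stage [g] stays below the next term of [Z], whose logarithm is three times the present
     term and so at most [3 * m]. *)
  apply: (incr (fun i => trunc_log 2 (g (h i)))) => i Hi.
    by rewrite ltn_neqAle (tp i Hi).2 /=; apply: leq_trunc_log; apply: gm.
  have Hi' : i < L by rewrite /L' in Hi; lia.
  have /andP[_ H1] := stP (hs i Hi'); have /andP[H2 _] := stP h0s.
  rewrite sc // in H1.
  rewrite ltnS; apply: leq_trans (leq_trunc_log 2 (ltnW H1)) _.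
  rewrite /Z iterS trunc_expnK // -/(Z z0 _); rewrite /m; lia.
case: ifP CL => [H|/negbFE/eqP Eg] CL.
  exfalso; have tp i : i.+1 < L' ->
     trunc_log 2 (g (h i)) = trunc_log 2 (g (h i.+1)) /\ g (h i) != g (h i.+1).
    move=> /eC; rewrite CL /col !w0 !w1; case: ifP => _; first by lia.
    case: eqP => [->|_] /=; last by lia.
    case: ifP => // _; lia.
  have sc i : i < L' -> trunc_log 2 (g (h i)) = trunc_log 2 m.
    by elim: i => // i IH Hi; have [<- _] := tp i Hi; apply: IH; apply: ltnW.
  (* A constant logarithm keeps [g] below [2 * m]. *)
  suff HM : L' <= 2 * m by rewrite /L' in HM; lia.
  apply: (incr (fun i => g (h i))) => i Hi; first by rewrite ltn_neqAle (tp i Hi).2 /=; apply: gm.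
  have := trunc_log_ltn (g (h i)) (isT : 1 < 2); rewrite sc // expnS.
  have m0 : 0 < m by lia.
  by have := trunc_logP (isT : 1 < 2) m0; lia.
exfalso; have tp i : i.+1 < L' -> g (h i) = g (h i.+1) /\
     fillc (g (h i)) (4 * N) n0 (win h i) = fillc m (4 * N) n0 (win h 0).
  move=> /eC; rewrite CL /col !w0 !w1; case: ifP => _; first by lia.
  case: ifP => _; first by lia.
  case: eqP => [->|_] /=; last by lia.
  by move=> H; split=> //; rewrite -/m in H; lia.
have sc i : i < L' -> g (h i) = m.
  by elim: i => // i IH Hi; have [<- _] := tp i Hi; apply: IH; apply: ltnW.
have m1 : 1 < m by lia.
have N2 : 0 < 2 * N by lia.
have := @fillc_bounds m (4 * N) n0 False m1 h L'.
have c23 j : cst 2 j <= cst 3 j by elim: j => //= j IH; lia.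
case=> [|||HB] //.
(* From [g = m] one gets [lg < (m + 1) ^ (2 * N) <= m ^ (4 * N)], whence the exponent [4 * N] in
   [col]. *)
- move=> i Hi; split; first by apply: hc; rewrite /L' in Hi; lia.
  apply: lg_tow; have /andP[_ H] := rtP (lg (h i.+1)) N2.
  apply: leq_trans H _; rewrite -/(g _) sc //.
  have -> : 4 * N = 2 * (2 * N) by lia.
  by rewrite (expnM m) leq_exp2r //; nia.
- move=> i Hi; rewrite -{1}(sc i) ?(tp i _).2; try lia.
  by rewrite -(tp i.+1 _).2 ?sc //; lia.
- by have := c23 n0; rewrite /L' in HB; lia.
Qed.

End Coloring.

(** * Definability with parameters *)

Section Definability.
Variable S : struc.
Implicit Types (e : nat -> S) (f g : (nat -> S) -> S) (P Q : (nat -> S) -> Prop).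

Definition etail e i := e i.+1.

Inductive Tm : ((nat -> S) -> S) -> Prop :=
| Tm_var i : Tm (fun e => e i)
| Tm_cst c : Tm (fun=> c)
| Tm_add f g : Tm f -> Tm g -> Tm (fun e => add (f e) (g e))
| Tm_mul f g : Tm f -> Tm g -> Tm (fun e => mul (f e) (g e))
| Tm_pow f g : Tm f -> Tm g -> Tm (fun e => pow (f e) (g e)).

Inductive D0 : ((nat -> S) -> Prop) -> Prop :=
| D0_bot : D0 (fun=> False)
| D0_eq f g : Tm f -> Tm g -> D0 (fun e => eqv (f e) (g e))
| D0_lt f g : Tm f -> Tm g -> D0 (fun e => ltr (f e) (g e))
| D0_imp P Q : D0 P -> D0 Q -> D0 (fun e => P e -> Q e)
| D0_all f P : Tm f -> D0 P -> D0 (fun e => forall x, ltr x (f e) -> P (econs x e)).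

Lemma D0_ext P Q : (forall e, P e <-> Q e) -> D0 P -> D0 Q.
Proof. by move=> H; rewrite (_ : Q = P) //; apply: funext => e; apply: propext; rewrite H. Qed.

Lemma D0_not P : D0 P -> D0 (fun e => ~ P e).
Proof. by move=> H; apply: D0_imp => //; apply: D0_bot. Qed.

Lemma D0_or P Q : D0 P -> D0 Q -> D0 (fun e => P e \/ Q e).
Proof.
move=> HP HQ; apply: D0_ext (D0_imp (D0_not HP) HQ) => e.
split=> [H|[//|//]]; first by case: (pselect (P e)) => ?; [left|right; apply: H].
Qed.

Lemma D0_and P Q : D0 P -> D0 Q -> D0 (fun e => P e /\ Q e).
Proof.
move=> HP HQ; apply: D0_ext (D0_not (D0_imp HP (D0_not HQ))) => e.
split=> [H|[HA HB] H]; last exact: H HA HB.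
by split; apply: contrapT => N; apply: H => // ? ?.
Qed.

Lemma D0_iff P Q : D0 P -> D0 Q -> D0 (fun e => P e <-> Q e).
Proof. by move=> HP HQ; apply: D0_and; apply: D0_imp. Qed.

Lemma D0_ex f P : Tm f -> D0 P -> D0 (fun e => exists2 x, ltr x (f e) & P (econs x e)).
Proof.
move=> Hf HP; apply: D0_ext (D0_not (D0_all Hf (D0_not HP))) => e.
split=> [H|[x Hx HPx] H]; last exact: H Hx HPx.
by apply: contrapT => N; apply: H => x Hx HPx; apply: N; exists x.
Qed.

Lemma Tm_tev t : Tm (fun e => tev e t).
Proof. by elim: t => /= *; constructor. Qed.

Lemma Tm_subst f (s : (nat -> S) -> nat -> S) :
  Tm f -> (forall i, Tm (fun e => s e i)) -> Tm (fun e => f (s e)).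
Proof. by move=> Hf Hs; elim: Hf => *; [apply: Hs|constructor..]. Qed.

Lemma Tm_tail f : Tm f -> Tm (fun e => f (etail e)).
Proof. by move=> Hf; apply: Tm_subst Hf _ => i; apply: (Tm_var i.+1). Qed.

Lemma D0_subst P (s : (nat -> S) -> nat -> S) :
  D0 P -> (forall i, Tm (fun e => s e i)) -> D0 (fun e => P (s e)).
Proof.
move=> HP; elim: HP s => {P} [|f g Hf Hg|f g Hf Hg|P Q _ IHP _ IHQ|f P Hf _ IH] s Hs.
- exact: D0_bot.
- by apply: D0_eq; apply: Tm_subst.
- by apply: D0_lt; apply: Tm_subst.
- by apply: D0_imp; [apply: IHP|apply: IHQ].
apply: (@D0_all (fun e => f (s e)) (fun e => P (econs (e 0) (s (etail e))))).
  exact: Tm_subst.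
apply: (IH (fun e => econs (e 0) (s (etail e)))) => -[|i] /=; first exact: Tm_var.
exact: (@Tm_tail (fun e => s e i)).
Qed.

Lemma D0_tail P : D0 P -> D0 (fun e => P (etail e)).
Proof. by move=> HP; apply: (D0_subst (s := etail) HP) => i; apply: Tm_var. Qed.

(** The Sigma_k relations. *)
Fixpoint Tn k P : Prop :=
  if k is k'.+1 then exists2 Q, Tn k' Q & forall e, P e <-> exists u, ~ Q (econs u e)
  else D0 P.

Lemma Tn_ext k P Q : (forall e, P e <-> Q e) -> Tn k P -> Tn k Q.
Proof. by move=> H; rewrite (_ : Q = P) //; apply: funext => e; apply: propext; rewrite H. Qed.

Lemma D0_Tn1 P : D0 P -> Tn 1 P.
Proof.
move=> HP; exists (fun e => ~ P (etail e)); first exact: D0_not (D0_tail HP).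
by move=> e; split=> [H|[_ /contrapT]] //; exists (e 0).
Qed.

Lemma Tn_S k P : Tn k P -> Tn k.+1 P.
Proof.
elim: k P => [|k IH] P; first exact: D0_Tn1.
by move=> [Q HQ HP]; exists Q => //; apply: IH.
Qed.

Lemma D0_Tn k P : D0 P -> Tn k P.
Proof. by move=> HP; elim: k => // k; apply: Tn_S. Qed.

Lemma Tn1_Tn k P : Tn 1 P -> Tn k.+1 P.
Proof. by move=> HP; elim: k => // k; apply: Tn_S. Qed.

Lemma Tn_subst k P (s : (nat -> S) -> nat -> S) :
  Tn k P -> (forall i, Tm (fun e => s e i)) -> Tn k (fun e => P (s e)).
Proof.
elim: k P s => [|k IH] P s; first exact: D0_subst.
move=> [Q HQ HP] Hs; exists (fun e => Q (econs (e 0) (s (etail e)))) => //.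
apply: (IH Q (fun e => econs (e 0) (s (etail e)))) => // -[|i] /=; first exact: Tm_var.
exact: (@Tm_tail (fun e => s e i)).
Qed.

Section Congr.
Hypothesis cS : congruent S.

Lemma Tm_congr f e e' : Tm f -> (forall i, eqv (e i) (e' i)) -> eqv (f e) (f e').
Proof. by case: cS => rf sm tr [cA cM cP cL cX] Hf H; elim: Hf => /=; auto. Qed.

Lemma D0_congr P e e' : D0 P -> (forall i, eqv (e i) (e' i)) -> P e -> P e'.
Proof.
case: (cS) => rf sm tr [cA cM cP cL cX] HP.
elim: HP e e' => {P} [|f g Hf Hg|f g Hf Hg|P Q _ IHP _ IHQ|f P Hf _ IH] e e' He //.
- move=> Hq; apply: (tr _ (g e)); last exact: Tm_congr.
  by apply: (tr _ (f e)) => //; apply: sm; apply: Tm_congr.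
- by apply: cL; apply: Tm_congr.
- by move=> HI HP; apply: (IHQ e) => //; apply: HI; apply: (IHP e') => // i; apply: sm.
- move=> H x Hx; apply: (IH (econs x e)); last first.
    by apply: H; apply: cL Hx => //; apply: sm; apply: Tm_congr.
  by case.
Qed.

Lemma Tn_congr k P e e' : Tn k P -> (forall i, eqv (e i) (e' i)) -> P e -> P e'.
Proof.
have rf : forall x : S, eqv x x by case: cS.
have sm : forall x y : S, eqv x y -> eqv y x by case: cS.
elim: k P e e' => [|k IH] P e e'; first exact: D0_congr.
move=> [Q HQ HP] He; rewrite !HP => -[u Hu]; exists u => HQu; apply: Hu.
by apply: (IH _ _ _ HQ) HQu => -[|i] //=; apply: sm.
Qed.

End Congr.

(** [tau] tells which free variables of a formula stand for parameters and which for
    entries of the environment. *)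
Definition lookup (tau : nat -> S + nat) e i : S :=
  match tau i with inl c => c | inr j => e j end.

(** Lets two formulas be joined without a clash, after renaming their variables to even and odd
    ones. *)
Definition merge T (t1 t2 : nat -> T) i := if odd i then t2 i./2 else t1 i./2.

Lemma lookup_merge1 t1 t2 e :
  (fun i => lookup (merge t1 t2) e i.*2) = lookup t1 e.
Proof. by apply: funext => i; rewrite /lookup /merge odd_double doubleK. Qed.

Lemma lookup_merge2 t1 t2 e :
  (fun i => lookup (merge t1 t2) e i.*2.+1) = lookup t2 e.
Proof. by apply: funext => i; rewrite /lookup /merge /= odd_double /= uphalf_double. Qed.

(** For quantifying over entry 0 of the environment: [bindr] sends every variable that stands for it
    to the bound variable and shifts the others, whose assignment becomes [unbind tau]. *)
Definition unbind (tau : nat -> S + nat) i : S + nat :=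
  match tau i with inl c => inl c | inr j => inr j.-1 end.
Definition bindr (tau : nat -> S + nat) i : nat :=
  if tau i is inr 0 then 0 else i.+1.

Lemma lookup_bind tau x e :
  (fun i => econs x (lookup (unbind tau) e) (bindr tau i)) = lookup tau (econs x e).
Proof.
by apply: funext => i; rewrite /lookup /bindr /unbind /=; case E : (tau i) => [c|[|j]] //=; rewrite E.
Qed.

Lemma Tm_term f : Tm f -> exists t tau, forall e, f e = tev (lookup tau e) t.
Proof.
have bin o (g : S -> S -> S) f1 f2 :
    (forall e t u, tev e (o t u) = g (tev e t) (tev e u)) ->
    (exists t tau, forall e, f1 e = tev (lookup tau e) t) ->
    (exists t tau, forall e, f2 e = tev (lookup tau e) t) ->
    exists t tau, forall e, g (f1 e) (f2 e) = tev (lookup tau e) t.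
  move=> Ho [t1 [s1 H1]] [t2 [s2 H2]].
  exists (o (tsubst (fun i => Var i.*2) t1) (tsubst (fun i => Var i.*2.+1) t2)), (merge s1 s2).
  by move=> e; rewrite Ho !tev_tsubst /= lookup_merge1 lookup_merge2 H1 H2.
elim=> [i|c|f1 f2 _ H1 _ H2|f1 f2 _ H1 _ H2|f1 f2 _ H1 _ H2].
- by exists (Var 0), (fun=> inr i).
- by exists (Var 0), (fun=> inl c).
- exact: (bin Add add).
- exact: (bin Mul mul).
- exact: (bin Exp pow).
Qed.

End Definability.

Lemma tsubst_comp s s' t : tsubst s (tsubst s' t) = tsubst (fun i => tsubst s (s' i)) t.
Proof. by elim: t => //= t -> u ->. Qed.

Lemma tsubst_up_lift s t : tsubst (up s) (tlift 1 t) = tlift 1 (tsubst s t).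
Proof. by rewrite /tlift !tsubst_comp. Qed.

Lemma bounded_subst so (A : formula so) s r : bounded A -> bounded (fsubst s r A).
Proof.
move=> HA; elim: HA s r => {A}
  [|t u|t u|h t X|A B _ IHA _ IHB|t A _ IH|t A _ IH] s r /=.
- exact: bounded_Bot.
- exact: bounded_Eq.
- exact: bounded_Lt.
- exact: bounded_Elem.
- by apply: bounded_Imp.
- by rewrite tsubst_up_lift; apply: bounded_All.
- by rewrite tsubst_up_lift; apply: bounded_Ex.
Qed.

Section Realize.
Variables (S : struc) (so : bool).

Lemma D0_formula (P : (nat -> S) -> Prop) : D0 P -> exists (A : formula so) tau,
  bounded A /\ forall e E, P e <-> ev (lookup tau e) E A.
Proof.
have two o (g : S -> S -> Prop) f1 f2 :
    (forall t u, bounded (o t u : formula so)) ->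
    (forall e E t u, ev e E (o t u : formula so) <-> g (tev e t) (tev e u)) ->
    Tm f1 -> Tm f2 -> exists (A : formula so) tau,
    bounded A /\ forall e E, g (f1 e) (f2 e) <-> ev (lookup tau e) E A.
  move=> Hb Ho /Tm_term [t1 [s1 H1]] /Tm_term [t2 [s2 H2]].
  exists (o (tsubst (fun i => Var i.*2) t1) (tsubst (fun i => Var i.*2.+1) t2)), (merge s1 s2).
  split=> // e E.
  by rewrite Ho !tev_tsubst /= lookup_merge1 lookup_merge2 H1 H2.
elim=> {P} [|f g|f g|P Q _ [A [s1 [bA HA]]] _ [B [s2 [bB HB]]]|f P Hf _ [A [s1 [bA HA]]]].
- by exists Bot, (fun=> inr 0); split=> //; apply: bounded_Bot.
- by apply: (two (@Eq so) eqv) => // *; apply: bounded_Eq.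
- by apply: (two (@Lt so) ltr) => // *; apply: bounded_Lt.
- exists (Imp (fsubst (fun i => Var i.*2) id A) (fsubst (fun i => Var i.*2.+1) id B)), (merge s1 s2).
  split; first by apply: bounded_Imp; apply: bounded_subst.
  by move=> e E; rewrite ev_Imp !ev_fsubst /= lookup_merge1 lookup_merge2 -HA -HB.
have [t [s2 Ht]] := Tm_term Hf.
exists (All (Imp (Lt (Var 0) (tlift 1 (tsubst (fun i => Var i.*2.+1) t)))
  (fsubst (fun i => Var (if bindr s1 i is j.+1 then j.*2.+1 else 0)) id A))).
exists (merge (unbind s1) s2); split; first by apply: bounded_All; apply: bounded_subst.
move=> e E; rewrite ev_All; have key x : ev (econs x (lookup (merge (unbind s1) s2) e)) E
    (fsubst (fun i => Var (if bindr s1 i is j.+1 then j.*2.+1 else 0)) id A) <-> P (econs x e).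
  rewrite ev_fsubst (HA _ E) -(lookup_bind s1) -(lookup_merge1 (unbind s1) s2).
  set w1 := (fun i => tev _ _); set w2 := (fun i => econs _ _ _).
  have -> // : w1 = w2.
  by apply: funext => i; rewrite /w1 /w2 /=; case: (bindr s1 i).
have lt' : forall y, ev (econs y (lookup (merge (unbind s1) s2) e)) E
   (Lt (Var 0) (tlift 1 (tsubst (fun i => Var i.*2.+1) t)) : formula so) <-> ltr y (f e).
  by move=> y; rewrite ev_Lt tlift1E tev_tsubst /= lookup_merge2 Ht.
by split=> H x; have := H x; rewrite ev_Imp key lt'.
Qed.

Lemma D0_formula1 (P : (nat -> S) -> Prop) e : D0 P -> exists (A : formula so) e',
  bounded A /\ forall x E, P (econs x e) <-> ev (econs x e') E A.
Proof.
move=> /D0_formula [A [tau [bA HA]]].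
exists (fsubst (fun i => Var (bindr tau i)) id A), (lookup (unbind tau) e).
split=> [|x E]; first exact: bounded_subst.
by rewrite ev_fsubst (HA _ E) /= lookup_bind.
Qed.

End Realize.

(** * Cuts of an ultrapower *)

Definition grow x := 2 ^ (3 * x).

Record ultra (U : (nat -> Prop) -> Prop) : Prop := {
  ultraS : forall P Q : nat -> Prop, (forall n, P n -> Q n) -> U P -> U Q;
  ultraI : forall P Q, U P -> U Q -> U (fun n => P n /\ Q n);
  ultraC : forall P, U P \/ U (fun n => ~ P n);
  ultraF : ~ U (fun=> False) }.

Section Cut.
Variable U : (nat -> Prop) -> Prop.
Hypothesis uU : ultra U.

Lemma ultraT (P : nat -> Prop) : (forall n, P n) -> U P.
Proof.
move=> H; case: (ultraC uU P) => // HN.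
by case: (ultraF uU); apply: (ultraS uU) HN => n; apply.
Qed.

Lemma ultraS2 (P Q R : nat -> Prop) : (forall n, P n -> Q n -> R n) -> U P -> U Q -> U R.
Proof. by move=> H HP HQ; apply: (ultraS uU) (ultraI uU HP HQ) => n []; apply: H. Qed.

Lemma ultraN (P : nat -> Prop) : U (fun n => ~ P n) <-> ~ U P.
Proof.
split=> [H H'|H]; first by apply: (ultraF uU); apply: (ultraS2 _ H H').
by case: (ultraC uU P).
Qed.

Lemma ultraU (P Q : nat -> Prop) : U (fun n => P n \/ Q n) <-> U P \/ U Q.
Proof.
split=> [H|[]]; last 2 first.
- by apply: (ultraS uU); left.
- by apply: (ultraS uU); right.
apply: contrapT => /not_orP [/ultraN H1 /ultraN H2].
by apply: (ultraF uU); apply: (ultraS2 _ H (ultraI uU H1 H2)) => n HPQ [N1 N2]; case: HPQ.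
Qed.

Lemma ultra_imp (P Q : nat -> Prop) : (U P -> U Q) <-> U (fun n => P n -> Q n).
Proof.
split=> [H|H HP]; last by apply: (ultraS2 _ H HP) => n; apply.
case: (ultraC uU P) => [/H HQ|HN]; first by apply: (ultraS uU) HQ.
by apply: (ultraS uU) HN => n.
Qed.

Lemma ultra_ex n0 (P : nat -> Prop) : U P -> U (fun n => n0 <= n) -> exists2 n, n0 <= n & P n.
Proof.
move=> HP Hn; apply: contrapT => H; apply: (ultraF uU).
by apply: (ultraS2 _ Hn HP) => n H1 H2; apply: H; exists n.
Qed.

(** Counterexamples at almost every index form an element of the ultrapower. *)
Lemma ultra_all (b : nat -> nat) (P : nat -> nat -> Prop) :
  (forall x : nat -> nat, U (fun n => x n < b n) -> U (fun n => P n (x n))) ->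
  U (fun n => forall y, y < b n -> P n y).
Proof.
move=> H; case: (ultraC uU (fun n => forall y, y < b n -> P n y)) => // HN.
have ch n : exists y, (exists2 y', y' < b n & ~ P n y') -> y < b n /\ ~ P n y.
  case: (pselect (exists2 y', y' < b n & ~ P n y')) => [[y H1 H2]|N].
    by exists y.
  by exists 0 => /N.
have [x Hx] := choice ch.
have HN' : U (fun n => x n < b n /\ ~ P n (x n)).
  apply: (ultraS uU) HN => n /existsNP [y /not_implyP [H1 H2]].
  by apply: Hx; exists y.
have /H HP : U (fun n => x n < b n) by apply: (ultraS uU) HN' => n [].
by exfalso; apply: (ultraF uU); apply: (ultraS2 _ HN' HP) => n [].
Qed.

Variable h : nat -> nat -> nat.
Hypothesis h_grow : forall i, U (fun n => grow (h i n) <= h i.+1 n).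

Definition inI (x : nat -> nat) := exists i, U (fun n => x n < h i n).

Lemma grow_gt x : x < grow x.
Proof. by apply: leq_ltn_trans (ltn_expl (3 * x) _) => //; lia. Qed.

Lemma h_lt i j : i < j -> U (fun n => h i n < h j n).
Proof.
elim: j => // j IH; rewrite ltnS leq_eqVlt => /orP [/eqP ->|/IH H].
  by apply: (ultraS uU) (h_grow j) => n; apply: leq_trans (grow_gt _).
by apply: (ultraS2 _ H (h_grow j)) => n H1 H2; have := grow_gt (h j n); lia.
Qed.

Lemma h_le i j : i <= j -> U (fun n => h i n <= h j n).
Proof.
rewrite leq_eqVlt => /orP [/eqP ->|/h_lt H]; first exact: ultraT.
by apply: (ultraS uU) H => n; apply: ltnW.
Qed.

Lemma inI_le x y : inI y -> U (fun n => x n <= y n) -> inI x.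
Proof. by move=> [i Hi] H; exists i; apply: (ultraS2 _ Hi H) => n; lia. Qed.

Lemma inI2 x y : inI x -> inI y -> exists i, U (fun n => x n < h i n /\ y n < h i n).
Proof.
move=> [i Hi] [j Hj]; exists (maxn i j).
have H1 := h_le (leq_maxl i j); have H2 := h_le (leq_maxr i j).
apply: (ultraI uU); [apply: (ultraS2 _ Hi H1)|apply: (ultraS2 _ Hj H2)] => n; lia.
Qed.

Lemma inI_pow x y : inI x -> inI y -> inI (fun n => x n ^ y n).
Proof.
move=> Hx Hy; have [i Hi] := inI2 Hx Hy; exists i.+2.
apply: (ultraS2 _ Hi (ultraI uU (h_grow i) (h_grow i.+1))) => n [H1 H2] [H3 H4].
apply: leq_trans H4; have x2 := ltn_expl (x n) (isT : 1 < 2).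
have hx : x n ^ y n <= 2 ^ (x n * y n) by rewrite expnM; case: (y n) => // y'; rewrite leq_exp2r // ltnW.
apply: leq_ltn_trans hx _; rewrite /grow ltn_exp2l //.
have : x n * y n < 2 ^ (x n + y n) by rewrite expnD; apply: ltn_mul => //; apply: ltn_expl.
have : 2 ^ (x n + y n) <= grow (h i n) by rewrite leq_exp2l //; lia.
lia.
Qed.

Lemma inI_cst c : inI (fun=> c).
Proof.
exists c.+1; elim: c => [|c IH].
  by apply: (ultraS uU) (h_grow 0) => n; have := grow_gt (h 0 n); lia.
by apply: (ultraS2 _ IH (h_grow c.+1)) => n; have := grow_gt (h c.+1 n); lia.
Qed.

Lemma inI_mul x y : inI x -> inI y -> inI (fun n => x n * y n).
Proof.
move=> Hx Hy; have [i Hi] := inI2 Hx Hy.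
apply: (@inI_le _ (fun n => (2 ^ h i n) ^ 2)).
  have Hh : inI (h i) by exists i.+1; apply: h_lt.
  by apply: (inI_pow (y := fun=> 2)); [apply: (inI_pow (x := fun=> 2)) => //; apply: inI_cst|apply: inI_cst].
apply: (ultraS uU) Hi => n [H1 H2].
have := ltn_expl (h i n) (isT : 1 < 2); rewrite expnS expn1 => H3.
by apply: leq_mul; lia.
Qed.

Lemma inI_add x y : inI x -> inI y -> inI (fun n => x n + y n).
Proof.
move=> Hx Hy; have [i Hi] := inI2 Hx Hy.
apply: (@inI_le _ (fun n => 2 * h i n)).
  by apply: (inI_mul (x := fun=> 2)); [apply: inI_cst|exists i.+1; apply: h_lt].
by apply: (ultraS uU) Hi => n [H1 H2]; lia.
Qed.

Definition icar := {x : nat -> nat | inI x}.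
Definition ival (x : icar) : nat -> nat := sval x.
Definition mkI x (Hx : inI x) : icar := exist _ x Hx.

Lemma ivalP (x : icar) : inI (ival x). Proof. exact: svalP. Qed.

(** A structure without sets: induction, collection and the Delta_1 sets are stated for relations
    with number parameters, before the sets of [SI] are known. *)
Definition S0 : struc := @Struc icar (fun x y => U (fun n => ival x n = ival y n))
  (mkI (inI_cst 0)) (mkI (inI_cst 1))
  (fun x y => mkI (inI_add (ivalP x) (ivalP y)))
  (fun x y => mkI (inI_mul (ivalP x) (ivalP y)))
  (fun x y => mkI (inI_pow (ivalP x) (ivalP y)))
  (fun x y => U (fun n => ival x n < ival y n)) unit (fun _ _ => False).

Lemma S0_congr : congruent S0.
Proof.
split=> [x|x y H|x y z H1 H2|]; first exact: ultraT.
- by apply: (ultraS uU) H.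
- by apply: (ultraS2 _ H1 H2) => n -> ->.
split=> // [x x' y y' H1 H2|x x' y y' H1 H2|x x' y y' H1 H2|x x' y y' H1 H2 H3].
- by apply: (ultraS2 _ H1 H2) => n /= -> ->.
- by apply: (ultraS2 _ H1 H2) => n /= -> ->.
- by apply: (ultraS2 _ H1 H2) => n /= -> ->.
- by apply: (ultraS2 _ (ultraI uU H1 H2) H3) => n [-> ->].
Qed.

Variable k : nat.

(** * Induction, collection and Sigma_1 relations in a cut *)

Definition Ind := forall P (e : nat -> S0), Tn k.+1 P -> P (econs zer e) ->
  (forall x : S0, P (econs x e) -> P (econs (add x uno) e)) ->
  forall x, P (econs x e).

(** As [~ Q] is Pi_k, this is collection for Pi_k relations, or equivalently for Sigma_(k+1)
    relations. *)
Definition Coll := forall Q (e : nat -> S0) (s : S0), Tn k Q ->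
  (forall x, ltr x s -> exists u, ~ Q (econs u (econs x e))) ->
  exists w, forall x, ltr x s -> exists2 u, ltr u w & ~ Q (econs u (econs x e)).

Hypotheses (ind : Ind) (coll : Coll).

Implicit Types (P Q : (nat -> S0) -> Prop) (e : nat -> S0).

Lemma S1_D0 P : (exists2 Q, D0 Q & forall e, P e <-> exists u : S0, Q (econs u e)) -> Tn 1 P.
Proof.
move=> [Q HQ H]; exists (fun e => ~ Q e); first exact: D0_not.
by move=> e; rewrite H; split=> -[u Hu]; exists u; [|apply: contrapT].
Qed.

Lemma D0_S1 P : Tn 1 P -> exists2 Q, D0 Q & forall e, P e <-> exists u : S0, Q (econs u e).
Proof. by move=> [Q HQ H]; exists (fun e => ~ Q e); first exact: D0_not. Qed.

Lemma S1_or P Q : Tn 1 P -> Tn 1 Q -> Tn 1 (fun e => P e \/ Q e).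
Proof.
move=> /D0_S1 [P1 H1 HP] /D0_S1 [Q1 H2 HQ]; apply: S1_D0.
exists (fun e => P1 e \/ Q1 e); first exact: D0_or.
move=> e; rewrite HP HQ; split; first by case=> -[u Hu]; exists u; [left|right].
by case=> u [Hu|Hu]; [left|right]; exists u.
Qed.

Definition sums (x y : S0) : S0 := add (add x y) uno.

Lemma sums_l x y : ltr x (sums x y).
Proof. by apply: ultraT => n /=; lia. Qed.
Lemma sums_r x y : ltr y (sums x y).
Proof. by apply: ultraT => n /=; lia. Qed.

Lemma S1_and P Q : Tn 1 P -> Tn 1 Q -> Tn 1 (fun e => P e /\ Q e).
Proof.
move=> /D0_S1 [P1 H1 HP] /D0_S1 [Q1 H2 HQ]; apply: S1_D0.
have sk R : D0 R -> D0 (fun e : nat -> S0 =>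
    exists2 u, ltr u (e 0) & R (econs u (etail e))).
  move=> HR; apply: (D0_ex (P := fun e => R (econs (e 0) (etail (etail e)))) (Tm_var S0 0)).
  by apply: (D0_subst (s := fun e => econs (e 0) (etail (etail e)))) => // -[|i] /=; apply: Tm_var.
exists (fun e => (exists2 u, ltr u (e 0) & P1 (econs u (etail e))) /\
  (exists2 u, ltr u (e 0) & Q1 (econs u (etail e)))); first by apply: D0_and; apply: sk.
move=> e; rewrite HP HQ; split.
  move=> [[u Hu] [v Hv]]; exists (sums u v).
  by split; [exists u => //; apply: sums_l|exists v => //; apply: sums_r].
by move=> [w [[u _ Hu] [v _ Hv]]]; split; [exists u|exists v].
Qed.

Lemma S1_ex P : Tn 1 P -> Tn 1 (fun e => exists x, P (econs x e)).
Proof.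
move=> /D0_S1 [P1 H1 HP]; apply: S1_D0.
exists (fun e => exists2 x, ltr x (e 0) &
    exists2 u, ltr u (econs x e 1) & P1 (econs u (econs x (etail e)))).
  apply: (D0_ex (P := fun e => exists2 u, ltr u (e 1) & P1 (econs u (econs (e 0) (etail (etail e))))) (Tm_var S0 0)).
  apply: (D0_ex (P := fun e => P1 (econs (e 0) (econs (e 1) (etail (etail (etail e)))))) (Tm_var S0 1)).
  apply: (D0_subst (s := fun e => econs (e 0) (econs (e 1) (etail (etail (etail e)))))) => //.
  by case=> [|[|i]] /=; apply: Tm_var.
move=> e; split.
  move=> [x]; rewrite HP => -[u Hu]; exists (sums x u), x; first exact: sums_l.
  by exists u => //; apply: sums_r.
by move=> [w [x _ [u _ Hu]]]; exists x; rewrite HP; exists u.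
Qed.

(** Collection bounds the witnesses for all [x] at once, so the unbounded quantifier can be moved
    outside. *)
Lemma S1_all f P : Tm f -> Tn 1 P -> Tn 1 (fun e => forall x, ltr x (f e) -> P (econs x e)).
Proof.
move=> Hf [Q HQ HP]; apply: S1_D0.
exists (fun e => forall x, ltr x (f (etail e)) ->
   exists2 u, ltr u (econs x e 1) & ~ Q (econs u (econs x (etail e)))).
  apply: (D0_all (f := fun e => f (etail e)) (P := fun e => exists2 u, ltr u (e 1) & ~ Q (econs u (econs (e 0) (etail (etail e)))))).
    exact: Tm_tail.
  apply: (D0_ex (P := fun e => ~ Q (econs (e 0) (econs (e 1) (etail (etail (etail e)))))) (Tm_var S0 1)).
  apply: D0_not.
  apply: (D0_subst (s := fun e => econs (e 0) (econs (e 1) (etail (etail (etail e)))))) => //.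
  by case=> [|[|i]] /=; apply: Tm_var.
move=> e; split=> [H|[w H] x /H [u _ Hu]]; last by rewrite HP; exists u.
have [||w Hw] := coll (Q := Q) (e := e) (s := f e).
- exact: D0_Tn.
- by move=> x /H; rewrite HP.
by exists w.
Qed.

Lemma S1_bex f P : Tm f -> Tn 1 P -> Tn 1 (fun e => exists2 x, ltr x (f e) & P (econs x e)).
Proof.
move=> Hf HP; apply: (Tn_ext (P := fun e => exists x, ltr (econs x e 0) (f (etail (econs x e))) /\ P (econs x e))).
  by move=> e; split=> [[x []]|[x]]; exists x.
apply: (S1_ex (P := fun e => ltr (e 0) (f (etail e)) /\ P e)).
apply: S1_and => //; apply: D0_Tn1; apply: D0_lt; first exact: Tm_var.
exact: Tm_tail.
Qed.

(** * The model formed by a cut and its Delta_1 sets *)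

Definition delta1 (X : icar -> Prop) := exists P1 P2 e,
  [/\ Tn 1 P1, Tn 1 P2, (forall x, X x <-> P1 (econs x e)) & (forall x, ~ X x <-> P2 (econs x e))].

Lemma delta1_0 : delta1 (fun=> False).
Proof.
exists (fun=> False), (fun=> ~ False), (fun=> zer).
by split=> //; apply: D0_Tn1; [apply: D0_bot|apply: D0_not; apply: D0_bot].
Qed.

Definition SI : struc := @Struc icar (fun x y => U (fun n => ival x n = ival y n))
  (mkI (inI_cst 0)) (mkI (inI_cst 1))
  (fun x y => mkI (inI_add (ivalP x) (ivalP y)))
  (fun x y => mkI (inI_mul (ivalP x) (ivalP y)))
  (fun x y => mkI (inI_pow (ivalP x) (ivalP y)))
  (fun x y => U (fun n => ival x n < ival y n)) {X | delta1 X} (fun x X => sval X x).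

Lemma SI_congr : congruent SI.
Proof.
have [rf sm tr [cA cM cP cL cX]] := S0_congr.
split=> //; split=> // x x' [X [P1 [P2 [e [H1 H2 H3 H4]]]]] /= xx'.
by rewrite !H3; apply: (Tn_congr S0_congr H1) => -[].
Qed.

Lemma tev_SI (e : nat -> SI) t : tev e t = tev (e : nat -> S0) t :> icar.
Proof. by elim: t => //= t -> u ->. Qed.

(** A set parameter is only Delta_1, so a bounded formula with sets need not be [D0]. Following a
    formula together with its negation shows that it is still Delta_1; this eliminates set
    parameters from all formulas of higher complexity. *)
Lemma S1_bounded so (A : formula so) (E : nat -> sets SI) : bounded A ->
  Tn 1 (fun e => ev (S := SI) e E A) /\ Tn 1 (fun e => ~ ev (S := SI) e E A).
Proof.
elim=> {A} [|t u|t u|h' t X|A B _ [A1 A2] _ [B1 B2]|t A _ [A1 A2]|t A _ [A1 A2]].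
- by split; apply: D0_Tn1; [apply: D0_bot|apply: D0_not; apply: D0_bot].
- have H : D0 (fun e : nat -> S0 => eqv (tev e t) (tev e u)) by apply: D0_eq; apply: Tm_tev.
  by split; apply: D0_Tn1; rewrite /ev; under eq_fun do rewrite !tev_SI; [|apply: D0_not].
- have H : D0 (fun e : nat -> S0 => ltr (tev e t) (tev e u)) by apply: D0_lt; apply: Tm_tev.
  by split; apply: D0_Tn1; rewrite /ev; under eq_fun do rewrite !tev_SI; [|apply: D0_not].
- rewrite /=; case: (E X) => Y [P1 [P2 [e0 [H1 H2 H3 H4]]]] /=.
  have sb P : Tn 1 P -> Tn 1 (fun e => P (econs (tev (S := S0) e t) e0)).
    move=> HP; apply: (Tn_subst (s := fun e => econs (tev (S := S0) e t) e0) HP).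
    by case=> [|i] /=; [apply: Tm_tev|apply: Tm_cst].
  split; [apply: Tn_ext (sb _ H1) => e|apply: Tn_ext (sb _ H2) => e].
    by rewrite tev_SI H3.
  by rewrite tev_SI -H4.
- split; first by apply: Tn_ext (S1_or A2 B1) => e; rewrite ev_Imp implyE.
  by apply: Tn_ext (S1_and A1 B2) => e; rewrite ev_Imp not_implyE.
- have eqA e : ev (S := SI) e E (All (Imp (Lt (Var 0) (tlift 1 t)) A)) <->
      forall x, ltr x (tev (S := S0) e t) -> ev (S := SI) (econs x e) E A.
    by rewrite ev_All; split=> H x; have := H x; rewrite ev_Imp ev_Lt tlift1E tev_SI.
  split; first by apply: Tn_ext (S1_all (Tm_tev _ t) A1) => e; rewrite eqA.
  apply: Tn_ext (S1_bex (Tm_tev _ t) A2) => e; rewrite eqA.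
  split=> [[x Hx N] H|H]; first by apply: N; apply: H.
  by apply: contrapT => N; apply: H => x Hx; apply: contrapT => N'; apply: N; exists x.
- have eqA e : ev (S := SI) e E (Ex (And (Lt (Var 0) (tlift 1 t)) A)) <->
      exists2 x, ltr x (tev (S := S0) e t) & ev (S := SI) (econs x e) E A.
    rewrite ev_Ex; split=> [[x]|[x H1 H2]].
      by rewrite ev_And ev_Lt tlift1E tev_SI => -[H1 H2]; exists x.
    by exists x; rewrite ev_And ev_Lt tlift1E tev_SI.
  split; first by apply: Tn_ext (S1_bex (Tm_tev _ t) A1) => e; rewrite eqA.
  apply: Tn_ext (S1_all (Tm_tev _ t) A2) => e; rewrite eqA.
  split=> [H [x Hx HA]|H x Hx HA]; first exact: H Hx HA.
  by apply: H; exists x.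
Qed.

Lemma SigmaPi_Tn so m (E : nat -> sets SI) :
  (forall A : formula so, Sigma m.+1 A -> Tn m.+1 (fun e => ev (S := SI) e E A)) /\
  (forall A : formula so, Pi m.+1 A -> Tn m.+1 (fun e => ~ ev (S := SI) e E A)).
Proof.
elim: m => [|m [IH1 IH2]].
  split=> F HF; inversion HF as [|? A HA]; subst; inversion HA as [? bA|]; subst.
    have [A1 _] := S1_bounded E bA; apply: Tn_ext (S1_ex A1) => e.
    by rewrite ev_Ex.
  have [_ A2] := S1_bounded E bA; apply: Tn_ext (S1_ex A2) => e.
  by rewrite ev_All; split=> [[x Hx] H|/existsNP //]; apply: Hx.
split=> F HF; inversion HF as [|? A HA]; subst.
  exists (fun e => ~ ev (S := SI) e E A); first exact: IH2.
  move=> e; rewrite ev_Ex; split=> -[u Hu]; exists u; first by apply.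
  exact: contrapT.
exists (fun e => ev (S := SI) e E A); first exact: IH1.
by move=> e; rewrite ev_All; split=> [/existsNP //|[x Hx] H]; apply: Hx.
Qed.

Lemma ev_induction so (A : formula so) (e : nat -> SI) E :
  Tn k.+1 (fun e => ev (S := SI) e E A) -> ev e E (induction_axiom A).
Proof.
move=> HA; rewrite /induction_axiom ev_Imp ev_And ev_inst ev_All => -[H0 HS].
rewrite ev_All; apply: (ind (e := e) HA) => // x Hx.
have := HS x; rewrite ev_Imp ev_fsubst => /(_ Hx).
set w := (fun i => tev _ _); suff -> : w = econs (add x uno : SI) e by [].
by apply: funext => -[|i].
Qed.

Lemma SI_arith so (F : formula so) : elementary_arithmetic F -> forall (e : nat -> SI) E, ev e E F.
Proof.
move=> HF e E; case: HF => [[HF|HF]|[A HA ->]].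
- case: HF.
  + by move=> H; apply: (ultraF uU); apply: (ultraS uU) H => n /=; lia.
  + by rewrite ev_Imp /= => H; apply: (ultraS uU) H => n /=; lia.
  + by apply: ultraT => n /=; lia.
  + by apply: ultraT => n /=; lia.
  + by apply: ultraT => n /=; lia.
  + by apply: ultraT => n /=; lia.
  + by move=> H; apply: (ultraF uU); apply: (ultraS uU) H => n.
  + rewrite ev_Iff ev_Or /=; rewrite -ultraU; split; apply: (ultraS uU) => n /=; lia.
- case: HF; first by apply: ultraT => n /=.
  by apply: ultraT => n /=; rewrite addn1 expnS.
- apply: ev_induction; inversion HA; subst.
  by apply: Tn1_Tn; have [] := S1_bounded E H.
Qed.

Lemma SI_ISigma so (F : formula so) : ISigma k.+1 F -> forall (e : nat -> SI) E, ev e E F.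
Proof.
by move=> [A HA ->] e E; apply: ev_induction; apply: (proj1 (SigmaPi_Tn so k E)).
Qed.

Lemma SI_comprehension F : Delta1_comprehension F -> forall (e : nat -> SI) E, ev e E F.
Proof.
move=> [A [B [HA HB ->]]] e E; rewrite /comprehension_axiom ev_Imp ev_All => H.
have A1 := proj1 (SigmaPi_Tn true 0 E) A HA; have B1 := proj2 (SigmaPi_Tn true 0 E) B HB.
have HX : delta1 (fun x => ev (S := SI) (econs x e) E A).
  exists (fun e => ev (S := SI) e E A), (fun e => ~ ev (S := SI) e E B), e; split=> // x.
  by have := H x; rewrite ev_Iff => ->.
rewrite ev_ExS; exists (exist _ _ HX); rewrite ev_All => x.
by rewrite ev_Iff ev_fliftS.
Qed.

Theorem SI_EFA A : proves (theory_union EFA (@ISigma false k.+1)) A ->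
  forall (e : nat -> SI) E, ev e E A.
Proof.
move=> HA e E; apply: (soundness SI_congr _ HA) => // F [] HF e' E'.
  exact: SI_arith.
exact: SI_ISigma.
Qed.

Theorem SI_RCA A : proves (theory_union RCA0star (@ISigma true k.+1)) A ->
  forall (e : nat -> SI) E, ev e E A.
Proof.
move=> HA e E; apply: (soundness SI_congr _ HA) => // F [[HF|HF]|HF] e' E'.
- exact: SI_arith.
- exact: SI_comprehension.
- exact: SI_ISigma.
Qed.

End Cut.

(** * The principle in a cut *)

Definition bit t s := odd (s %/ 2 ^ t).
Definition pairn t u := (t + u) * (t + u) + t.
Definition code xs v := foldr pairn v xs.

Lemma bit_lt t s : bit t s -> t < s.
Proof.
move=> H; rewrite ltnNge; apply/negP => Hs; move: H.
by rewrite /bit divn_small //; apply: leq_ltn_trans Hs (ltn_expl _ _).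
Qed.

Lemma pairn_inj t u t' u' : pairn t u = pairn t' u' -> t = t' /\ u = u'.
Proof.
rewrite /pairn => E; have E2 : t + u = t' + u'; last by lia.
have [H|H|//] := ltngtP (t + u) (t' + u'); nia.
Qed.

Lemma code_inj xs v xs' v' : size xs = size xs' -> code xs v = code xs' v' ->
  xs = xs' /\ v = v'.
Proof.
elim: xs xs' => [|x xs IH] [|x' xs'] //= [Hs] /pairn_inj [-> /(IH _ Hs) [-> ->]] //.
Qed.

Lemma code_le xs v y : (forall x, x \in xs -> x <= y) -> v <= y ->
  code xs v <= code (nseq (size xs) y) y.
Proof.
elim: xs => [|x xs IH] //= H Hv.
have H1 := H x (mem_head _ _); have H2 : code xs v <= code (nseq (size xs) y) y.
  by apply: IH => // z Hz; apply: H; rewrite inE Hz orbT.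
by rewrite /pairn leq_add // leq_mul // leq_add.
Qed.

Lemma nat_code (P : nat -> bool) b : exists2 s, s < 2 ^ b & forall t, bit t s = (t < b) && P t.
Proof.
elim: b => [|b [s Hs IH]].
  by exists 0 => // t; rewrite /bit div0n.
exists (s + P b * 2 ^ b).
  by rewrite expnS; case: (P b); lia.
move=> t; rewrite /bit ltnS; have [E|E] := eqVneq t b.
  by rewrite E addnC divnMDl ?expn_gt0 // divn_small // leqnn addn0; case: (P b).
have [H|H] := ltnP b t; last first.
  have Htb : t < b by rewrite ltn_neqAle E.
  rewrite divnDr; last first.
    by apply: dvdn_mull; apply: dvdn_exp2l; apply: ltnW.
  rewrite oddD -/(bit t s) IH Htb /=.
  have -> : b = (b - t.+1) + t.+1 by lia.
  rewrite expnD expnS mulnA [2 * _]mulnC !mulnA mulnAC mulnK ?expn_gt0 //.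
  by rewrite oddM andbF addbF.
rewrite divn_small //.
have : 2 ^ b.+1 <= 2 ^ t by rewrite leq_exp2l.
by rewrite expnS; case: (P b); lia.
Qed.

Fixpoint incn x (xs : seq nat) R : Prop :=
  if xs is y :: ys then x < y /\ incn y ys R else x <= R.
Definition simplexn a (xs : seq nat) R : Prop :=
  if xs is x :: xs' then a <= x /\ incn x xs' R else True.

Lemma simplexn_le a xs R (x : nat) : simplexn a xs R -> x \in xs -> x <= R.
Proof.
case: xs => // y ys [_]; elim: ys y x => [|z ys IH] y x.
  by rewrite inE => H /eqP ->.
move=> [yz Hz]; rewrite inE => /orP [/eqP ->|]; last exact: IH.
by apply: leq_trans (ltnW yz) (IH z z Hz (mem_head _ _)).
Qed.

(** What the principle amounts to for true numbers at one index, with [g ^ 2] in place of the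
    root. *)
Definition comb n0 N c a R := forall col : (nat -> nat) -> nat,
  localc n0.+2 col -> (forall w, col w < c) ->
  exists h L, [/\ forall i, i < L -> a <= h i <= R, forall i, i.+1 < L -> h i < h i.+1,
    whom n0.+2 col h L & g n0 N (h 0) ^ 2 < L].

Section WPHCut.
Variable U : (nat -> Prop) -> Prop.
Hypothesis uU : ultra U.
Variable h : nat -> nat -> nat.
Hypothesis h_grow : forall i, U (fun n => grow (h i n) <= h i.+1 n).
Let SI := SI uU h_grow.
Let inI := inI U h.
Notation "x @ n" := (ival x n) (at level 10).
Implicit Types (F R a c : SI).

Lemma lee_SI (x y : SI) : lee (S := SI) x y <-> U (fun n => x @ n <= y @ n).
Proof.
rewrite /lee /= -(ultraU uU); split; apply: (ultraS uU) => n; lia.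
Qed.

Lemma inset_SI (t s : SI) : inset (S := SI) t s <-> U (fun n => bit (t @ n) (s @ n)).
Proof.
split=> [[q [r [Hr Hs]]]|H].
  apply: (ultraS2 uU _ Hr Hs) => n /= H1 ->.
  by rewrite /bit divnMDl ?expn_gt0 // divn_small // addn0 oddD oddM.
have Hq : inI (fun n => (s @ n %/ 2 ^ (t @ n))./2).
  apply: (inI_le uU (ivalP s)); apply: (ultraT uU) => n.
  by have := leq_div (s @ n) (2 ^ (t @ n)); lia.
have Hr : inI (fun n => s @ n %% 2 ^ (t @ n)).
  by apply: (inI_le uU (ivalP s)); apply: (ultraT uU) => n; apply: leq_mod.
exists (mkI Hq), (mkI Hr); split; first by apply: (ultraT uU) => n /=; rewrite ltn_mod expn_gt0.
apply: (ultraS uU) H => n; rewrite /bit /= => H.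
rewrite {1}(divn_eq (s @ n) (2 ^ (t @ n))); congr (_ * _ + _).
by have := odd_double_half (s @ n %/ 2 ^ (t @ n)); rewrite H; lia.
Qed.

Definition at_ (xs : seq SI) n : seq nat := map (fun x => x @ n) xs.

Lemma ival_code (v : SI) xs n : (foldr (pairs (S := SI)) v xs) @ n = code (at_ xs n) (v @ n).
Proof. by elim: xs => //= x xs ->. Qed.

Lemma app_SI F (xs : seq SI) v : app (S := SI) F xs v <-> U (fun n => bit (code (at_ xs n) (v @ n)) (F @ n)).
Proof.
by rewrite /app inset_SI; split; apply: (ultraS uU) => n; rewrite ival_code.
Qed.

Lemma simplex_SI a (xs : seq SI) R : simplex (S := SI) a xs R <-> U (fun n => simplexn (a @ n) (at_ xs n) (R @ n)).
Proof.
have uA P Q : U (fun n => P n /\ Q n) <-> U P /\ U Q.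
  split=> [H|[]]; last exact: (ultraI uU).
  by split; apply: (ultraS uU) H => n [].
case: xs => [|x xs] /=; first by split=> // _; apply: (ultraT uU).
rewrite uA lee_SI; suff -> : increasing (S := SI) x xs R <->
  U (fun n => incn (x @ n) (at_ xs n) (R @ n)) by [].
by elim: xs x => [|y xs IH] x /=; rewrite ?lee_SI // uA IH.
Qed.

Lemma num_SI j n : (num SI j) @ n = j.
Proof. by elim: j => //= j ->; rewrite addn1. Qed.

Lemma logiter_SI j (x y : SI) : logiter (S := SI) j x y -> U (fun n => y @ n = lg j (x @ n)).
Proof.
elim: j y => [|j IH] y /=; first by apply: (ultraS uU).
move=> [z [/IH Hz Hl]]; case: Hl => [[H1 H2]|[/lee_SI H1 H2]].
  by apply: (ultraS2 uU _ Hz (ultraI uU H1 H2)) => n /= E [E1 ->]; rewrite -E E1 trunc_log0.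
apply: (ultraS2 uU _ Hz (ultraI uU H1 H2)) => n /= E [H3 H4]; rewrite -E.
apply/esym/trunc_log_eq => //; rewrite -(addn1 (y @ n)); apply/andP; split; [exact: H3|exact: H4].
Qed.

(** The convention for the 0-th root is the reason for [maxn n 1]: that root is the identity, like
    the first one. *)
Lemma rootlog_SI n j (x y : SI) : rootlog (S := SI) n j x y ->
  U (fun i => g j (maxn n 1) (x @ i) ^ 2 <= y @ i).
Proof.
move=> [z [/logiter_SI Hz Hr]].
have N2 : 0 < 2 * maxn n 1 by lia.
have gz i : z @ i = lg j (x @ i) -> (g j (maxn n 1) (x @ i) ^ 2) ^ maxn n 1 <= z @ i.
  by move=> ->; have /andP[H _] := rtP (lg j (x @ i)) N2; rewrite -expnM.
case: n Hr N2 gz => [|n] Hr N2 gz.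
  by apply: (ultraS2 uU _ Hz Hr) => i /gz; rewrite expn1 => H <-.
case: Hr => /lee_SI H1 H2; rewrite (maxn_idPl _) // in gz *.
apply: (ultraS2 uU _ Hz H2) => i /gz H3 /=; rewrite num_SI addn1 => H4.
by rewrite -ltnS -(ltn_exp2r _ _ (ltn0Sn n)) -(addn1 n); apply: leq_ltn_trans H4; rewrite addn1.
Qed.

Variables n0 n : nat.
Hypothesis W : wph (S := SI) n0.+2 (rootlog n n0).

(** If [comb] failed almost everywhere, the bad colorings at the single indices would form one
    coloring of the cut: its code is below [2 ^ b], and the cut is closed under exponentiation. The
    weakly homogeneous set given by the cut is then read back at almost every index. *)
Theorem wph_comb (c a : SI) : exists R : SI,
  U (fun i => comb n0 (maxn n 1) (c @ i) (a @ i) (R @ i)).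
Proof.
have [R HR] := W c a; exists R; apply: contrapT => /(ultraN uU) HN.
set N := maxn n 1 in HN.
pose bad i (col : (nat -> nat) -> nat) := [/\ localc n0.+2 col, (forall w, col w < c @ i) &
  ~ exists h L, [/\ forall j, j < L -> a @ i <= h j <= R @ i, forall j, j.+1 < L -> h j < h j.+1,
    whom n0.+2 col h L & g n0 N (h 0) ^ 2 < L]].
have ch1 i : exists col, ~ comb n0 N (c @ i) (a @ i) (R @ i) -> bad i col.
  case: (pselect (comb n0 N (c @ i) (a @ i) (R @ i))) => [H|].
    by exists (fun=> 0).
  by move=> /existsNP [col /not_implyP [H1 /not_implyP [H2 H3]]]; exists col.
have [col Hcol] := choice ch1.
have {}HN : U (fun i => bad i (col i)) by apply: (ultraS uU) HN => i /Hcol.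
(* At least every entry and every color, so the code of the constant tuple bounds all codes. *)
pose y i := R @ i + c @ i.
pose b i := (code (nseq n0.+2 (y i)) (y i)).+1.
pose isC i t := `[< exists xs, [/\ size xs = n0.+2, simplexn (a @ i) xs (R @ i) &
   t = code xs (col i (nth 0 xs))] >].
have ch2 i : exists t, t < 2 ^ b i /\ forall u, bit u t = (u < b i) && isC i u.
  by have [t H1 H2] := nat_code (isC i) (b i); exists t.
have [C0 HC] := choice ch2.
have Hy : inI y by apply: (inI_add uU h_grow); apply: ivalP.
have HC0 : inI C0.
  apply: (@inI_le _ uU h _ (fun i => 2 ^ b i)); last first.
    by apply: (ultraT uU) => i; apply: ltnW; case: (HC i).
  apply: (inI_pow uU h_grow); first exact: inI_cst.
  rewrite /b; elim: (n0.+2) => [|m IH] /=.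
    by apply: (@inI_le _ uU h _ (fun i => y i + 1));
      [apply: (inI_add uU h_grow) => //; apply: inI_cst|apply: (ultraT uU) => i; rewrite addn1].
  have Hw : inI (fun i => code (nseq m (y i)) (y i)).
    by apply: (inI_le uU IH); apply: (ultraT uU) => i.
  have Hs : inI (fun i => y i + code (nseq m (y i)) (y i)) by apply: (inI_add uU h_grow).
  apply: (@inI_le _ uU h _ (fun i => pairn (y i) (code (nseq m (y i)) (y i)) + 1)).
    apply: (inI_add uU h_grow); last exact: inI_cst.
    by apply: (inI_add uU h_grow) => //; apply: (inI_mul uU h_grow).
  by apply: (ultraT uU) => i; rewrite addn1.
pose C : SI := mkI HC0.
have Cbit xs v : size xs = n0.+2 -> U (fun i => simplexn (a @ i) (at_ xs i) (R @ i)) ->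
    app (S := SI) C xs v <-> U (fun i => v @ i = col i (nth 0 (at_ xs i))).
  move=> Hs Hx; rewrite app_SI; split=> H.
    apply: (ultraS2 uU _ H (ultraI uU Hx HN)) => i /=; rewrite (HC i).2.
    move=> /andP [_ /asboolP [ys [H1 H2 H3]]] _.
    by have [|-> ->] := code_inj _ H3; first by rewrite size_map Hs H1.
  apply: (ultraS2 uU _ H (ultraI uU Hx HN)) => i /= -> [H1 [H2 H3 _]].
  rewrite (HC i).2; apply/andP; split; last first.
    by apply/asboolP; exists (at_ xs i); split=> //; rewrite size_map.
  rewrite /b ltnS -Hs -(size_map (fun x => x @ i)); apply: code_le.
    by move=> x /(simplexn_le H1); rewrite /y; lia.
  by apply: ltnW; apply: leq_trans (H3 _) _; rewrite /y leq_addl.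
have Ccol : coloring (S := SI) n0.+2 C c a R.
  move=> xs Hs /simplex_SI Hx.
  have Hv : inI (fun i => col i (nth 0 (at_ xs i))).
    by apply: (inI_le uU (ivalP c)); apply: (ultraS uU) HN => i [_ H _]; apply: ltnW.
  exists (mkI Hv); split; first by apply: (ultraS uU) HN => i [_ H _]; apply: H.
  by move=> w; rewrite Cbit.
have Capp xs v : size xs = n0.+2 -> app (S := SI) C xs v ->
    U (fun i => v @ i = col i (nth 0 (at_ xs i))).
  move=> Hs /app_SI H; apply: (ultraS uU) H => i /=; rewrite (HC i).2.
  move=> /andP [_ /asboolP [ys [H1 H2 H3]]].
  by have [|-> ->] := code_inj _ H3; first by rewrite size_map Hs H1.
have {Ccol} [H [k [s [Hsub [He1 He2 He3] Hwk [m [z [[Hm1 Hm2] Hmz Hzk]]]]]]] := HR C Ccol.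
(* Choosing values index by index turns the enumeration in the cut into sequences of true
   numbers. *)
pose isv i t v := bit v (H @ i) /\ bit (pairn t v) (s @ i).
have ch3 i t : exists v, (exists v', isv i t v') -> isv i t v.
  by case: (pselect (exists v', isv i t v')) => [[v Hv]|N']; [exists v|exists 0].
have ch4 i : exists f : nat -> nat, forall t, (exists v', isv i t v') -> isv i t (f t).
  by have [f Hf] := choice (ch3 i); exists f.
have [hh Hhh] := choice ch4.
have F1 : U (fun i => forall t, t < k @ i -> isv i t (hh i t)).
  apply: (ultra_all uU) => t Ht.
  have It : inI t by apply: (inI_le uU (ivalP k)); apply: (ultraS uU) Ht => i; apply: ltnW.
  have [v [/inset_SI Hv Hv']] := He1 (mkI It) Ht.
  have /app_SI Hv2 : app (S := SI) s [:: mkI It] v by apply/Hv'; apply: (ultraT uU).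
  by apply: (ultraS2 uU _ Hv Hv2) => i H1 H2; apply: Hhh; exists (v @ i).
have Ihh t : U (fun i => t i < k @ i) -> inI (fun i => hh i (t i)).
  move=> Ht; apply: (inI_le uU (ivalP H)); apply: (ultraS2 uU _ Ht F1) => i H1 H2.
  by have [/bit_lt /ltnW] := H2 _ H1.
have It t : U (fun i => t i < k @ i) -> inI t.
  by move=> Ht; apply: (inI_le uU (ivalP k)); apply: (ultraS uU) Ht => i; apply: ltnW.
have Fapp t (Ht : U (fun i => t i < k @ i)) : app (S := SI) s [:: mkI (It t Ht)] (mkI (Ihh t Ht)).
  by apply/app_SI; apply: (ultraS2 uU _ Ht F1) => i H1 H2; have [] := H2 _ H1.
have F2 : U (fun i => forall t, t < (k @ i).-1 -> hh i t < hh i t.+1).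
  apply: (ultra_all uU) => t Ht.
  have Ht1 : U (fun i => (t i).+1 < k @ i) by apply: (ultraS uU) Ht => i; lia.
  have Ht0 : U (fun i => t i < k @ i) by apply: (ultraS uU) Ht => i; lia.
  have := He2 (mkI (It _ Ht0)) (mkI (It _ Ht1)) (mkI (Ihh _ Ht0)) (mkI (Ihh _ Ht1)).
  apply=> //; by [apply: (ultraT uU)|apply: Fapp].
have F3 : U (fun i => forall t, t < k @ i -> a @ i <= hh i t <= R @ i).
  apply: (ultra_all uU) => t Ht.
  have : inset (S := SI) (mkI (Ihh t Ht)) H.
    by apply/inset_SI; apply: (ultraS2 uU _ Ht F1) => i H1 H2; have [] := H2 _ H1.
  move=> /Hsub [/lee_SI H1 /lee_SI H2].
  by apply: (ultraS2 uU _ H1 H2) => i /= -> ->.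
have F4 : U (fun i => forall t, t < k @ i - n0.+2 ->
    col i (win (hh i) t) = col i (win (hh i) t.+1)).
  apply: (ultra_all uU) => t Ht.
  have Htj j : j < n0.+3 -> U (fun i => t i + j < k @ i).
    by move=> Hj; apply: (ultraS uU) Ht => i; lia.
  have Ht0 : U (fun i => t i < k @ i) by apply: (ultraS uU) Ht => i; lia.
  (* The default 0 makes [xj] total in [j]. *)
  have Htj' j : U (fun i => t i + (if j < n0.+3 then j else 0) < k @ i).
    by apply: Htj; case: ifP.
  pose xj j : SI := mkI (Ihh _ (Htj' j)).
  pose xs := mkseq xj n0.+3.
  have xsE j i : j < n0.+3 -> nth 0 (at_ xs i) j = hh i (t i + j).
    by move=> Hj; rewrite (nth_map (xj 0)) ?size_mkseq // nth_mkseq //= Hj.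
  have [|||v [Hv1 Hv2]] := Hwk (mkI (It _ Ht0)) xs.
  - by rewrite size_mkseq.
  - by apply: (ultraS uU) Ht => i /=; rewrite num_SI; lia.
  - move=> j Hj; rewrite nth_mkseq //.
    apply/app_SI; apply: (ultraS2 uU _ (Htj' j) F1) => i H1 H2 /=.
    by rewrite num_SI; have [_] := H2 _ H1; rewrite Hj.
  have {}Hv1 := Capp _ _ _ Hv1; have {}Hv2 := Capp _ _ _ Hv2.
  have T1 : size (take n0.+2 xs) = n0.+2 by rewrite size_takel // size_mkseq.
  have T2 : size (drop 1 xs) = n0.+2 by rewrite size_drop size_mkseq subn1.
  apply: (ultraS2 uU _ (Hv1 T1) (ultraI uU (Hv2 T2) HN)) => i E1 [E2 [L _ _]].
  rewrite (L _ (nth 0 (at_ (take n0.+2 xs) i))); last first.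
    move=> j Hj; rewrite /at_ map_take nth_take // xsE //; lia.
  rewrite -E1 E2; apply: L => j Hj.
  by rewrite /at_ map_drop nth_drop xsE ?ltnS // /win; congr (hh i _); lia.
(* The minimum is enumerated at some [t0]; as the enumeration increases, it equals the entry at
   0. *)
have [t0 [Ht0 Hmt]] := He3 m Hm1.
have {}Ht0 : U (fun i => t0 @ i < k @ i) := Ht0.
have [v0 [_ Hv0]] := He1 t0 Ht0.
have E1 := (Hv0 m).1 Hmt.
have E2 : U (fun i => hh i (t0 @ i) = v0 @ i).
  apply: (Hv0 (mkI (Ihh _ Ht0))).1; apply/app_SI.
  by apply: (ultraS2 uU _ Ht0 F1) => i H1 H2; have [] := H2 _ H1.
have k0 : U (fun i => 0 < k @ i) by apply: (ultraS uU) Ht0 => i; lia.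
have Hm0 : U (fun i => m @ i <= hh i 0).
  have /Hm2 /lee_SI // : inset (S := SI) (mkI (Ihh (fun=> 0) k0)) H.
  by apply/inset_SI; apply: (ultraS2 uU _ k0 F1) => i H1 H2; have [] := H2 _ H1.
have Em : U (fun i => m @ i = hh i 0).
  apply: (ultraS2 uU _ (ultraI uU (ultraI uU E1 E2) (ultraI uU Hm0 Ht0)) F2).
  move=> i [[-> <-] [H1 H2]] H3; apply/eqP; rewrite eqn_leq H1 /=.
  elim: (t0 @ i) H2 => // t IH Ht; apply: leq_trans (IH (ltnW Ht)) _.
  by apply: ltnW; apply: H3; lia.
have Hz := rootlog_SI Hmz.
have uA := ultraI uU (ultraI uU (ultraI uU F2 F3) (ultraI uU F4 Em)) (ultraI uU (ultraI uU Hz Hzk) HN).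
apply: (ultraF uU); apply: (ultraS uU) uA.
move=> i [[[G2 G3] [G4 Gm]] [[Gz Gk] [_ _]]]; apply.
exists (hh i), (k @ i); split=> //.
- by move=> j Hj; apply: G2; lia.
- by move=> j Hj; apply: G4; lia.
- by rewrite -Gm; apply: leq_ltn_trans Gz Gk.
Qed.

End WPHCut.

Lemma ultra_exists : exists U, ultra U /\ forall m, U (fun n => m <= n).
Proof.
have [G [uG sG]] := filter.ultraFilterLemma (filter.eventually_filter).
have pG : filter.ProperFilter G := filter.ultra_proper.
exists G; split; last first.
  by move=> m; apply: sG; exists m.
split.
- by move=> P Q H; apply: filter.filterS.
- by move=> P Q; apply: filter.filterI.
- by move=> P; apply: (filter.in_ultra_setVsetC (F := G)).
- exact: filter.filter_not_empty.
Qed.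

(** ** The cut of standard elements *)

Section StandardCut.
Variable U : (nat -> Prop) -> Prop.
Hypothesis uU : ultra U.

Definition std i (_ : nat) := iter i grow 0.

Lemma std_grow i : U (fun n => grow (std i n) <= std i.+1 n).
Proof. by apply: (ultraT uU) => n. Qed.

Let S0 := S0 uU std_grow.
Definition scst m : S0 := mkI (inI_cst uU std_grow m).

Lemma std_cst (x : S0) : exists m, eqv x (scst m).
Proof.
have [i Hi] := ivalP x; rewrite /= /std in Hi *; move: (iter i grow 0) Hi => M.
elim: M => [|M IH] H; first by case: (ultraF uU); apply: (ultraS uU) H => n.
have : U (fun n => ival x n < M \/ ival x n = M).
  by apply: (ultraS uU) H => n; rewrite ltnS leq_eqVlt => /orP [/eqP|]; [right|left].
by rewrite (ultraU uU) => -[/IH|] //; exists M.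
Qed.

Lemma std_ind k : @Ind U uU std std_grow k.
Proof.
move=> P e HP H0 HS x; have [m Hm] := std_cst x.
have cS := S0_congr uU std_grow.
have cP y y' : eqv y y' -> P (econs y e) -> P (econs y' e).
  by move=> Hy; apply: (Tn_congr cS HP) => -[|i] //=; apply: (ultraT uU).
apply: (cP (scst m)); first by apply: (ultraS uU) Hm.
elim: m {Hm} => [|m IH]; first by apply: cP H0; apply: (ultraT uU).
by apply: cP (HS _ IH); apply: (ultraT uU) => n /=; rewrite addn1.
Qed.

Lemma std_coll k : @Coll U uU std std_grow k.
Proof.
move=> Q e s HQ H; have [m Hm] := std_cst s.
have cS := S0_congr uU std_grow.
have : exists w : S0, forall j, j < m -> exists2 u, ltr u w & ~ Q (econs u (econs (scst j) e)).
  have : forall j, j < m -> exists u, ~ Q (econs u (econs (scst j) e)).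
    by move=> j Hj; apply: H; apply: (ultraS uU) Hm => n /= ->.
  elim: (m) => [|m' IH] Hu; first by exists zer.
  have [w Hw] := IH (fun j Hj => Hu j (ltnW Hj)); have [u HNu] := Hu m' (ltnSn _).
  exists (sums w u) => j; rewrite ltnS leq_eqVlt => /orP [/eqP ->|/Hw [u' H1 H2]].
    by exists u => //; apply: sums_r.
  by exists u' => //; apply: (ultraS uU) H1 => n /= H1; lia.
move=> [w Hw]; exists w => x Hx; have [j Hj] := std_cst x.
have jm : j < m.
  have [n _] := ultra_ex uU (n0 := 0) (ultraI uU Hx (ultraI uU Hm Hj)) (ultraT uU (fun n => isT : 0 <= n)).
  by move=> /= [H1 [H2 H3]]; rewrite -H2 -H3.
have [u H1 H2] := Hw j jm; exists u => // HQu; apply: H2.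
apply: (Tn_congr cS HQ) HQu => -[|[|i]] //=; by apply: (ultraT uU).
Qed.

End StandardCut.

(** ** Enumerating formulas *)

(** Finite stages replace a coding of syntax: index [nu] knows the formulas of [fen nu], and each
    formula is known from some index on. *)
Fixpoint ten n : seq term :=
  if n is n'.+1 then
    [:: Zero; One] ++ map Var (iota 0 (n' + 1)) ++
    List.flat_map (fun t => List.flat_map (fun u => [:: Add t u; Mul t u; Exp t u]) (ten n')) (ten n')
  else [::].

Fixpoint fen n : seq (formula false) :=
  if n is n'.+1 then
    Bot :: List.flat_map (fun t => List.flat_map (fun u => [:: Eq t u; Lt t u]) (ten n')) (ten n')
    ++ List.flat_map (fun A => List.flat_map (fun B => [:: Imp A B]) (fen n')) (fen n')
    ++ map (@All false) (fen n')
  else [::].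

Lemma mem_In (x : nat) s : x \in s -> List.In x s.
Proof.
by elim: s => //= y s IH; rewrite inE => /orP [/eqP ->|/IH]; [left|right].
Qed.

Lemma ten_in t : exists m, forall n, m <= n -> List.In t (ten n).
Proof.
have bin t1 t2 o : List.In o [:: Add t1 t2; Mul t1 t2; Exp t1 t2] ->
    (exists m, forall n, m <= n -> List.In t1 (ten n)) ->
    (exists m, forall n, m <= n -> List.In t2 (ten n)) ->
    exists m, forall n, m <= n -> List.In o (ten n).
  move=> Ho [m1 H1] [m2 H2]; exists (m1 + m2).+1 => -[//|n] Hn /=; right; right.
  apply/List.in_app_iff; right.
  apply/List.in_flat_map; exists t1; split; first by apply: H1; lia.
  by apply/List.in_flat_map; exists t2; split => //; apply: H2; lia.
elim: t => [i| | |t1 H1 t2 H2|t1 H1 t2 H2|t1 H1 t2 H2].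
- exists i.+1 => -[//|n] Hn /=; right; right.
  have : List.In (Var i) (map Var (iota 0 (n + 1))).
    by apply: List.in_map; apply: mem_In; rewrite mem_iota; lia.
  by move=> HV; apply/List.in_app_iff; left.
- by exists 1 => -[//|n] _; left.
- by exists 1 => -[//|n] _; right; left.
- by apply: (bin t1 t2) => //=; auto.
- by apply: (bin t1 t2) => //=; auto.
- by apply: (bin t1 t2) => //=; auto.
Qed.

Lemma fen_in A : exists m, forall n, m <= n -> List.In A (fen n).
Proof.
elim: A => [|t u|t u|//|A [m1 H1] B [m2 H2]|A [m1 H1]|//].
- by exists 1 => -[//|n] _; left.
- have [m1 H1] := ten_in t; have [m2 H2] := ten_in u.
  exists (m1 + m2).+1 => -[//|n] Hn; right; apply/List.in_app_iff; left.
  apply/List.in_flat_map; exists t; split; first by apply: H1; lia.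
  by apply/List.in_flat_map; exists u; split; [apply: H2; lia|left].
- have [m1 H1] := ten_in t; have [m2 H2] := ten_in u.
  exists (m1 + m2).+1 => -[//|n] Hn; right; apply/List.in_app_iff; left.
  apply/List.in_flat_map; exists t; split; first by apply: H1; lia.
  by apply/List.in_flat_map; exists u; split; [apply: H2; lia|right; left].
- exists (m1 + m2).+1 => -[//|n] Hn; right; apply/List.in_app_iff; right.
  apply/List.in_app_iff; left.
  apply/List.in_flat_map; exists A; split; first by apply: H1; lia.
  by apply/List.in_flat_map; exists B; split; [apply: H2; lia|left].
- exists m1.+1 => -[//|n] Hn; right; apply/List.in_app_iff; right.
  by apply/List.in_app_iff; right; apply: List.in_map; apply: H1.
Qed.

Lemma In_nth T (x0 x : T) s : List.In x s -> exists2 i, i < size s & nth x0 s i = x.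
Proof.
elim: s => // y s IH [->|/IH [i Hi Hx]]; first by exists 0.
by exists i.+1.
Qed.

(** Replaces a notion of free variable: it limits the parameters that have to be coded to finitely
    many. *)
Lemma ev_finite so (A : formula so) : exists v, forall (S : struc) (e e' : nat -> S) E,
  (forall i, i < v -> e i = e' i) -> ev e E A <-> ev e' E A.
Proof.
have tv t : exists v, forall (S : struc) (e e' : nat -> S),
    (forall i, i < v -> e i = e' i) -> tev e t = tev e' t.
  elim: t => [i| | |t [v1 H1] u [v2 H2]|t [v1 H1] u [v2 H2]|t [v1 H1] u [v2 H2]].
  - by exists i.+1 => S e e' H; apply: H.
  - by exists 0.
  - by exists 0.
  - by exists (v1 + v2) => S e e' H /=; rewrite (H1 S e e') ?(H2 S e e') // => i Hi; apply: H; lia.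
  - by exists (v1 + v2) => S e e' H /=; rewrite (H1 S e e') ?(H2 S e e') // => i Hi; apply: H; lia.
  - by exists (v1 + v2) => S e e' H /=; rewrite (H1 S e e') ?(H2 S e e') // => i Hi; apply: H; lia.
elim: A => [|t u|t u|h t X|A [v1 H1] B [v2 H2]|A [v H]|h A [v H]].
- by exists 0.
- have [v1 H1] := tv t; have [v2 H2] := tv u; exists (v1 + v2) => S e e' E H /=.
  by rewrite (H1 S e e') ?(H2 S e e') // => i Hi; apply: H; lia.
- have [v1 H1] := tv t; have [v2 H2] := tv u; exists (v1 + v2) => S e e' E H /=.
  by rewrite (H1 S e e') ?(H2 S e e') // => i Hi; apply: H; lia.
- by have [v1 H1] := tv t; exists v1 => S e e' E H /=; rewrite (H1 S e e').
- exists (v1 + v2) => S e e' E H; rewrite !ev_Imp.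
  by rewrite (H1 S e e' E) ?(H2 S e e' E) // => i Hi; apply: H; lia.
- exists v => S e e' E He; rewrite !ev_All.
  have Hx x : ev (econs x e) E A <-> ev (econs x e') E A.
    by apply: H => -[|i] //= Hi; apply: He; lia.
  by split=> HA x; have := HA x; rewrite Hx.
- exists v => S e e' E He.
  by split=> HA X; apply/(H S e e' (econs X E) He); apply: HA.
Qed.

Definition NN : struc := @Struc nat eq 0 1 addn muln expn (fun x y => x < y) unit (fun _ _ => False).

Lemma ev_Ex_All so (A B : formula so) (S : struc) (e : nat -> S) E :
  ev e E (Ex (And A B)) <-> ev e E (Not (All (Imp A (Not B)))).
Proof.
rewrite ev_Not ev_Ex ev_All; split=> [[x]|H].
  by rewrite ev_And => -[HA HB] /(_ x); apply.
by apply: contrapT => N; apply: H => x HA HB; apply: N; exists x; rewrite ev_And.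
Qed.

(** * Transfer of bounded formulas between a cut and the indices *)

Section Los.
Variable U : (nat -> Prop) -> Prop.
Hypothesis uU : ultra U.
Variable h : nat -> nat -> nat.
Hypothesis h_grow : forall i, U (fun n => grow (h i n) <= h i.+1 n).
Let S0 := S0 uU h_grow.

Definition enth (e : nat -> S0) n : nat -> NN := fun i => ival (e i) n.

Lemma tev_nth (e : nat -> S0) t n : ival (tev e t) n = tev (enth e n) t.
Proof. by elim: t => //= t -> u ->. Qed.

Lemma enth_econs x e n : enth (econs x e) n = econs (ival x n : NN) (enth e n).
Proof. by apply: funext => -[]. Qed.

(** A bounded quantifier ranges below an element of the cut, so counterexamples chosen at almost
    every index form an element of the cut again. *)
Lemma los (A : formula false) : bounded A -> forall e : nat -> S0,
  ev e (fun=> tt) A <-> U (fun n => ev (enth e n) (fun=> tt) A).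
Proof.
have ball t (B : formula false) (e : nat -> S0) : (forall e : nat -> S0,
    ev e (fun=> tt) B <-> U (fun n => ev (enth e n) (fun=> tt) B)) ->
    ev e (fun=> tt) (All (Imp (Lt (Var 0) (tlift 1 t)) B)) <->
    U (fun n => ev (enth e n) (fun=> tt) (All (Imp (Lt (Var 0) (tlift 1 t)) B))).
  move=> IH; rewrite ev_All; split=> H.
    suff : U (fun n => forall y, y < tev (enth e n) t -> ev (econs (y : NN) (enth e n)) (fun=> tt) B).
      by apply: (ultraS uU) => n Hn; rewrite ev_All => y; rewrite ev_Imp ev_Lt tlift1E; apply: Hn.
    apply: (ultra_all uU) => y Hy.
    have Iy : inI U h y.
      apply: (inI_le uU (ivalP (tev e t))); apply: (ultraS uU) Hy => n.
      by rewrite tev_nth; apply: ltnW.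
    have := H (mkI Iy); rewrite ev_Imp ev_Lt tlift1E IH.
    have Hlt : ltr (tev (econs (mkI Iy : S0) e) (Var 0)) (tev e t).
      by apply: (ultraS uU) Hy => n; rewrite /= tev_nth.
    by move=> /(_ Hlt); apply: (ultraS uU) => n; rewrite enth_econs.
  move=> x; rewrite ev_Imp ev_Lt tlift1E IH => Hx.
  apply: (ultraS2 uU _ Hx H) => n H1; rewrite ev_All => /(_ (ival x n)).
  by rewrite ev_Imp ev_Lt tlift1E enth_econs; apply; have := H1; rewrite /= tev_nth.
have neg (B : formula false) (e : nat -> S0) : (ev e (fun=> tt) B <-> U (fun n => ev (enth e n) (fun=> tt) B)) ->
    (ev e (fun=> tt) (Not B) <-> U (fun n => ev (enth e n) (fun=> tt) (Not B))).
  by move=> H; rewrite ev_Not H -(ultraN uU).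
elim=> {A} [|t u|t u|//|A B _ IHA _ IHB|t A _ IH|t A _ IH] e.
- by split=> // /(ultraF uU).
- by split; apply: (ultraS uU) => n /=; rewrite !tev_nth.
- by split; apply: (ultraS uU) => n /=; rewrite !tev_nth.
- by rewrite ev_Imp IHA IHB (ultra_imp uU).
- exact: ball.
rewrite ev_Ex_All neg; last by apply: ball => e'; apply: neg.
by split; apply: (ultraS uU) => n; rewrite ev_Ex_All.
Qed.

End Los.

(** ** Cuts given by scattered sequences *)

Definition unpr1 q := logn 2 q.
Definition unpr2 q := (q %/ 2 ^ logn 2 q)./2.
(** Every number codes a whole environment, and [pr] pushes an entry onto it. So one number carries
    bound variables, the index of a formula, and parameters. *)
Fixpoint envq q i := if i is j.+1 then envq (unpr1 q) j else unpr2 q.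

Lemma envq_pr p u : envq (pr p u) = econs u (envq p).
Proof.
apply: funext => -[|i] /=; last by rewrite /unpr1 pr_log.
by rewrite /unpr2 pr_log /pr mulKn ?expn_gt0 //= uphalf_double.
Qed.

Lemma pr_lt p u y : p < y -> u < y -> pr p u < grow y.
Proof.
move=> Hp Hu; rewrite /pr /grow; have := ltn_expl y (isT : 1 < 2) => Hy.
have H1 : 2 ^ p < 2 ^ y by rewrite ltn_exp2l.
have -> : 3 * y = y + (y + y) by lia.
rewrite !expnD; apply: ltn_mul => //; nia.
Qed.

Lemma pr_mono p u p' u' : p <= p' -> u <= u' -> pr p u <= pr p' u'.
Proof. by move=> H1 H2; rewrite /pr leq_mul // ?leq_exp2l // ltnS leq_double. Qed.

Lemma ecatE T (x0 : T) xs e i :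
  ecat xs e i = if i < size xs then nth x0 xs i else e (i - size xs).
Proof. by elim: xs i => [|x xs IH] [|i] //=; rewrite ?subn0 // IH subSS ltnS. Qed.

(** One matrix serves for all formulas of [fen nu]: the entry at position [n0.+2] of
    the environment coded by [q] selects the formula. *)
Definition matrix n0 nu (q : nat) : bool :=
  `[< ev (S := NN) (fun i => if i < n0.+2 then envq q i else envq q i.+1)
        (fun=> tt) (nth Bot (fen nu) (envq q n0.+2)) >].

Section ScatteredCut.
Variable U : (nat -> Prop) -> Prop.
Hypothesis uU : ultra U.
Hypothesis U_free : forall m, U (fun n => m <= n).
Variables (n0 : nat) (D : nat -> nat -> seq nat) (z0 R : nat -> nat).
Let th := matrix n0.
Hypothesis HG : forall nu j, j <= n0.+1 -> Good (th nu) (z0 nu) (R nu) j (D nu j).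
Hypothesis HP : forall nu j, j <= n0 -> prefix (D nu j.+1) (B (th nu) j (D nu j)).
Hypothesis Hsz : forall nu, nu <= size (D nu n0.+1).
Hypothesis Hz : forall nu, size (fen nu) <= z0 nu.

Definition hE i nu := nth 0 (D nu n0.+1) i.

Lemma D_facts nu j : j <= n0.+1 -> [/\ D nu j != [::], sorted ltn (D nu j), nth 0 (D nu j) 0 = z0 nu &
  forall x : nat, x \in D nu j -> (exists i, x = Z (z0 nu) i) /\ x <= R nu].
Proof. by move=> Hj; apply: Good_facts (HG nu Hj). Qed.

Lemma D_sorted nu j : j <= n0.+1 -> sorted ltn (D nu j).
Proof. by case/(D_facts nu). Qed.

Lemma D_grow nu j i : j <= n0.+1 -> i.+1 < size (D nu j) ->
  grow (nth 0 (D nu j) i) <= nth 0 (D nu j) i.+1.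
Proof.
move=> Hj Hi; have [D0 sD _ aD] := D_facts nu Hj.
have [[a Ha] _] := aD _ (mem_nth 0 (ltnW Hi)); have [[b Hb] _] := aD _ (mem_nth 0 Hi).
have := sorted_nth sD Hi (ltnSn i); rewrite Ha Hb => Hab.
have ab : a < b.
  rewrite ltnNge; apply/negP; rewrite leq_eqVlt => /orP [/eqP E|/(Z_lt (z0 nu)) H].
    by rewrite E ltnn in Hab.
  by lia.
have : Z (z0 nu) a.+1 <= Z (z0 nu) b.
  by move: ab; rewrite leq_eqVlt => /orP [/eqP -> //|/(Z_lt (z0 nu)) /ltnW].
by [].
Qed.

Lemma D_sub nu j j' : j <= j' -> j' <= n0.+1 -> {subset D nu j' <= D nu j}.
Proof.
elim: j' => [|j' IH]; first by rewrite leqn0 => /eqP -> _ x.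
rewrite leq_eqVlt => /orP [/eqP -> _ x //|Hj] Hj' x Hx.
have [D0 sD _ _] := D_facts nu (ltnW Hj').
apply: IH => //; first exact: ltnW.
by apply: (B_mem (theta := th nu) (j := j') D0 sD); apply: prefix_mem Hx; apply: HP.
Qed.

Lemma hE_grow i : U (fun n => grow (hE i n) <= hE i.+1 n).
Proof.
apply: (ultraS uU) (U_free i.+2) => n Hn; apply: D_grow => //.
by apply: leq_trans (Hsz n).
Qed.

Let S0 := S0 uU hE_grow.
Let inI := inI U hE.

Lemma inI_pr p u : inI p -> inI u -> inI (fun n => pr (p n) (u n)).
Proof.
move=> Hp Hu; have [i Hi] := inI2 uU hE_grow Hp Hu; exists i.+1.
apply: (ultraS2 uU _ Hi (hE_grow i)) => n [H1 H2] H3.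
exact: leq_trans (pr_lt H1 H2) H3.
Qed.

Definition prI (q u : S0) : S0 := mkI (inI_pr (ivalP q) (ivalP u)).

(** Sigma_j truth in the cut with unbounded quantifiers; [T] is its bounded counterpart at a single
    index. *)
Fixpoint TI j (q : S0) : Prop :=
  if j is j'.+1 then exists u, ~ TI j' (prI q u) else U (fun n => th n (ival q n)).

Definition inD j (t : nat -> nat) := U (fun n => t n < size (D n j)) /\
  inI (fun n => nth 0 (D n j) (t n)).

Lemma inD_E j (i : nat) : j <= n0.+1 -> exists t, inD j t /\ U (fun n => nth 0 (D n j) (t n) = hE i n).
Proof.
move=> Hj; pose t n := index (hE i n) (D n j).
have Ht : U (fun n => hE i n \in D n j).
  apply: (ultraS uU) (U_free i.+1) => n Hn; apply: (D_sub Hj (leqnn _)).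
  by apply: mem_nth; apply: leq_trans (Hsz n).
have E : U (fun n => nth 0 (D n j) (t n) = hE i n).
  by apply: (ultraS uU) Ht => n Hn; rewrite nth_index.
exists t; split=> //; split; first by apply: (ultraS uU) Ht => n; rewrite index_mem.
exists i.+1; apply: (ultraS2 uU _ E (h_lt uU hE_grow (ltnSn i))) => n -> //.
Qed.

(** The element of [D n j] following one in the cut is below the next element of the
    cofinal sequence [hE]. *)
Lemma inD_S j t : j <= n0.+1 -> inD j t -> inD j (fun n => (t n).+1).
Proof.
move=> Hj [H1 [i Hi]]; have [s [[H2 H3] H4]] := inD_E i Hj.
have lt : U (fun n => (t n).+1 <= s n).
  apply: (ultraS2 uU _ (ultraI uU H1 Hi) (ultraI uU H2 H4)) => n [H5 H6] [H7 H8].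
  rewrite ltnNge; apply/negP => H; have := sorted_nth_le (D_sorted n Hj) H5 H.
  by lia.
have szS : U (fun n => (t n).+1 < size (D n j)).
  by apply: (ultraS2 uU _ lt H2) => n; lia.
split=> //; apply: (inI_le uU H3).
apply: (ultraS2 uU _ lt H2) => n H5 H6; exact: sorted_nth_le (D_sorted n Hj) H6 H5.
Qed.

Lemma inD_add j t m : j <= n0.+1 -> inD j t -> inD j (fun n => t n + m).
Proof.
move=> Hj; elim: m => [|m IH] Ht; first by under eq_fun do rewrite addn0.
by under eq_fun do rewrite addnS; apply: inD_S => //; apply: IH.
Qed.

Lemma inD_le j t x : j <= n0.+1 -> inI x -> U (fun n => t n < size (D n j)) ->
  U (fun n => nth 0 (D n j) (t n) <= x n) -> inD j t.
Proof. by move=> Hj Hx Ht H; split=> //; apply: inI_le Hx H. Qed.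

Lemma T_TI j j' t (q : S0) : j <= j' -> j' <= n0.+1 -> inD j' t ->
  U (fun n => ival q n < nth 0 (D n j') (t n)) ->
  U (fun n => T (th n) j (D n j') (t n) (ival q n)) <-> TI j q.
Proof.
elim: j j' t q => [//|j IH] j' t q Hj Hj' Ht Hq.
have Ht1 := inD_S Hj' Ht; have Ht2 := inD_S Hj' Ht1.
have prlt (u : nat -> nat) : U (fun n => u n < nth 0 (D n j') (t n).+1) ->
   U (fun n => pr (ival q n) (u n) < nth 0 (D n j') (t n).+2).
  move=> Hu; apply: (ultraS2 uU _ (ultraI uU Hq Hu) (ultraI uU Ht1.1 Ht2.1)) => n [H1 H2] [H3 H4].
  apply: leq_trans (D_grow Hj' H4); apply: pr_lt => //.
  by apply: leq_trans H1 _; apply: sorted_nth_le (D_sorted n Hj') H3 (leqnSn _).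
have back (u : S0) : U (fun n => ival u n < nth 0 (D n j') (t n).+1) ->
    U (fun n => ~ T (th n) j (D n j') (t n).+2 (pr (ival q n) (ival u n))) <-> ~ TI j (prI q u).
  by move=> Hu; rewrite (ultraN uU) -(IH j' _ (prI q u) (ltnW Hj) Hj' Ht2) //; apply: prlt.
split=> [H|[u0 Hu0]].
  have ch n : exists u, T (th n) j.+1 (D n j') (t n) (ival q n) ->
      u < nth 0 (D n j') (t n).+1 /\ ~ T (th n) j (D n j') (t n).+2 (pr (ival q n) u).
    case: (boolP (T (th n) j.+1 (D n j') (t n) (ival q n))) => [/hasP [u]|_]; last by exists 0.
    by rewrite mem_iota => Hu /negP HN; exists u.
  have [u Hu] := choice ch.
  have {}H : U (fun n => u n < nth 0 (D n j') (t n).+1 /\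
      ~ T (th n) j (D n j') (t n).+2 (pr (ival q n) (u n))).
    by apply: (ultraS uU) H => n /Hu.
  have H1 : U (fun n => u n < nth 0 (D n j') (t n).+1) by apply: (ultraS uU) H => n [].
  have Iu : inI u by apply: (inI_le uU Ht1.2); apply: (ultraS uU) H1 => n; apply: ltnW.
  by exists (mkI Iu); apply/back => //; apply: (ultraS uU) H => n [].
have Hj1 : j <= n0.+1 by lia.
(* The entry [hE i] exceeds [q] and the witness [u0], so its position in [D n j] will be a witness
   position. *)
have [i Hi] := inI2 uU hE_grow (ivalP q) (ivalP u0).
have [t' [Ht' Et']] := inD_E i Hj1.
have Ht'1 := inD_S Hj1 Ht'; have Ht'a := inD_add (2 * j) Hj1 Ht'.
have W : U (fun n => wit (th n) (D n j) j (ival q n) (t' n)).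
  have HT : U (fun n => ~ T (th n) j (D n j) (t' n).+1 (pr (ival q n) (ival u0 n))).
    have plt : U (fun n => ival (prI q u0) n < nth 0 (D n j) (t' n).+1).
      apply: (ultraS2 uU _ (ultraI uU Hi Et') Ht'1.1) => n [[H1 H2] H3] H4 /=.
      by apply: leq_trans (D_grow Hj1 H4); apply: pr_lt; rewrite H3.
    by rewrite (ultraN uU); move/(IH j _ _ (leqnn j) Hj1 Ht'1 plt).
  apply: (ultraS2 uU _ (ultraI uU Hi Et') (ultraI uU HT Ht'a.1)) => n [[H1 H2] H3] [H4 H5].
  rewrite /wit H5 H3 H1 /=; apply/hasP; exists (ival u0 n); first by rewrite mem_iota.
  exact/negP.
have ch n : exists tu : nat * nat, wit (th n) (D n j) j (ival q n) (t' n) ->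
    ival q n < nth 0 (D n j') (t n) -> (t n).+1 < size (D n j') -> t n < size (D n j') ->
    [/\ tu.1 < size (D n j), nth 0 (D n j) tu.1 <= nth 0 (D n j') (t n).+1,
        ival q n < nth 0 (D n j) tu.1, tu.2 < nth 0 (D n j) tu.1 &
        ~ T (th n) j (D n j) tu.1.+1 (pr (ival q n) tu.2)].
  case: (pselect [/\ wit (th n) (D n j) j (ival q n) (t' n),
    ival q n < nth 0 (D n j') (t n), (t n).+1 < size (D n j') & t n < size (D n j')]);
    last by move=> N; exists (0, 0) => *; case: N.
  move=> [Hw Hlt Hs1 Hs0].
  have Hj0 : j <= n0 by lia.
  have [D0 sD _ _] := D_facts n Hj1.
  have pB := HP n Hj0; have sB := sorted_B (th n) j D0 sD.
  have Hj1' : j.+1 <= n0.+1 by lia.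
  have sD1 := D_sorted n Hj1'; have sub := D_sub (nu := n) Hj Hj'.
  have X1 : nth 0 (D n j') (t n) \in D n j.+1 by apply: sub; apply: mem_nth.
  have Y1 : nth 0 (D n j') (t n).+1 \in D n j.+1 by apply: sub; apply: mem_nth.
  set r := index (nth 0 (D n j') (t n)) (D n j.+1).
  set r2 := index (nth 0 (D n j') (t n).+1) (D n j.+1).
  have Er : nth 0 (D n j.+1) r = nth 0 (D n j') (t n) by apply: nth_index.
  have Er2 : nth 0 (D n j.+1) r2 = nth 0 (D n j') (t n).+1 by apply: nth_index.
  have Sr2 : r2 < size (D n j.+1) by rewrite index_mem.
  have Sr : r < size (D n j.+1) by rewrite index_mem.
  have rr : r.+1 <= r2.
    rewrite ltnNge; apply/negP => H; have := sorted_nth_le sD1 Sr H; rewrite Er Er2.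
    by have := sorted_nth (D_sorted n Hj') Hs1 (ltnSn (t n)); lia.
  have Sr1 : r.+1 < size (D n j.+1) by apply: leq_ltn_trans Sr2.
  have SB : r.+1 < size (B (th n) j (D n j)) by apply: leq_trans Sr1 (size_prefix pB).
  have Hp : ival q n < nth 0 (B (th n) j (D n j)) r by rewrite -(prefix_nth pB) // Er.
  (* Scattering is used here: [q] is below entry [r] of the thinned sequence, so some witness
     position has its entry at most entry [r.+1]. *)
  have [t2 Hw2 Ht2'] := closed_B D0 sD SB Hp Hw.
  have /andP[S2 /andP[S3 /hasP [u]]] := Hw2; rewrite mem_iota => Hu /negP Hn.
  exists (t2, u) => _ _ _ _; split=> //=; first by lia.
  apply: leq_trans Ht2' _; rewrite -(prefix_nth pB) // -Er2.
  exact: sorted_nth_le.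
have [tu Htu] := choice ch.
have {}Htu : U (fun n => [/\ (tu n).1 < size (D n j), nth 0 (D n j) (tu n).1 <= nth 0 (D n j') (t n).+1,
        ival q n < nth 0 (D n j) (tu n).1, (tu n).2 < nth 0 (D n j) (tu n).1 &
        ~ T (th n) j (D n j) (tu n).1.+1 (pr (ival q n) (tu n).2)]).
  apply: (ultraS2 uU _ (ultraI uU W Hq) (ultraI uU Ht.1 Ht1.1)) => n [H1 H2] [H3 H4].
  exact: Htu.
have Hu1 : U (fun n => (tu n).2 < nth 0 (D n j') (t n).+1).
  by apply: (ultraS uU) Htu => n [_ H1 _ H2 _]; apply: leq_trans H2 H1.
have Iu : inI (fun n => (tu n).2) by apply: (inI_le uU Ht1.2); apply: (ultraS uU) Hu1 => n; apply: ltnW.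
have Ht2' : inD j (fun n => (tu n).1).
  apply: (inD_le Hj1 Ht1.2); first by apply: (ultraS uU) Htu => n [].
  by apply: (ultraS uU) Htu => n [].
have Ht2'1 := inD_S Hj1 Ht2'.
pose u : S0 := mkI Iu.
have Nu : ~ TI j (prI q u).
  have plt : U (fun n => ival (prI q u) n < nth 0 (D n j) (tu n).1.+1).
    apply: (ultraS2 uU _ Htu Ht2'1.1) => n [_ _ H1 H2 _] H4.
    by apply: leq_trans (D_grow Hj1 H4); apply: pr_lt.
  move/(IH j _ _ (leqnn j) Hj1 Ht2'1 plt); apply/(ultraN uU).
  by apply: (ultraS uU) Htu => n [].
have {}Nu := (back u Hu1).2 Nu.
apply: (ultraS2 uU _ Hu1 Nu) => n H1 H2 /=; apply/hasP; exists (ival u n).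
  by rewrite mem_iota.
exact/negP.
Qed.

Definition stk (b : S0) us := foldr (fun u q => prI q u) b us.

Lemma envq_stk b us n :
  envq (ival (stk b us) n) = ecat (map (fun u : S0 => ival u n) us) (envq (ival b n)).
Proof. by elim: us => //= u us IH; rewrite envq_pr IH. Qed.

(** The code [b] holds the index of the matrix and the parameters. When the matrix is reached,
    exactly [n0.+2] entries lie above [b]: [m] from the quantifiers and the others from [us]. This
    is why [matrix] finds the index at position [n0.+2]. *)
Lemma Tn_TI m P (e : nat -> S0) : Tn m P -> m <= n0.+2 ->
  exists b, forall us, size us = n0.+2 - m -> P (ecat us e) <-> TI m (stk b us).
Proof.
elim: m P => [|m IH] P; last first.
  move=> [Q HQ HP'] Hm; have [b Hb] := IH Q HQ (ltnW Hm); exists b => us Hus.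
  by rewrite HP' /=; split=> -[u Hu]; exists u; move: Hu; rewrite (Hb (u :: us)) //= Hus; lia.
move=> HQ _; have [A [tau [bA HA]]] := D0_formula false HQ.
(* Varying entries keep their places; parameters and entries of the fixed [e] are moved above them,
   to places named by the variable itself. *)
pose rho i := if tau i is inr j then if j < n0.+2 then j else n0.+2 + i else n0.+2 + i.
pose A' := fsubst (fun i => Var (rho i)) id A.
pose e2 i : S0 := match tau i with inl c => c | inr j => e (j - n0.+2) end.
have bA' : bounded A' by apply: bounded_subst.
have [v Hv] := ev_finite A'; have [m Hm] := fen_in A'.
have ch n : exists j, m <= n -> j < size (fen n) /\ nth Bot (fen n) j = A'.
  case: (leqP m n) => [/Hm H|_]; last by exists 0.
  by have [j H1 H2] := In_nth Bot H; exists j.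
have [j Hj] := choice ch.
(* The index of the formula is below [size (fen n) <= z0 n], and [z0 n] is the entry [hE 0 n]. *)
have Ij : inI j.
  exists 0; apply: (ultraS2 uU _ (U_free m) (U_free 1)) => n H1 H2.
  have [_ _ E _] := D_facts n (leqnn _); rewrite /hE E.
  by apply: leq_trans (Hz n); case: (Hj n H1).
(* A number holds finitely many parameters; the first [v] are those on which [A'] depends. *)
pose rest := stk (zer : S0) (mkseq e2 v).
exists (prI rest (mkI Ij)) => us; rewrite subn0 => Hus.
have -> : P (ecat us e) <-> ev (ecat us e2) (fun=> tt) A'.
  rewrite (HA _ (fun=> tt)) ev_fsubst; set w := (fun i => tev _ _).
  have -> // : w = lookup tau (ecat us e).
  apply: funext => i; rewrite /w /lookup /rho /=; case E : (tau i) => [c|k].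
    by rewrite (ecatE (zer : S0)) Hus ltnNge leq_addr /= addKn /e2 E.
  rewrite [RHS](ecatE (zer : S0)) Hus; case: ifP => H; first by rewrite (ecatE (zer : S0)) Hus H.
  by rewrite (ecatE (zer : S0)) Hus ltnNge leq_addr /= addKn /e2 E.
rewrite (los bA').
have Eq n : m <= n -> ev (enth (ecat us e2) n) (fun=> tt) A' <->
    th n (ival (stk (prI rest (mkI Ij)) us) n).
  move=> Hn; rewrite /th /matrix envq_stk.
  have Eb : envq (ival (prI rest (mkI Ij)) n) = econs (j n) (envq (ival rest n)) := envq_pr _ _.
  rewrite Eb; set b1 := map _ us; have Hb1 : size b1 = n0.+2 by rewrite size_map.
  have -> : ecat b1 (econs (j n) (envq (ival rest n))) n0.+2 = j n.
    by rewrite (ecatE 0) Hb1 ltnn subnn.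
  rewrite (Hj n Hn).2.
  rewrite (Hv NN (enth (ecat us e2) n) (fun i => if i < n0.+2 then ecat b1 (econs (j n) (envq (ival rest n))) i
       else ecat b1 (econs (j n) (envq (ival rest n))) i.+1) (fun=> tt)).
    by split=> [H|/asboolP]; [apply/asboolP|].
  move=> i Hi; rewrite /enth (ecatE (zer : S0)) Hus; case: ifP => H.
    by rewrite (ecatE 0) Hb1 H (nth_map (zer : S0)) ?Hus.
  have Hle : n0.+2 <= i by rewrite leqNgt H.
  rewrite (ecatE 0) Hb1 ltnNge (leqW Hle) /= subSn //= envq_stk.
  by rewrite (ecatE 0) size_map size_mkseq ifT ?(nth_map (zer : S0)) ?size_mkseq ?nth_mkseq //; lia.
by split=> H; apply: (ultraS2 uU _ (U_free m) H) => n /Eq; case.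
Qed.

(** The case [j = j' = n0.+1] of [T_TI], along the sequence [hE] itself, where positions are
    standard. *)
Lemma TI_bound i (q : S0) : U (fun n => ival q n < hE i n) ->
  (TI n0.+1 q <-> U (fun n => T (th n) n0.+1 (D n n0.+1) i (ival q n))) /\
  (TI n0.+1 q -> exists u, U (fun n => ival u n < hE i.+1 n) /\ ~ TI n0 (prI q u)).
Proof.
move=> Hq; have Ht : inD n0.+1 (fun=> i).
  split; first by apply: (ultraS uU) (U_free i.+1) => n Hn; apply: leq_trans (Hsz n).
  by exists i.+1; apply: (h_lt uU hE_grow (ltnSn i)).
have H := T_TI (leqnn _) (leqnn _) Ht Hq; split; first by rewrite -H.
have Ht1 := inD_S (leqnn _) Ht; have Ht2 := inD_S (leqnn _) Ht1.
rewrite -H => HT.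
have ch n : exists u, T (th n) n0.+1 (D n n0.+1) i (ival q n) ->
    u < hE i.+1 n /\ ~ T (th n) n0 (D n n0.+1) i.+2 (pr (ival q n) u).
  case: (boolP (T (th n) n0.+1 (D n n0.+1) i (ival q n))) => [/hasP [u]|_]; last by exists 0.
  by rewrite mem_iota => Hu /negP HN; exists u.
have [u Hu] := choice ch.
have H1 : U (fun n => u n < hE i.+1 n) by apply: (ultraS uU) HT => n /Hu [].
have Iu : inI u by exists i.+1.
exists (mkI Iu); split=> //.
have plt : U (fun n => ival (prI q (mkI Iu)) n < nth 0 (D n n0.+1) i.+2).
  apply: (ultraS2 uU _ (ultraI uU Hq H1) (ultraI uU (hE_grow i.+1) (h_lt uU hE_grow (ltnSn i)))).
  move=> n [H2 H3] [H4 H5]; apply: leq_trans H4; apply: pr_lt => //.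
  exact: ltn_trans H2 H5.
rewrite -(T_TI (leqnSn n0) (leqnn _) Ht2 plt); apply/(ultraN uU).
by apply: (ultraS uU) HT => n /Hu [].
Qed.

Lemma prI_bound (b x : S0) : exists i, forall y : S0, U (fun n => ival y n <= ival x n) ->
  U (fun n => ival (prI b y) n < hE i n).
Proof.
have [i Hi] := ivalP (prI b x); exists i => y Hy.
by apply: (ultraS2 uU _ Hi Hy) => n H1 H2; apply: leq_ltn_trans H1; apply: pr_mono.
Qed.

(** Up to [x] the relation is given by a decidable [F n] at almost every index. If induction fails,
    [F n] turns from true to false at some place; these places form an element of the cut at which
    the inductive step fails. *)
Lemma E_ind : @Ind U uU hE hE_grow n0.
Proof.
move=> P e HP0 P0 PS x; have [b Hb] := Tn_TI e HP0 (leqnSn _).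
have {}Hb y : P (econs y e) <-> TI n0.+1 (prI b y) by apply: (Hb [:: y]) => /=; lia.
have [i Hi] := prI_bound b x.
have HT y : U (fun n => ival y n <= ival x n) -> P (econs y e) <->
    U (fun n => T (th n) n0.+1 (D n n0.+1) i (pr (ival b n) (ival y n))).
  by move=> /Hi Hy; rewrite Hb (TI_bound Hy).1.
apply: contrapT; rewrite HT; last exact: (ultraT uU).
rewrite -(ultraN uU) => HN.
have H0 : U (fun n => T (th n) n0.+1 (D n n0.+1) i (pr (ival b n) 0)).
  by rewrite (HT (zer : S0)) in P0; last exact: (ultraT uU).
pose F n y := T (th n) n0.+1 (D n n0.+1) i (pr (ival b n) y).
have ch n : exists y, F n 0 -> ~ F n (ival x n) -> [/\ y < ival x n, F n y & ~ F n y.+1].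
  elim: (ival x n) => [|y [z IH]]; first by exists 0.
  case: (boolP (F n y)) => Hy; first by exists y.
  exists z => F0 _; have [||H1 H2 H3] := IH; [by []|exact/negP|].
  by split=> //; apply: ltnW.
have [y Hy] := choice ch.
have {}Hy : U (fun n => [/\ y n < ival x n, F n (y n) & ~ F n (y n).+1]).
  by apply: (ultraS2 uU _ H0 HN) => n; apply: Hy.
have Iy : inI y by apply: (inI_le uU (ivalP x)); apply: (ultraS uU) Hy => n [/ltnW].
have Py : P (econs (mkI Iy : S0) e).
  by apply/HT; apply: (ultraS uU) Hy => n [/ltnW].
have := PS _ Py; rewrite HT; last by apply: (ultraS uU) Hy => n [] /=; rewrite addn1.
apply/(ultraN uU); apply: (ultraS uU) Hy => n [_ _] /=; by rewrite addn1.
Qed.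

(** The codes for all [x < s] lie below one [hE i], so [TI_bound] puts all witnesses below
    [hE i.+1]. *)
Lemma E_coll : @Coll U uU hE hE_grow n0.
Proof.
move=> Q e s HQ H; have [b Hb] := Tn_TI e HQ (leq_trans (leqnSn _) (leqnSn _)).
have {}Hb u y : Q (econs u (econs y e)) <-> TI n0 (prI (prI b y) u).
  by apply: (Hb [:: u; y]) => /=; lia.
have [i Hi] := prI_bound b s.
have Iw : inI (hE i.+1) by exists i.+2; apply: (h_lt uU hE_grow (ltnSn _)).
exists (mkI Iw) => x Hx.
have /Hi Hq : U (fun n => ival x n <= ival s n) by apply: (ultraS uU) Hx => n; apply: ltnW.
have [|u [H1 H2]] := (TI_bound Hq).2.
  by have [u Hu] := H x Hx; exists u; rewrite -Hb.
by exists u => //; rewrite Hb.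
Qed.

End ScatteredCut.

(** * The contradiction with minimality *)

Lemma Good_chain th z0 R j E : Good th z0 R j E -> exists Ds : nat -> seq nat,
  [/\ Ds j = E, forall i, i <= j -> Good th z0 R i (Ds i) &
      forall i, i < j -> prefix (Ds i.+1) (B th i (Ds i))].
Proof.
elim: j E => [|j IH] E.
  by move=> HE; exists (fun=> E); split=> // i; rewrite leqn0 => /eqP ->.
move=> HE; have [E0 [D' /IH [Ds [H1 H2 H3]] HD]] := HE.
exists (fun i => if i == j.+1 then E else Ds i); split; first by rewrite eqxx.
  by move=> i Hi; case: eqP => [-> //|/eqP Hne]; apply: H2; rewrite -ltnS ltn_neqAle Hne.
move=> i Hi; rewrite eqSS; case: eqP => [->|/eqP Hne].
  by rewrite ltn_eqF // H1.
by rewrite ltn_eqF // H3 // ltn_neqAle Hne.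
Qed.

(** The premise mentions cuts only, so that one argument serves both theories. It is applied to the
    standard cut and to the scattered one. *)
Theorem no_cut_wph n0 n :
  (forall U (uU : ultra U) h (h_grow : forall i, U (fun n => grow (h i n) <= h i.+1 n)),
     @Ind U uU h h_grow n0 -> @Coll U uU h h_grow n0 ->
     wph (S := SI uU h_grow) n0.+2 (rootlog n n0)) -> False.
Proof.
move=> W; have [U [uU U_free]] := ultra_exists.
set N := maxn n 1; have N0 : 0 < N by rewrite /N; lia.
have exR c a : exists R, comb n0 N c a R.
  have W' := W U uU std (std_grow uU) (@std_ind U uU n0) (@std_coll U uU n0).
  have [R HR] := wph_comb W' (scst uU c) (scst uU a).
  by have [i _ Hi] := ultra_ex uU HR (U_free 0); exists (ival R i).
(* The constants are for [col_success], [size (fen nu)] puts indices of formulas into the cut, and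
   [nu] does so for the number of colors. *)
pose z0 nu := cst 3 n0 + n0 + 8 + size (fen nu) + nu.
pose c nu := ncol nu n0 N; pose a nu := start (z0 nu) n0 N.
have ch nu : exists R, comb n0 N (c nu) (a nu) R /\ forall R', comb n0 N (c nu) (a nu) R' -> R <= R'.
  have ex : exists R, `[< comb n0 N (c nu) (a nu) R >].
    by have [R HR] := exR (c nu) (a nu); exists R; apply/asboolP.
  case: (ex_minnP ex) => R /asboolP HR Hmin; exists R; split=> // R' HR'.
  by apply: Hmin; apply/asboolP.
have [R HR] := choice ch.
have ch2 nu : exists Ds : nat -> seq nat, [/\ nu <= size (Ds n0.+1),
    forall i, i <= n0.+1 -> Good (matrix n0 nu) (z0 nu) (R nu) i (Ds i) &
    forall i, i <= n0 -> prefix (Ds i.+1) (B (matrix n0 nu) i (Ds i))].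
  (* The size demanded for success is [nu], so the sequences obtained grow without bound. *)
  have [h [L [H1 H2 H3 H4]]] := (HR nu).1 (col (matrix n0 nu) (z0 nu) nu (R nu) n0 N)
    (@col_local _ _ _ _ _ _) (@col_lt _ _ _ _ _ _ N0).
  have zlow : cst 3 n0 + n0 + 8 <= z0 nu by rewrite /z0; lia.
  have [E HE Hsz] := col_success N0 zlow H1 H2 H3 H4.
  by have [Ds [E1 E2 E3]] := Good_chain HE; exists Ds; split=> //; rewrite E1.
have [D HD] := choice ch2.
have HG nu j : j <= n0.+1 -> Good (matrix n0 nu) (z0 nu) (R nu) j (D nu j) by case: (HD nu) => _ H _ /H.
have HP nu j : j <= n0 -> prefix (D nu j.+1) (B (matrix n0 nu) j (D nu j)) by case: (HD nu) => _ _ H /H.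
have Hsz nu : nu <= size (D nu n0.+1) by case: (HD nu).
have Hz nu : size (fen nu) <= z0 nu by rewrite /z0; lia.
have W' := W U uU _ (hE_grow uU U_free HG Hsz) (E_ind HP Hz) (E_coll HP Hz).
have G := hE_grow uU U_free HG Hsz.
have Iz : inI U (hE n0 D) z0.
  exists 1; apply: (ultraS2 uU _ (U_free 1) (h_lt uU G (ltnSn 0))) => nu H1 H2.
  by have [_ _ <- _] := D_facts HG nu (leqnn _).
have Ia : inI U (hE n0 D) a.
  have tw j : inI U (hE n0 D) (fun nu => tow j (z0 nu ^ (2 * N))); last exact: tw.
  elim: j => [|i IH] /=; first exact: (inI_pow uU G Iz (inI_cst uU G (2 * N))).
  exact: (inI_pow uU G (inI_cst uU G 2) IH).
have Ic : inI U (hE n0 D) c.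
  apply: (inI_mul uU G (inI_cst uU G 4)); apply: (inI_mul uU G (inI_cst uU G (3 ^ n0))).
  apply: (@inI_le _ uU _ _ (fun nu => z0 nu + (4 * N).+1)).
    exact: (inI_add uU G Iz (inI_cst uU G (4 * N).+1)).
  by apply: (ultraT uU) => nu; rewrite /z0; lia.
have [R' HR'] := wph_comb W' (mkI Ic) (mkI Ia).
have [i Hi] := ivalP R'.
have [nu] := ultra_ex uU (ultraI uU HR' Hi) (U_free i.+1).
(* By minimality [R nu] is at most the bound found in the cut, hence below an entry of the sequence,
   while all entries are at most [R nu]. *)
move=> Hnu [/= /((HR nu).2) H1 H2].
have [_ _ _ H3] := D_facts HG nu (leqnn _).
have /H3 [_ H4] : hE n0 D i nu \in D nu n0.+1.
  by apply: mem_nth; apply: leq_trans (Hsz nu).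
lia.
Qed.

Theorem EFA_unprovable n0 n :
  ~ proves (theory_union EFA (@ISigma false n0.+1)) (WPH n0.+2 (@RootLogIter false n n0)).
Proof.
move=> H; apply: (@no_cut_wph n0 n) => U uU h G ind coll.
have := SI_EFA ind coll H (fun=> zer) (fun=> exist _ _ (delta1_0 uU G)).
by rewrite (ev_WPH (g := rootlog n n0)) // => *; apply: ev_RootLogIter.
Qed.

Theorem RCA_unprovable n0 n :
  ~ proves (theory_union RCA0star (@ISigma true n0.+1)) (WPH n0.+2 (@RootLogIter true n n0)).
Proof.
move=> H; apply: (@no_cut_wph n0 n) => U uU h G ind coll.
have := SI_RCA ind coll H (fun=> zer) (fun=> exist _ _ (delta1_0 uU G)).
by rewrite (ev_WPH (g := rootlog n n0)) // => *; apply: ev_RootLogIter.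
Qed.

(** * Completeness *)

Local Notation fm := (formula false).
Local Notation fsub s := (@fsubst false s id).

Lemma tsubst_id t : tsubst Var t = t.
Proof. by elim: t => //= t -> u ->. Qed.

Lemma tsubst_scons_lift u s t : tsubst (scons u s) (tlift 1 t) = tsubst s t.
Proof. by rewrite /tlift tsubst_comp. Qed.

Lemma up_comp s s' : (fun i => tsubst (up s) (up s' i)) = up (fun i => tsubst s (s' i)).
Proof. by apply: funext => -[|i] //=; rewrite tsubst_up_lift. Qed.

Lemma up_Var : up Var = Var.
Proof. by apply: funext => -[|i]. Qed.

Lemma fsubst_comp s s' (A : fm) : fsub s (fsub s' A) = fsub (fun i => tsubst s (s' i)) A.
Proof.
elim: A s s' => //= [t u|t u|A IHA B IHB|A IH] s s'.
- by rewrite !tsubst_comp.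
- by rewrite !tsubst_comp.
- by rewrite IHA IHB.
- by rewrite IH up_comp.
Qed.

Lemma fsubst_id (A : fm) : fsub Var A = A.
Proof.
elim: A => //= [t u|t u|A IHA B IHB|A IH]; rewrite ?tsubst_id //.
- by rewrite IHA IHB.
- by rewrite up_Var IH.
Qed.

Lemma fsubst_inst_up s (A : fm) t : inst (fsub (up s) A) t = fsub (scons t s) A.
Proof.
rewrite /inst fsubst_comp; congr (fsubst _ _ A).
by apply: funext => -[|i] //=; rewrite tsubst_scons_lift tsubst_id.
Qed.

Lemma fsubst_inst s (A : fm) t : fsub s (inst A t) = inst (fsub (up s) A) (tsubst s t).
Proof.
rewrite fsubst_inst_up /inst fsubst_comp; congr (fsubst _ _ A).
by apply: funext => -[|i].
Qed.

Lemma fsubst_flift s (A : fm) : fsub (up s) (flift A) = flift (fsub s A).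
Proof.
by rewrite /flift !fsubst_comp; congr (fsubst _ _ A).
Qed.

Lemma fsubst_finite (A : fm) : exists v, forall s s', (forall i, i < v -> s i = s' i) ->
  fsub s A = fsub s' A.
Proof.
have tv t : exists v, forall s s', (forall i, i < v -> s i = s' i) -> tsubst s t = tsubst s' t.
  elim: t => [i| | |t [v1 H1] u [v2 H2]|t [v1 H1] u [v2 H2]|t [v1 H1] u [v2 H2]];
    [by exists i.+1 => s s' H; apply: H|by exists 0|by exists 0|..];
    by exists (v1 + v2) => s s' H /=; rewrite (H1 s s') ?(H2 s s') // => i Hi; apply: H; lia.
elim: A => [|t u|t u|//|A [v1 H1] B [v2 H2]|A [v H]|//].
- by exists 0.
- have [v1 H1] := tv t; have [v2 H2] := tv u; exists (v1 + v2) => s s' H /=.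
  by rewrite (H1 s s') ?(H2 s s') // => i Hi; apply: H; lia.
- have [v1 H1] := tv t; have [v2 H2] := tv u; exists (v1 + v2) => s s' H /=.
  by rewrite (H1 s s') ?(H2 s s') // => i Hi; apply: H; lia.
- exists (v1 + v2) => s s' H /=.
  by rewrite (H1 s s') ?(H2 s s') // => i Hi; apply: H; lia.
- exists v => s s' Hs /=; congr All; apply: H => -[|i] //= Hi.
  by rewrite Hs //; lia.
Qed.

Section Derivations.
Variable T : fm -> Prop.

Lemma weakening G A : derives T G A -> forall G', (forall B, List.In B G -> List.In B G') ->
  derives T G' A.
Proof.
elim=> {G A}.
- by move=> G A HA G' _; apply: Ax.
- by move=> G A HA G' H; apply: Hyp; apply: H.
- by move=> G A B _ IH G' H; apply: Imp_I; apply: IH => C /= [|/H]; auto.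
- by move=> G A B _ IH1 _ IH2 G' H; apply: Imp_E (IH1 _ H) (IH2 _ H).
- by move=> G A _ IH G' H; apply: Raa; apply: IH => C /= [|/H]; auto.
- move=> G A _ IH G' H; apply: All_I; apply: IH => C /List.in_map_iff [D [<- /H HD]].
  exact: List.in_map.
- by move=> G A t _ IH G' H; apply: All_E; apply: IH.
- by [].
- by [].
- by move=> G t G' _; apply: Eq_I.
- by move=> G A t u _ IH1 _ IH2 G' H; apply: Eq_E (IH1 _ H) (IH2 _ H).
Qed.

Lemma derives_AllN_subst n s s' G (A : fm) : (forall i, s' (n + i) = s i) ->
  derives T G (fsub s (AllN n A)) -> derives T G (fsub s' A).
Proof.
elim: n s => [|n IH] s Hs; first by have -> : s' = s by apply: funext.
move=> /= /(All_E (s' n)); rewrite fsubst_inst_up; apply: IH => -[|i].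
  by rewrite addn0.
by rewrite addnS -addSn Hs.
Qed.

(** The set [T] need not be closed under substitution; instead [A] is generalized in the variables
    that matter and then instantiated. *)
Lemma derives_Ax_subst s G A : T A -> derives T G (fsub s A).
Proof.
move=> HA; apply: (@weakening [::]) => //.
have [v Hv] := fsubst_finite A.
have D n : derives T [::] (AllN n A).
  by elim: n => [|n IH]; [apply: Ax|apply: All_I].
(* Beyond [v] the substitution is replaced by the shift that instantiating [v] quantifiers
   produces. *)
rewrite (Hv s (fun i => if i < v then s i else Var (i - v))); last by move=> i ->.
apply: (@derives_AllN_subst v Var); last by rewrite fsubst_id; apply: D.
by move=> i; rewrite ltnNge leq_addr addKn.
Qed.

Lemma derives_subst G A : derives T G A -> forall s, derives T (map (fsub s) G) (fsub s A).
Proof.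
elim=> {G A}.
- by move=> G A HA s; apply: derives_Ax_subst.
- by move=> G A HA s; apply: Hyp; apply: List.in_map.
- by move=> G A B _ IH s; apply: Imp_I; apply: IH.
- by move=> G A B _ IH1 _ IH2 s; apply: Imp_E (IH1 s) (IH2 s).
- by move=> G A _ IH s; apply: Raa; apply: IH.
- move=> G A _ IH s; apply: All_I; have := IH (up s); rewrite -!map_comp.
  rewrite (_ : map _ G = map (@flift false \o fsub s) G) //.
  by apply: eq_map => B /=; apply: fsubst_flift.
- by move=> G A t _ IH s; rewrite fsubst_inst; apply: All_E; apply: IH.
- by [].
- by [].
- by move=> G t s; apply: Eq_I.
- move=> G A t u _ IH1 _ IH2 s; rewrite fsubst_inst.
  by apply: Eq_E (IH1 s) _; rewrite -fsubst_inst.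
Qed.

Definition consistent G := ~ derives T G Bot.

Lemma seq_finite (G : seq fm) : exists v, forall A, List.In A G ->
  forall s s', (forall i, i < v -> s i = s' i) -> fsub s A = fsub s' A.
Proof.
elim: G => [|A G [v1 H1]]; first by exists 0.
have [v2 H2] := fsubst_finite A; exists (v1 + v2) => B /= [<-|/H1 H] s s' Hs.
  by apply: H2 => i Hi; apply: Hs; lia.
by apply: H => i Hi; apply: Hs; lia.
Qed.

(** A variable [v] beyond those of the context serves as the new constant. Renaming [v] to the
    variable to be generalized, and lifting the others, turns a refutation into a premise of
    [All_I]. *)
Lemma henkin G B : consistent G -> List.In (Not (All B)) G ->
  exists x, consistent (Not (inst B (Var x)) :: G).
Proof.
move=> cG HB; have [v Hv] := seq_finite (Not (All B) :: G).
exists v => D; apply: cG.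
pose s i := if i == v then Var 0 else Var i.+1.
have sv i : i < v -> s i = Var i.+1 by rewrite /s; case: eqP => // ->; rewrite ltnn.
have {D} := derives_subst D s; rewrite /= -/(fsub s).
have -> : map (fsub s) G = map (@flift false) G.
  by apply: List.map_ext_in => A HA; apply: (Hv A) sv; right.
have -> : fsub s (inst B (Var v)) = B.
  have [E] := Hv _ (or_introl erefl) s (fun i => Var i.+1) sv.
  rewrite fsubst_inst E fsubst_inst_up /= /s eqxx -[RHS]fsubst_id.
  by congr (fsubst _ _ B); apply: funext => -[|i].
move=> D; apply: Imp_E (Hyp _ HB) _; apply: All_I; exact: Raa.
Qed.

Variable F : fm.
Hypothesis F_unprovable : ~ proves T F.

Definition fdec q := nth Bot (fen (unpr1 q)) (unpr2 q).

Lemma fdecP A : exists q, fdec q = A.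
Proof.
have [m Hm] := fen_in A; have [j Hj HA] := In_nth Bot (Hm m (leqnn m)).
exists (pr m j); rewrite /fdec /unpr1 pr_log.
have -> // : unpr2 (pr m j) = j.
by have := congr1 (fun e => e 0) (envq_pr m j).
Qed.

Lemma consistent_or G A : consistent G -> consistent (A :: G) \/ consistent (Not A :: G).
Proof.
move=> cG; apply: contrapT => /not_orP [/contrapT H1 /contrapT H2].
by apply: cG; apply: Imp_E (Imp_I H1) (Raa H2).
Qed.

Lemma extend G A : consistent G -> exists G', [/\ consistent G',
  (forall B, List.In B G -> List.In B G'), List.In A G' \/ List.In (Not A) G' &
  forall B, A = Not (All B) -> List.In A G' -> exists x, List.In (Not (inst B (Var x))) G'].
Proof.
move=> cG; case: (pselect (consistent (A :: G))) => cA; last first.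
  have [//|cN] := consistent_or A cG; exists (Not A :: G); split=> //=; [by auto|by auto|].
  move=> B E [E'|HA]; first by move: E'; rewrite E.
  by case: cA => D; apply: cG; apply: (weakening D) => C /= [<-|].
case: (pselect (exists B, A = Not (All B))) => [[B E]|N].
  have [|x cx] := henkin (B := B) cA; first by left.
  exists (Not (inst B (Var x)) :: A :: G); split=> //=; [by auto|by auto|].
  by move=> C; rewrite E => -[->] _; exists x; left.
exists (A :: G); split=> //=; [by auto|by auto|].
by move=> B E; case: N; exists B.
Qed.

(** The stages remain finite lists, so a fresh variable is always available. *)
Lemma saturated : exists Gs : nat -> seq fm, [/\ forall n, consistent (Gs n),
  List.In (Not F) (Gs 0), forall n B, List.In B (Gs n) -> List.In B (Gs n.+1) &
  forall n, [/\ List.In (fdec n) (Gs n.+1) \/ List.In (Not (fdec n)) (Gs n.+1) &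
   forall B, fdec n = Not (All B) -> List.In (fdec n) (Gs n.+1) ->
     exists x, List.In (Not (inst B (Var x))) (Gs n.+1)]].
Proof.
pose CG := {G : seq fm | consistent G}.
have ch (p : nat * CG) : exists G' : CG,
  [/\ (forall B, List.In B (sval p.2) -> List.In B (sval G')),
      List.In (fdec p.1) (sval G') \/ List.In (Not (fdec p.1)) (sval G') &
  forall B, fdec p.1 = Not (All B) -> List.In (fdec p.1) (sval G') ->
    exists x, List.In (Not (inst B (Var x))) (sval G')].
  have [G' [H1 H2 H3 H4]] := extend (fdec p.1) (svalP p.2).
  by exists (exist _ G' H1).
have [f Hf] := choice ch.
have c0 : consistent [:: Not F] by move=> /Raa.
pose Gs := fix Gs n : CG := if n is n'.+1 then f (n', Gs n') else exist _ _ c0.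
exists (fun n => sval (Gs n)); split.
- by move=> n; apply: svalP.
- by left.
- by move=> n B HB; have [H _ _] := Hf (n, Gs n); apply: H.
- by move=> n; have [_ H1 H2] := Hf (n, Gs n).
Qed.

Section Term.
Variable Gs : nat -> seq fm.
Hypothesis Gc : forall n, consistent (Gs n).
Hypothesis Gm : forall n B, List.In B (Gs n) -> List.In B (Gs n.+1).
Hypothesis Gd : forall n, List.In (fdec n) (Gs n.+1) \/ List.In (Not (fdec n)) (Gs n.+1).
Hypothesis Gh : forall n B, fdec n = Not (All B) -> List.In (fdec n) (Gs n.+1) ->
     exists x, List.In (Not (inst B (Var x))) (Gs n.+1).

Definition Th A := exists n, derives T (Gs n) A.

Lemma Gs_le n m B : n <= m -> List.In B (Gs n) -> List.In B (Gs m).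
Proof. by elim: m => [|m IH]; [rewrite leqn0 => /eqP ->|rewrite leq_eqVlt => /orP [/eqP ->|/IH H] // /H /Gm]. Qed.

Lemma Th_le n m A : n <= m -> derives T (Gs n) A -> derives T (Gs m) A.
Proof. by move=> nm D; apply: weakening D _ _ => B; apply: Gs_le. Qed.

Lemma Th1 A B : (forall n, derives T (Gs n) A -> derives T (Gs n) B) -> Th A -> Th B.
Proof. by move=> H [n D]; exists n; apply: H. Qed.

Lemma Th2 A B C : (forall n, derives T (Gs n) A -> derives T (Gs n) B -> derives T (Gs n) C) ->
  Th A -> Th B -> Th C.
Proof.
move=> H [n D] [m D']; exists (maxn n m).
by apply: H; [apply: Th_le D|apply: Th_le D']; rewrite ?leq_maxl ?leq_maxr.
Qed.

Lemma Th_Bot : ~ Th Bot.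
Proof. by move=> [n]; apply: Gc. Qed.

Lemma Th_dec A : Th A \/ Th (Not A).
Proof.
have [q <-] := fdecP A; case: (Gd q) => H; [left|right]; exists q.+1; exact: Hyp.
Qed.

Lemma Th_Not A : Th (Not A) <-> ~ Th A.
Proof.
split=> [H1 H2|]; last by case: (Th_dec A).
by apply: Th_Bot; apply: Th2 H1 H2 => n; apply: Imp_E.
Qed.

Lemma Th_Imp A B : Th (Imp A B) <-> (Th A -> Th B).
Proof.
split=> [H1 H2|H]; first by apply: Th2 H1 H2 => n; apply: Imp_E.
case: (Th_dec A) => [/H HB|HN].
  by apply: Th1 HB => n D; apply: Imp_I; apply: weakening D _ _ => C; right.
apply: Th1 HN => n D; apply: Imp_I; apply: Raa.
apply: Imp_E (_ : derives T _ (Not A)) _; last by apply: Hyp; right; left.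
by apply: weakening D _ _ => C; right; right.
Qed.

Lemma Th_All A : Th (All A) <-> forall t, Th (inst A t).
Proof.
split=> [H t|H]; first by apply: Th1 H => n; apply: All_E.
case: (Th_dec (All A)) => // HN; exfalso.
have [q Eq] := fdecP (Not (All A)).
have HA : List.In (fdec q) (Gs q.+1).
  case: (Gd q) => // H'; exfalso; apply: Th_Bot; apply: Th2 HN (_ : Th (Not (Not (All A)))).
    by move=> n H1 H2; apply: Imp_E H2 H1.
  by exists q.+1; apply: Hyp; rewrite -Eq.
have [x Hx] := Gh Eq HA.
have /Th_Not : Th (Not (inst A (Var x))) by exists q.+1; apply: Hyp.
by apply.
Qed.

(** * The term model *)

Definition teq t u := Th (Eq t u).

Lemma inst_lift t u : tsubst (scons u Var) (tlift 1 t) = t.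
Proof. by rewrite tsubst_scons_lift tsubst_id. Qed.

Lemma teq_E A t u : teq t u -> Th (inst A t) -> Th (inst A u).
Proof. by apply: Th2 => n; apply: Eq_E. Qed.

Lemma teq_refl t : teq t t.
Proof. by exists 0; apply: Eq_I. Qed.

Lemma teq_sym t u : teq t u -> teq u t.
Proof.
move=> H; have := @teq_E (Eq (Var 0) (tlift 1 t)) t u H.
by rewrite /inst /= !inst_lift; apply; apply: teq_refl.
Qed.

Lemma teq_trans t u v : teq t u -> teq u v -> teq t v.
Proof.
move=> H1 H2; have := @teq_E (Eq (tlift 1 t) (Var 0)) u v H2.
by rewrite /inst /= !inst_lift; apply.
Qed.

Lemma teq_bin (o : term -> term -> term) :
  (forall s t u, tsubst s (o t u) = o (tsubst s t) (tsubst s u)) ->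
  forall t t' u u', teq t t' -> teq u u' -> teq (o t u) (o t' u').
Proof.
move=> Ho t t' u u' H1 H2.
have E1 := @teq_E (Eq (tlift 1 (o t u)) (o (Var 0) (tlift 1 u))) t t' H1.
have E2 := @teq_E (Eq (tlift 1 (o t u)) (o (tlift 1 t') (Var 0))) u u' H2.
move: E1 E2; rewrite /inst /= !Ho !inst_lift /= => E1 E2.
by apply: E2; apply: E1; apply: teq_refl.
Qed.

Lemma teq_Lt t t' u u' : teq t t' -> teq u u' -> Th (Lt t u) -> Th (Lt t' u').
Proof.
move=> H1 H2.
have E1 := @teq_E (Lt (Var 0) (tlift 1 u)) t t' H1.
have E2 := @teq_E (Lt (tlift 1 t') (Var 0)) u u' H2.
by move: E1 E2; rewrite /inst /= !inst_lift /= => E1 E2 /E1.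
Qed.

(** Classes are represented by predicates so that equality in the term model is
    Leibniz equality. *)
Definition tcls t : term -> Prop := teq t.
Definition tcar := {S : term -> Prop | exists t, S = tcls t}.
Definition cls t : tcar := exist _ (tcls t) (ex_intro _ t erefl).

Lemma cls_eq t u : cls t = cls u <-> teq t u.
Proof.
split=> [[E]|H].
  by have : tcls u u := teq_refl u; rewrite -E.
have E : tcls t = tcls u.
  apply: funext => v; apply: propext; split; last exact: teq_trans H.
  exact: teq_trans (teq_sym H).
by apply: eq_exist.
Qed.

Lemma cls_surj (x : tcar) : exists t, x = cls t.
Proof. by case: x => S [t E]; exists t; apply: eq_exist. Qed.

Definition trep (x : tcar) : term := sval (cid (cls_surj x)).

Lemma trepK x : cls (trep x) = x.
Proof. by rewrite /trep; case: cid => t /= ->. Qed.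

Lemma trep_cls t : teq (trep (cls t)) t.
Proof. by apply/cls_eq; rewrite trepK. Qed.

Definition TM : struc := @Struc tcar eq (cls Zero) (cls One)
  (fun x y => cls (Add (trep x) (trep y))) (fun x y => cls (Mul (trep x) (trep y)))
  (fun x y => cls (Exp (trep x) (trep y))) (fun x y => Th (Lt (trep x) (trep y)))
  unit (fun _ _ => False).

Lemma tev_TM (s : nat -> term) t : tev (S := TM) (fun i => cls (s i)) t = cls (tsubst s t).
Proof.
elim: t => //= t -> u ->; apply/cls_eq.
- by apply: (@teq_bin Add) => //; apply: trep_cls.
- by apply: (@teq_bin Mul) => //; apply: trep_cls.
- by apply: (@teq_bin Exp) => //; apply: trep_cls.
Qed.

Lemma ev_TM (A : fm) s : ev (S := TM) (fun i => cls (s i)) (fun=> tt) A <-> Th (fsub s A).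
Proof.
elim: A s => [|t u|t u|//|A IHA B IHB|A IH|//] s.
- by split=> // /Th_Bot.
- by rewrite /= !tev_TM; apply: cls_eq.
- rewrite /= !tev_TM; split; apply: teq_Lt; try exact: trep_cls; exact: teq_sym (trep_cls _).
- by rewrite ev_Imp IHA IHB -Th_Imp.
- rewrite ev_All /= Th_All.
  have Ec t : econs (cls t) (fun i => cls (s i)) = fun i => cls (scons t s i).
    by apply: funext => -[|i].
  split=> H t; first by rewrite fsubst_inst_up -IH -Ec; apply: H.
  by have [u ->] := cls_surj t; rewrite Ec IH -fsubst_inst_up.
Qed.

Lemma TM_T A : T A -> forall e : nat -> TM, ev e (fun=> tt) A.
Proof.
move=> HA e; have -> : e = (fun i => cls (trep (e i))).
  by apply: funext => i; rewrite trepK.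
by rewrite ev_TM; exists 0; apply: derives_Ax_subst.
Qed.

End Term.

Lemma countermodel : exists S : struc, [/\ forall x y : S, eqv x y <-> x = y,
  sets S = unit, forall A, T A -> forall (e : nat -> S) E, ev e E A &
  exists e E, ~ ev (S := S) e E F].
Proof.
have [Gs [Gc G0 Gm Gd]] := saturated.
have Gd1 n : List.In (fdec n) (Gs n.+1) \/ List.In (Not (fdec n)) (Gs n.+1) by case: (Gd n).
have Gd2 n : forall B, fdec n = Not (All B) -> List.In (fdec n) (Gs n.+1) ->
     exists x, List.In (Not (inst B (Var x))) (Gs n.+1) by case: (Gd n).
exists (TM Gs); split=> //.
  move=> A HA e E; have -> : E = (fun=> tt) by apply: funext => i; case: (E i).
  exact: TM_T.
exists (fun i => cls Gs (Var i)), (fun=> tt).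
rewrite (ev_TM Gc Gm Gd1 Gd2) fsubst_id -(Th_Not Gc Gm Gd1).
by exists 0; apply: Hyp.
Qed.

End Derivations.

Theorem completeness (T : fm -> Prop) (F : fm) :
  (forall S : struc, (forall x y : S, eqv x y <-> x = y) -> sets S = unit ->
     (forall A, T A -> forall (e : nat -> S) E, ev e E A) ->
     forall (e : nat -> S) E, ev e E F) -> proves T F.
Proof.
move=> H; apply: contrapT => HN.
by have [S [H1 H2 H3 [e [E He]]]] := countermodel HN; apply: He; apply: H.
Qed.

(** * First order derivations in second order arithmetic *)

(** The set constructors have no instance in the first order language, so [Bot] is a dummy value for
    them. *)
Fixpoint emb (A : formula false) : formula true :=
  match A with
  | Bot => Bot
  | Eq t u => Eq t u
  | Lt t u => Lt t u
  | Elem _ _ _ => Bot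
  | Imp A B => Imp (emb A) (emb B)
  | All A => All (emb A)
  | AllS _ _ => Bot
  end.

Lemma emb_fsubst s r r' A : emb (fsubst s r A) = fsubst s r' (emb A).
Proof. by elim: A s => //= [A IHA B IHB|A IH] s; rewrite ?IHA ?IHB ?IH. Qed.

Lemma emb_inst A t : emb (inst A t) = inst (emb A) t.
Proof. exact: emb_fsubst. Qed.

Lemma emb_flift A : emb (flift A) = flift (emb A).
Proof. exact: emb_fsubst. Qed.

Lemma emb_bounded A : bounded A -> bounded (emb A).
Proof.
elim=> {A} [|t u|t u|//|A B _ IHA _ IHB|t A _ IH|t A _ IH].
- exact: bounded_Bot.
- exact: bounded_Eq.
- exact: bounded_Lt.
- exact: bounded_Imp.
- exact: bounded_All.
- exact: bounded_Ex.
Qed.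

Lemma emb_induction A : emb (induction_axiom A) = induction_axiom (emb A).
Proof.
rewrite /induction_axiom -emb_inst.
by rewrite -(emb_fsubst (scons (#0 + 1)%tm (fun i => Var i.+1)) id id).
Qed.

Lemma emb_EFA A : EFA A -> RCA0star (emb A).
Proof.
move=> H; left; case: H => [[H|H]|[B HB ->]].
- by left; left; case: H; constructor.
- by left; right; case: H; constructor.
right; exists (emb B); last exact: emb_induction.
by inversion HB; subst; apply: Sigma_0; apply: emb_bounded.
Qed.

Lemma emb_derives G A : derives EFA G A -> derives RCA0star (map emb G) (emb A).
Proof.
elim=> {G A}.
- by move=> G A /emb_EFA; apply: Ax.
- by move=> G A HA; apply: Hyp; apply: List.in_map.
- by move=> G A B _ IH; apply: Imp_I.
- by move=> G A B _ IH1 _ IH2; apply: Imp_E IH1 IH2.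
- by move=> G A _ IH; apply: Raa.
- move=> G A _ IH; apply: All_I; move: IH; rewrite -!map_comp.
  by rewrite (_ : map _ G = map (@flift true \o emb) G) //; apply: eq_map => B /=; rewrite emb_flift.
- by move=> G A t _ IH; rewrite emb_inst; apply: All_E.
- by [].
- by [].
- by move=> G t; apply: Eq_I.
- by move=> G A t u _ IH1 _ IH2; rewrite emb_inst; apply: Eq_E IH1 _; rewrite -emb_inst.
Qed.

Lemma emb_AllN k A : emb (AllN k A) = AllN k (emb A).
Proof. by elim: k => //= k ->. Qed.

Lemma emb_Simplex a xs R : emb (Simplex false a xs R) = Simplex true a xs R.
Proof.
case: xs => // x xs /=; suff -> : emb (increasing_to false x xs R) = increasing_to true x xs R by [].
by elim: xs x => //= y ys IH x; rewrite IH.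
Qed.

Lemma emb_Conj As : emb (Conj As) = Conj (map emb As).
Proof. by elim: As => //= A As ->. Qed.

Lemma emb_WeaklyHomogeneous d C s k :
  emb (WeaklyHomogeneous false d C s k) = WeaklyHomogeneous true d C s k.
Proof.
rewrite /WeaklyHomogeneous emb_AllN.
pose As so := [seq App so s⇑(d.+2) [:: #(d.+1) + Defs.Num j]%tm #j | j <- iota 0 d.+1].
have E : emb (Conj (As false)) = Conj (As true).
  by rewrite emb_Conj -map_comp; congr Conj; apply: eq_map.
by rewrite -/(As true) -E.
Qed.

Lemma emb_Coloring d C c a R : emb (Coloring false d C c a R) = Coloring true d C c a R.
Proof. by rewrite /Coloring emb_AllN; congr (AllN _ (Imp _ _)); apply: emb_Simplex. Qed.

Lemma emb_WPH d (f : graph false) (g : graph true) :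
  (forall t u, emb (f t u) = g t u) -> emb (WPH d f) = WPH d g.
Proof.
move=> fg; have EL H k : emb (Large f H k) = Large g H k.
  by rewrite /Large -fg.
rewrite /WPH -EL -emb_WeaklyHomogeneous -emb_Coloring.
reflexivity.
Qed.

Lemma emb_LogIter k t u : emb (LogIter false k t u) = LogIter true k t u.
Proof. by elim: k t u => //= k IH t u; rewrite IH. Qed.

Theorem EFA_RCA0star d k : proves EFA (WPH d (@LogIter false k)) ->
  proves RCA0star (WPH d (@LogIter true k)).
Proof.
by move=> /emb_derives; rewrite (emb_WPH _ (@emb_LogIter k)).
Qed.

(** * Elementary arithmetic in a model *)

Declare Scope m_scope.

Definition EFAmodel (S : struc) := [/\ forall x y : S, eqv x y <-> x = y,
  sets S = unit & forall A, EFA A -> forall (e : nat -> S) E, ev e E A].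

Section Arith.
Variable S : struc.
Hypothesis modS : EFAmodel S.
Implicit Types (x y z t u s n q r : S) (e : nat -> S).

Local Open Scope m_scope.
Local Notation "0" := (@zer S) : m_scope.
Local Notation "1" := (@uno S) : m_scope.
Local Notation "x + y" := (@add S x y) : m_scope.
Local Notation "x * y" := (@mul S x y) : m_scope.
Local Notation "x < y" := (@ltr S x y) : m_scope.
Local Notation p2 := (@pow S (two S)).

Lemma eqS x y : eqv x y <-> x = y. Proof. by case: modS. Qed.

Let E0 : nat -> sets S.
Proof. by case: modS => _ H _ _; move: tt; rewrite -H. Qed.

Lemma basicS A : @basic_axiom false A -> forall e, ev e E0 A.
Proof. by case: modS => _ _ H HA e; apply: H; left; left. Qed.

Definition en (x y : S) := econs x (econs y (fun=> zer)).

Lemma succ_neq0 x : x + 1 <> 0.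
Proof. by have := basicS (@ax_succ_neq0 _) (en x x); rewrite ev_Not /= eqS. Qed.
Lemma succ_inj x y : x + 1 = y + 1 -> x = y.
Proof. by have := basicS (@ax_succ_inj _) (en x y); rewrite ev_Imp /= !eqS. Qed.
Lemma addx0 x : x + 0 = x.
Proof. by have := basicS (@ax_add0 _) (en x x); rewrite /= eqS. Qed.
Lemma addxS x y : x + (y + 1) = (x + y) + 1.
Proof. by have := basicS (@ax_addS _) (en x y); rewrite /= eqS. Qed.
Lemma mulx0 x : x * 0 = 0.
Proof. by have := basicS (@ax_mul0 _) (en x x); rewrite /= eqS. Qed.
Lemma mulxS x y : x * (y + 1) = x * y + x.
Proof. by have := basicS (@ax_mulS _) (en x y); rewrite /= eqS. Qed.
Lemma ltx0 x : ~ (x < 0).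
Proof. by have := basicS (@ax_lt0 _) (en x x). Qed.
Lemma ltxS x y : x < y + 1 <-> x < y \/ x = y.
Proof. by have := basicS (@ax_ltS _) (en x y); rewrite ev_Iff ev_Or /= eqS. Qed.
Lemma powx0 x : pow x 0 = 1.
Proof.
case: modS => _ _ H; have := H _ (or_introl (or_intror (@ax_exp0 _))) (en x x) E0.
by rewrite /= eqS.
Qed.
Lemma powxS x y : pow x (y + 1) = x * pow x y.
Proof.
case: modS => _ _ H; have := H _ (or_introl (or_intror (@ax_expS _))) (en x y) E0.
by rewrite /= eqS.
Qed.

Definition le x y := x < y \/ x = y.
Local Notation "x <= y" := (le x y) : m_scope.

Lemma leeE x y : lee x y <-> x <= y. Proof. by rewrite /lee eqS. Qed.

Lemma D0_eqS f g : Tm f -> Tm g -> D0 (fun e => f e = g e).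
Proof. by move=> Hf Hg; apply: D0_ext (D0_eq Hf Hg) => e; apply: eqS. Qed.

Lemma D0_le f g : Tm f -> Tm g -> D0 (fun e => f e <= g e).
Proof. by move=> Hf Hg; apply: D0_or; [apply: D0_lt|apply: D0_eqS]. Qed.

Lemma D0_ball f (P : S -> (nat -> S) -> Prop) : Tm f -> D0 (fun e => P (e 0%N) (etail e)) ->
  D0 (fun e => forall x, x < f e -> P x e).
Proof. exact: D0_all. Qed.

Lemma D0_bex f (P : S -> (nat -> S) -> Prop) : Tm f -> D0 (fun e => P (e 0%N) (etail e)) ->
  D0 (fun e => exists2 x, x < f e & P x e).
Proof. exact: D0_ex. Qed.

Lemma D0_true (P : Prop) : D0 (fun _ : nat -> S => P).
Proof.
case: (pselect P) => H; last by apply: (D0_ext (P := fun=> False)) (D0_bot S) => e; split.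
by apply: (D0_ext (P := fun=> ~ False)) (D0_not (D0_bot S)) => e; split=> // _ [].
Qed.

Lemma D0_app2 (P : S -> S -> Prop) f g : D0 (fun e => P (e 0%N) (e 1%N)) -> Tm f -> Tm g ->
  D0 (fun e => P (f e) (g e)).
Proof.
move=> HP Hf Hg; apply: (D0_subst (s := fun e => econs (f e) (econs (g e) e)) HP) => -[|[|i]] //=.
exact: Tm_var.
Qed.

(** The only source of induction in the model. Statements proved with it carry explicit bounds on
    their quantifiers for this reason. *)
Lemma ind (P : S -> Prop) : D0 (fun e => P (e 0%N)) -> P 0 ->
  (forall x, P x -> P (x + 1)) -> forall x, P x.
Proof.
move=> HP P0 PS x; have [A [e' [bA HA]]] := D0_formula1 false (fun=> zer) HP.
case: modS => _ _ H; have := H _ (or_intror (ex_intro2 _ _ A (Sigma_0 bA) erefl)) e' E0.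
rewrite /induction_axiom ev_Imp ev_And ev_inst !ev_All => K.
apply/(HA x E0); apply: K; split; first by apply/(HA 0 E0).
move=> y; rewrite ev_Imp -(HA y E0) ev_fsubst => /PS.
move/(HA (y + 1) E0).
by rewrite (_ : (fun i => tev _ _) = econs (y + 1) e') //; apply: funext => -[|i].
Qed.

End Arith.

Ltac tm := solve [repeat first
  [ exact: Tm_var | exact: Tm_cst | assumption
  | apply: Tm_add | apply: Tm_mul | apply: Tm_pow ] ].
Ltac d0 := repeat first
  [ assumption | exact: D0_true
  | (apply: D0_eqS; [eassumption|tm|tm]) | (apply: D0_lt; [tm|tm]) | (apply: D0_le; [eassumption|tm|tm])
  | (apply: D0_ball; [tm|]) | (apply: D0_bex; [tm|])
  | apply: D0_not | apply: D0_and | apply: D0_or | apply: D0_iff | apply: D0_imp ].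

Section Arith2.
Variable S : struc.
Hypothesis modS : EFAmodel S.
Implicit Types (x y z t u s n q r : S) (e : nat -> S).
Local Open Scope m_scope.
Local Notation "0" := (@zer S) : m_scope.
Local Notation "1" := (@uno S) : m_scope.
Local Notation "x + y" := (@add S x y) : m_scope.
Local Notation "x * y" := (@mul S x y) : m_scope.
Local Notation "x < y" := (@ltr S x y) : m_scope.
Local Notation "x <= y" := (@le S x y) : m_scope.
Local Notation p2 := (@pow S (two S)).
Let ind := @ind S modS.
Let addx0 := @addx0 S modS. Let addxS := @addxS S modS.
Let mulx0 := @mulx0 S modS. Let mulxS := @mulxS S modS.

Lemma add0x x : 0 + x = x.
Proof.
apply: (ind (P := fun x => 0 + x = x)) => [||y IH]; first by d0.
  exact: addx0.
by rewrite addxS IH.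
Qed.

Lemma addSx x y : (x + 1) + y = (x + y) + 1.
Proof.
apply: (ind (P := fun y => (x + 1) + y = (x + y) + 1)) => [||z IH]; first by d0.
  by rewrite !addx0.
by rewrite !addxS IH.
Qed.

Lemma addxC x y : x + y = y + x.
Proof.
apply: (ind (P := fun y => x + y = y + x)) => [||z IH]; first by d0.
  by rewrite addx0 add0x.
by rewrite addxS addSx IH.
Qed.

Lemma addxA x y z : x + (y + z) = (x + y) + z.
Proof.
apply: (ind (P := fun z => x + (y + z) = (x + y) + z)) => [||u IH]; first by d0.
  by rewrite !addx0.
by rewrite !addxS IH.
Qed.

Lemma mul0x x : 0 * x = 0.
Proof.
apply: (ind (P := fun x => 0 * x = 0)) => [||y IH]; first by d0.
  exact: mulx0.
by rewrite mulxS IH addx0.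
Qed.

Lemma mulSx x y : (x + 1) * y = x * y + y.
Proof.
apply: (ind (P := fun y => (x + 1) * y = x * y + y)) => [||z IH]; first by d0.
  by rewrite !mulx0 addx0.
by rewrite !mulxS IH -!addxA; congr (_ + _); rewrite !addxS; congr (_ + _); rewrite addxC.
Qed.

Lemma mulxC x y : x * y = y * x.
Proof.
apply: (ind (P := fun y => x * y = y * x)) => [||z IH]; first by d0.
  by rewrite mulx0 mul0x.
by rewrite mulxS mulSx IH.
Qed.

Lemma mulxDl x y z : (x + y) * z = x * z + y * z.
Proof.
apply: (ind (P := fun z => (x + y) * z = x * z + y * z)) => [||u IH]; first by d0.
  by rewrite !mulx0 addx0.
rewrite !mulxS IH -!addxA; congr (_ + _); rewrite !addxA; congr (_ + _).
exact: addxC.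
Qed.

Lemma mulxA x y z : x * (y * z) = (x * y) * z.
Proof.
apply: (ind (P := fun z => x * (y * z) = (x * y) * z)) => [||u IH]; first by d0.
  by rewrite !mulx0.
by rewrite !mulxS -IH mulxC mulxDl mulxC [y * x]mulxC.
Qed.

Lemma mul1x x : 1 * x = x.
Proof. by rewrite -{1}(add0x 1) mulSx mul0x add0x. Qed.

Lemma S_semiring : semi_ring_theory 0 1 (@add S) (@mul S) eq.
Proof.
split.
- exact: add0x.
- exact: addxC.
- exact: addxA.
- exact: mul1x.
- exact: mul0x.
- exact: mulxC.
- exact: mulxA.
- exact: mulxDl.
Qed.

Add Ring S_ring : S_semiring.

End Arith2.

Section Arith3.
Variable S : struc.
Hypothesis modS : EFAmodel S.
Implicit Types (x y z t u s n q r d : S) (e : nat -> S).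
Local Open Scope m_scope.
Local Notation "0" := (@zer S) : m_scope.
Local Notation "1" := (@uno S) : m_scope.
Local Notation "x + y" := (@add S x y) : m_scope.
Local Notation "x * y" := (@mul S x y) : m_scope.
Local Notation "x < y" := (@ltr S x y) : m_scope.
Local Notation "x <= y" := (@le S x y) : m_scope.
Local Notation "2" := (two S) : m_scope.
Local Notation p2 := (@pow S (two S)).
Let ind := @ind S modS.
Let addx0 := @addx0 S modS. Let addxS := @addxS S modS.
Let mulx0 := @mulx0 S modS. Let mulxS := @mulxS S modS.
Let addxC := @addxC S modS. Let addxA := @addxA S modS.
Add Ring S_ring3 : (S_semiring modS).

Lemma ltxS' x : x < x + 1.
Proof. by apply/(ltxS modS); right. Qed.

Lemma lt0S x : 0 < x + 1.
Proof.
apply: (ind (P := fun x => 0 < x + 1)) => [||y IH]; first by d0.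
  exact: ltxS'.
by apply/(ltxS modS); left.
Qed.

Lemma succ_lt x y : x < y -> x + 1 < y + 1.
Proof.
apply: (ind (P := fun y => x < y -> x + 1 < y + 1)) => [||z IH]; first by d0.
  by move/(ltx0 modS).
move/(ltxS modS) => [/IH H|->]; first by apply/(ltxS modS); left.
exact: ltxS'.
Qed.

Lemma zeroVsucc x : x = 0 \/ exists w, x = w + 1.
Proof.
have : x = 0 \/ exists2 w, w < x & x = w + 1.
  apply: (ind (P := fun x => x = 0 \/ exists2 w, w < x & x = w + 1)) => [||y IH]; first by d0.
    by left.
  by right; exists y => //; apply: ltxS'.
by case=> [|[w _]]; [left|right; exists w].
Qed.

Lemma lt_add x z : x < x + z + 1.
Proof.
apply: (ind (P := fun z => x < x + z + 1)) => [||y IH]; first by d0.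
  by rewrite addx0; apply: ltxS'.
by rewrite addxS; apply/(ltxS modS); left.
Qed.

Lemma lt_ex x y : x < y <-> exists z, y = x + z + 1.
Proof.
split=> [|[z ->]]; last exact: lt_add.
suff : x < y -> exists2 z, z < y & y = x + z + 1 by move=> H /H [z _]; exists z.
apply: (ind (P := fun y => x < y -> exists2 z, z < y & y = x + z + 1)) => [||z IH]; first by d0.
  by move/(ltx0 modS).
move/(ltxS modS) => [/IH [w Hw E]|<-]; last by exists 0; [apply: lt0S|rewrite addx0].
by exists (w + 1); [apply: succ_lt|rewrite {1}E; ring].
Qed.

Lemma le_ex x y : x <= y <-> exists z, y = x + z.
Proof.
split=> [[/lt_ex [z ->]|<-]|[z ->]]; first by exists (z + 1); ring.
  by exists 0; rewrite addx0.
case: (zeroVsucc z) => [->|[w ->]]; first by right; rewrite addx0.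
by left; apply/lt_ex; exists w; ring.
Qed.

Lemma add_inj z x y : x + z = y + z -> x = y.
Proof.
apply: (ind (P := fun z => x + z = y + z -> x = y)) => [||w IH]; first by d0.
  by rewrite !addx0.
by rewrite !addxS => /(succ_inj modS).
Qed.

Lemma add_injl z x y : z + x = z + y -> x = y.
Proof. by rewrite ![z + _]addxC; apply: add_inj. Qed.

Lemma ltxx x : ~ (x < x).
Proof.
move/lt_ex => [z E]; apply: (@succ_neq0 S modS z); apply: (@add_injl x).
by rewrite addx0 [RHS]E; ring.
Qed.

Lemma le_refl x : x <= x. Proof. by right. Qed.
Lemma ltW x y : x < y -> x <= y. Proof. by left. Qed.

Lemma le_trans y x z : x <= y -> y <= z -> x <= z.
Proof. by move=> /le_ex [a ->] /le_ex [b ->]; apply/le_ex; exists (a + b); ring. Qed.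

Lemma lt_le_trans y x z : x < y -> y <= z -> x < z.
Proof. by move=> /lt_ex [a ->] /le_ex [b ->]; apply/lt_ex; exists (a + b); ring. Qed.

Lemma le_lt_trans y x z : x <= y -> y < z -> x < z.
Proof. by move=> /le_ex [a ->] /lt_ex [b ->]; apply/lt_ex; exists (a + b); ring. Qed.

Lemma lt_trans y x z : x < y -> y < z -> x < z.
Proof. by move=> H /ltW; apply: lt_le_trans. Qed.

Lemma lt_S x y : x < y <-> x + 1 <= y.
Proof.
by split=> [/lt_ex [z ->]|/le_ex [z ->]]; [apply/le_ex|apply/lt_ex]; exists z; ring.
Qed.

Lemma le_S x y : x <= y <-> x < y + 1.
Proof. by rewrite (ltxS modS). Qed.

Lemma ltVle x y : x < y \/ y <= x.
Proof.
apply: (ind (P := fun x => x < y \/ y <= x)) => [||z [|H]]; first by d0.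
- by case: (zeroVsucc y) => [->|[w ->]]; [right; right|left; apply: lt0S].
- by move/lt_S => [H|H]; [left|right; right].
by right; apply: le_trans H _; left; apply: ltxS'.
Qed.

Lemma le_gtF x y : x <= y -> ~ (y < x).
Proof. by move=> H H'; apply: (@ltxx x); apply: le_lt_trans H H'. Qed.

Lemma lt_neq x y : x < y -> x <> y.
Proof. by move=> H E; apply: (@ltxx y); rewrite -{1}E. Qed.

Lemma le0 x : 0 <= x.
Proof. by apply/le_ex; exists x; rewrite (add0x modS). Qed.

Lemma gt0_ex x : 0 < x <-> exists w, x = w + 1.
Proof.
split=> [/lt_ex [z ->]|[w ->]]; last exact: lt0S.
by exists z; rewrite (add0x modS).
Qed.

Lemma le_add x y x' y' : x <= x' -> y <= y' -> x + y <= x' + y'.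
Proof. by move=> /le_ex [a ->] /le_ex [b ->]; apply/le_ex; exists (a + b); ring. Qed.

Lemma le_lt_add x y x' y' : x <= x' -> y < y' -> x + y < x' + y'.
Proof. by move=> /le_ex [a ->] /lt_ex [b ->]; apply/lt_ex; exists (a + b); ring. Qed.

Lemma le_mul x y x' y' : x <= x' -> y <= y' -> x * y <= x' * y'.
Proof.
by move=> /le_ex [a ->] /le_ex [b ->]; apply/le_ex; exists (x * b + a * y + a * b); ring.
Qed.

Lemma le_addr x y : x <= x + y. Proof. by apply/le_ex; exists y. Qed.
Lemma le_addl x y : x <= y + x. Proof. by apply/le_ex; exists y; ring. Qed.

Lemma greatest (P : S -> Prop) b : D0 (fun e => P (e 0%N)) -> (exists2 x, x < b & P x) ->
  exists2 m, m < b & P m /\ forall y, y < b -> m < y -> ~ P y.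
Proof.
move=> HP; apply: (ind (P := fun b => (exists2 x, x < b & P x) ->
   exists2 m, m < b & P m /\ forall y, y < b -> m < y -> ~ P y)) => [||z IH].
- apply: D0_imp; first by apply: D0_bex; [tm|].
  apply: D0_bex; first by tm.
  apply: D0_and => //; apply: D0_ball; first by tm.
  apply: D0_imp; first by d0.
  by apply: D0_not.
- by move=> [x /(ltx0 modS)].
move=> [x Hx Px]; case: (pselect (P z)) => Pz.
  exists z; first exact: ltxS'.
  split=> // y /le_S Hy Hzy; by case: (le_gtF Hy Hzy).
have [m Hm [Pm Hmax]] : exists2 m, m < z & P m /\ forall y, y < z -> m < y -> ~ P y.
  by apply: IH; exists x => //; move/(ltxS modS): Hx => [//|E]; case: Pz; rewrite -E.
exists m; first by apply: lt_trans Hm (ltxS' _).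
by split=> // y /(ltxS modS) [Hy|->//]; apply: Hmax.
Qed.

Lemma divE s d : 0 < d -> exists2 q, q <= s & exists2 r, r < d & s = q * d + r.
Proof.
move=> d0'; suff : exists2 q, q < s + 1 & exists2 r, r < d & s = q * d + r.
  by move=> [q /le_S Hq Hr]; exists q.
apply: (ind (P := fun s => exists2 q, q < s + 1 & exists2 r, r < d & s = q * d + r)) => [||z].
- by d0.
- by exists 0; [apply: lt0S|exists 0 => //; ring].
move=> [q Hq [r /lt_S [Hr|Er] E]].
  exists q; first by apply: lt_trans Hq (ltxS' _).
  by exists (r + 1) => //; rewrite {1}E; ring.
exists (q + 1); first exact: succ_lt.
by exists 0 => //; rewrite E -Er; ring.
Qed.

Lemma div_uniq d q r q' r' : r < d -> r' < d -> q * d + r = q' * d + r' -> q = q' /\ r = r'.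
Proof.
have half a b c c' : c < d -> a * d + c = b * d + c' -> ~ (a < b).
  move=> Hc E /lt_ex [z Ez]; apply: (le_gtF _ Hc); apply/le_ex; exists (z * d + c').
  by apply: (@add_injl (a * d)); rewrite E Ez; ring.
move=> H H' E; have Eq : q = q'.
  by case: (ltVle q q') => [/(half _ _ _ _ H E)//|[/(half _ _ _ _ H' (esym E))//|]].
by split=> //; move: E; rewrite Eq; apply: add_injl.
Qed.

Lemma p2_0 : p2 0 = 1. Proof. exact: (powx0 modS). Qed.
Lemma p2_S x : p2 (x + 1) = 2 * p2 x. Proof. exact: (powxS modS). Qed.

Lemma p2_add x y : p2 (x + y) = p2 x * p2 y.
Proof.
apply: (ind (P := fun y => p2 (x + y) = p2 x * p2 y)) => [||z IH]; first by d0.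
  by rewrite addx0 p2_0; ring.
by rewrite addxS !p2_S IH; ring.
Qed.

Lemma p2_gt x : x < p2 x.
Proof.
apply: (ind (P := fun x => x < p2 x)) => [||z /lt_ex [w E]]; first by d0.
  by rewrite p2_0 -(add0x modS 1); apply: ltxS'.
by rewrite p2_S E; apply/lt_ex; exists (z + w + w); rewrite /two; ring.
Qed.

Lemma p2_gt0 x : 0 < p2 x.
Proof. exact: le_lt_trans (le0 x) (p2_gt x). Qed.

Lemma p2_le x y : x <= y -> p2 x <= p2 y.
Proof.
move=> /le_ex [z ->]; rewrite p2_add; have /gt0_ex [w ->] := p2_gt0 z.
by apply/le_ex; exists (p2 x * w); ring.
Qed.

Lemma p2_lt x y : x < y -> p2 x < p2 y.
Proof.
move=> /lt_S /p2_le; rewrite p2_S; apply: lt_le_trans.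
by have /gt0_ex [w ->] := p2_gt0 x; apply/lt_ex; exists w; rewrite /two; ring.
Qed.

Lemma p2_lt_inv x y : p2 x < p2 y -> x < y.
Proof. by case: (ltVle x y) => // /p2_le H /(le_gtF H). Qed.

(** ** Bits *)

Lemma two_gt1 : 1 < 2. Proof. exact: ltxS'. Qed.

Lemma parity x : exists q, x = 2 * q \/ x = 2 * q + 1.
Proof.
have [q _ [r Hr ->]] := divE x (lt0S 1); exists q.
move/(ltxS modS): Hr => [|->]; last by right; rewrite /two; ring.
by rewrite -(add0x modS 1) => /(ltxS modS) [/(ltx0 modS)//|->]; left; rewrite /two; ring.
Qed.

Lemma parity_neq q q' : 2 * q <> 2 * q' + 1.
Proof.
move=> E; have [|||_] := @div_uniq 2 q 0 q' 1.
- by apply/gt0_ex; exists 1.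
- exact: two_gt1.
- by rewrite addx0 !(mulxC modS _ 2).
by move=> E'; apply: (@succ_neq0 S modS 0); rewrite (add0x modS).
Qed.

Definition even t s := exists q r, r < p2 t /\ s = 2 * q * p2 t + r.

Lemma insetE t s : inset t s <-> exists q r, r < p2 t /\ s = (2 * q + 1) * p2 t + r.
Proof. by split=> -[q [r [H1 H2]]]; exists q, r; split=> //; apply/(eqS modS). Qed.

Lemma insetVeven t s : inset t s \/ even t s.
Proof.
have [Q _ [r Hr E]] := divE s (p2_gt0 t).
have [q [Eq|Eq]] := parity Q; [right|left; apply/insetE]; exists q, r; by rewrite E Eq.
Qed.

Lemma evenNinset t s : even t s -> ~ inset t s.
Proof.
move=> [q [r [Hr E]]] /insetE [q' [r' [Hr']]]; rewrite E => E'.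
by have [] := div_uniq Hr Hr' E' => /parity_neq.
Qed.

Lemma inset_le t s : inset t s -> p2 t <= s.
Proof.
move=> /insetE [q [r [_ ->]]]; apply/le_ex; exists (2 * q * p2 t + r); ring.
Qed.

Lemma inset_lt t s : inset t s -> t < s.
Proof. by move/inset_le; apply: lt_le_trans (p2_gt t). Qed.

Lemma inset_ltb t s n : s < p2 n -> inset t s -> t < n.
Proof. by move=> H /inset_le H'; apply: p2_lt_inv; apply: le_lt_trans H. Qed.

Lemma D0_inset f g : Tm f -> Tm g -> D0 (fun e => inset (f e) (g e)).
Proof.
move=> Hf Hg; apply: (D0_app2 (P := fun t s => inset t s)) Hf Hg.
apply: (D0_ext (P := fun e => exists2 q, q < e 1%N + 1 & exists2 r, r < p2 (e 0%N) &
   e 1%N = (2 * q + 1) * p2 (e 0%N) + r)); last first.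
  by apply: D0_bex; [tm|apply: D0_bex; [tm|d0]].
move=> e; split=> [[q _ [r Hr E]]|/insetE [q [r [Hr E]]]].
  by apply/insetE; exists q, r.
exists q; last by exists r.
apply/le_S; apply/le_ex; have /gt0_ex [w Ew] := p2_gt0 (e 0%N).
by exists (q + 2 * q * w + p2 (e 0%N) + r); rewrite E Ew /two; ring.
Qed.

(** For [t < n] the number [p2 n] is an even multiple of [p2 t], so adding it does not change the
    parity that decides bit [t]. *)
Lemma inset_add t n s : t < n -> inset t (s + p2 n) <-> inset t s.
Proof.
move=> /lt_ex [z ->]; have Ep : p2 (t + z + 1) = 2 * p2 z * p2 t by rewrite p2_S p2_add; ring.
have A s' : inset t s' -> inset t (s' + p2 (t + z + 1)).
  move=> /insetE [q [r [Hr ->]]]; apply/insetE; exists (q + p2 z), r; split=> //.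
  by rewrite Ep; ring.
split=> [H|]; last exact: A.
case: (insetVeven t s) => // -[q [r [Hr E]]]; exfalso; apply: evenNinset H.
by exists (q + p2 z), r; split=> //; rewrite E Ep; ring.
Qed.

Lemma inset_top n s : s < p2 n -> inset n (s + p2 n).
Proof. by move=> H; apply/insetE; exists 0, s; split=> //; ring. Qed.

Lemma comprehension (P : S -> Prop) n : D0 (fun e => P (e 0%N)) ->
  exists2 s, s < p2 n & forall t, inset t s <-> t < n /\ P t.
Proof.
move=> HP; suff : exists2 s, s < p2 n & forall t, t < n -> (inset t s <-> P t).
  move=> [s Hs H]; exists s => // t; split=> [Ht|[Ht]]; last by rewrite H.
  by have Htn := inset_ltb Hs Ht; rewrite -H.
apply: (ind (P := fun n => exists2 s, s < p2 n & forall t, t < n -> (inset t s <-> P t))).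
- apply: D0_bex; first by tm.
  apply: D0_ball; first by tm.
  by apply: D0_iff; [apply: D0_inset; tm|].
- by exists 0; [apply: p2_gt0|move=> t /(ltx0 modS)].
move=> m [s Hs H]; case: (pselect (P m)) => Pm.
  exists (s + p2 m).
    by have := le_lt_add (le_refl (p2 m)) Hs; rewrite p2_S (addxC s) /two; congr (_ < _); ring.
  move=> t /(ltxS modS) [Ht|->]; first by rewrite inset_add ?H.
  by split=> // _; apply: inset_top.
exists s; first by apply: lt_trans Hs _; apply: p2_lt; apply: ltxS'.
move=> t /(ltxS modS) [Ht|->]; first exact: H.
by split=> // /(inset_ltb Hs) /ltxx.
Qed.

Lemma ext n s s' : s < p2 n -> s' < p2 n ->
  (forall t, t < n -> (inset t s <-> inset t s')) -> s = s'.
Proof.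
suff : forall s, s < p2 n -> forall s', s' < p2 n ->
    (forall t, t < n -> (inset t s <-> inset t s')) -> s = s' by move=> H ? ?; apply: H.
apply: (ind (P := fun n => forall s, s < p2 n -> forall s', s' < p2 n ->
    (forall t, t < n -> (inset t s <-> inset t s')) -> s = s')).
- apply: D0_ball; first by tm.
  apply: D0_ball; first by tm.
  apply: D0_imp; last by d0.
  apply: D0_ball; first by tm.
  by apply: D0_iff; apply: D0_inset; tm.
- have z x : x < p2 0 -> x = 0.
    by rewrite p2_0 -(add0x modS 1) => /(ltxS modS) [/(ltx0 modS)|].
  by move=> x /z -> y /z ->.
move=> m IH.
have split' x : x < p2 (m + 1) -> exists2 x0, x0 < p2 m &
    (x = x0 /\ ~ inset m x) \/ (x = x0 + p2 m /\ inset m x).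
  move=> Hx; case: (ltVle x (p2 m)) => H.
    by exists x => //; left; split=> // /(inset_ltb H) /ltxx.
  have /le_ex [x0 E] := H.
  have Hx0 : x0 < p2 m.
    case: (ltVle x0 (p2 m)) => // H'; case: (le_gtF _ Hx).
    by rewrite p2_S E; apply: le_trans (le_add (le_refl (p2 m)) H'); right; rewrite /two; ring.
  exists x0 => //; right; split; first by rewrite E addxC.
  by rewrite E addxC; apply: inset_top.
move=> x /split' [x0 Hx0 Ex] y /split' [y0 Hy0 Ey] H.
have Hm := H m (ltxS' m).
have lo : forall t, t < m -> (inset t x0 <-> inset t y0).
  move=> t Ht; have := H t (lt_trans Ht (ltxS' m)).
  have Ex' : inset t x <-> inset t x0 by case: Ex => -[-> _] //; apply: inset_add.
  have Ey' : inset t y <-> inset t y0 by case: Ey => -[-> _] //; apply: inset_add.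
  by rewrite Ex' Ey'.
have E0 := IH x0 Hx0 y0 Hy0 lo.
case: Ex Ey => -[Ex Nx] [[Ey Ny]|[Ey Ny]].
- by rewrite Ex Ey.
- by case: Nx; apply/Hm.
- by case: Ny; apply/Hm.
- by rewrite Ex Ey E0.
Qed.

(** * Pairs and the pigeonhole principle *)

Lemma pairs_inj t u t' u' : pairs t u = pairs t' u' -> t = t' /\ u = u'.
Proof.
have half x y t1 t2 : t1 <= x -> x * x + t1 = y * y + t2 -> ~ (x < y).
  move=> /le_ex [w Ew] E /lt_ex [z Ez]; subst x y.
  apply: (@succ_neq0 S modS (w + (t1 + w) + 2 * (t1 + w) * z + z * z + 2 * z + t2)).
  apply: (@add_injl ((t1 + w) * (t1 + w) + t1)); rewrite addx0 [RHS]E /two; ring.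
rewrite /pairs => E.
have T1 : t <= t + u by apply: le_addr.
have T2 : t' <= t' + u' by apply: le_addr.
have Es : t + u = t' + u'.
  by case: (ltVle (t + u) (t' + u')) => [/(half _ _ _ _ T1 E)//|[/(half _ _ _ _ T2 (esym E))//|]].
have Et : t = t' by move: E; rewrite Es; apply: add_injl.
by split=> //; move: Es; rewrite Et; apply: add_injl.
Qed.

Lemma pairs_le t u t' u' : t <= t' -> u <= u' -> pairs t u <= pairs t' u'.
Proof. by move=> H1 H2; rewrite /pairs; apply: le_add => //; apply: le_mul; apply: le_add. Qed.

Lemma D0_pairs f g h : Tm f -> Tm g -> Tm h -> D0 (fun e => inset (pairs (f e) (g e)) (h e)).
Proof. by move=> Hf Hg Hh; apply: D0_inset => //; rewrite /pairs; tm. Qed.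

(** The induction treats all codes of maps below a fixed bound at once, which keeps it bounded. From
    an injection of [m + 2] points into [m + 1] values, sending the preimage of the last value to
    the value of the last point gives one of [m + 1] points into [m]. *)
Lemma php (G : S -> S -> Prop) n : D0 (fun e => G (e 0%N) (e 1%N)) ->
  (forall i, i <= n -> exists2 v, v < n & G i v) ->
  (forall i i' v, i <= n -> i' <= n -> v < n -> G i v -> G i' v -> i = i') -> False.
Proof.
move=> HG tot inj; pose B := pairs n n + 1.
have [|s0 Hs0 Es0] := comprehension (P := fun p => exists2 i, i < n + 1 & exists2 v, v < n & p = pairs i v /\ G i v) B.
  apply: D0_bex; first by tm.
  apply: D0_bex; first by tm.
  apply: D0_and; first by rewrite /pairs; d0.
  exact: (D0_app2 HG (Tm_var S 1) (Tm_var S 0)).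
pose bad m s := (forall i, i < m + 1 -> exists2 v, v < m & inset (pairs i v) s) /\
  (forall i, i < m + 1 -> forall i', i' < m + 1 -> forall v, v < m ->
     inset (pairs i v) s -> inset (pairs i' v) s -> i = i').
have nobad m : m <= n -> forall s, s < p2 B -> ~ bad m s.
  apply: (ind (P := fun m => m <= n -> forall s, s < p2 B -> ~ bad m s)) => [|_ s Hs [Ht _]|{}m IH Hm].
  - apply: D0_imp; first by d0.
    apply: D0_ball; first by tm.
    apply: D0_not; apply: D0_and.
      apply: D0_ball; first by tm.
      apply: D0_bex; first by tm.
      by apply: D0_pairs; tm.
    apply: D0_ball; first by tm.
    apply: D0_ball; first by tm.
    apply: D0_ball; first by tm.
    apply: D0_imp; first by apply: D0_pairs; tm.
    apply: D0_imp; first by apply: D0_pairs; tm.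
    by d0.
  - by have [v /(ltx0 modS)] := Ht 0 (lt0S 0).
  move=> s Hs [Ht Hi].
  have [|s' Hs' Es'] := comprehension (P := fun p => exists2 i, i < m + 1 & exists2 v, v < m &
    p = pairs i v /\ (inset (pairs i v) s \/ inset (pairs i m) s /\ inset (pairs (m + 1) v) s)) B.
    apply: D0_bex; first by tm.
    apply: D0_bex; first by tm.
    apply: D0_and; first by rewrite /pairs; d0.
    apply: D0_or; first by apply: D0_pairs; tm.
    by apply: D0_and; apply: D0_pairs; tm.
  have lt1 i : i < m + 1 -> i < m + 1 + 1 by move=> H; apply: lt_trans H (ltxS' _).
  have mv v : v < m -> v < m + 1 by move=> H; apply: lt_trans H (ltxS' _).
  have mn : m <= n by apply: le_trans Hm; left; apply: ltxS'.
  have top := ltxS' (m + 1).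
  apply: (IH mn s' Hs'); split.
    move=> i Him; have [v /(ltxS modS) Hv Hiv] := Ht i (lt1 _ Him).
    have key u : u < m -> inset (pairs i u) s \/ inset (pairs i m) s /\ inset (pairs (m + 1) u) s ->
        exists2 v, v < m & inset (pairs i v) s'.
      move=> Hu Hc; exists u => //; apply/Es'; split; last by exists i => //; exists u.
      apply/le_S; apply: pairs_le; first by apply: le_trans mn; apply/le_S.
      by apply: le_trans mn; left.
    case: Hv => [Hv|Ev]; first by apply: (key v) => //; left.
    have [u /(ltxS modS) [Hu|Eu] Hu'] := Ht (m + 1) top.
      by apply: (key u) => //; right; rewrite -{1}Ev.
    case: (lt_neq Him); apply: (Hi i (lt1 _ Him) (m + 1) top m (ltxS' m)); first by rewrite -{1}Ev.
    by rewrite -{2}Eu.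
  move=> i Him i' Him' v Hv /Es' [_ [j Hj [u Hu [/pairs_inj [Ej Eu] H1]]]].
  move=> /Es' [_ [j' Hj' [u' Hu' [/pairs_inj [Ej' Eu'] H2]]]].
  rewrite -{}Ej -{}Eu in H1; rewrite -{}Ej' -{}Eu' in H2.
  have HI a a' w : a < m + 1 + 1 -> a' < m + 1 + 1 -> w < m + 1 -> inset (pairs a w) s ->
    inset (pairs a' w) s -> a = a' by move=> Ha Ha' Hw; apply: Hi.
  have mm := ltxS' m.
  case: H1 H2 => [H1|[H1 H1']] [H2|[H2 H2']].
  - exact: (HI _ _ v (lt1 _ Him) (lt1 _ Him') (mv _ Hv)).
  - by case: (lt_neq Him); apply: (HI _ _ v (lt1 _ Him) top (mv _ Hv)).
  - by case: (lt_neq Him'); apply: (HI _ _ v (lt1 _ Him') top (mv _ Hv)).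
  - exact: (HI _ _ m (lt1 _ Him) (lt1 _ Him') mm).
apply: (nobad n (le_refl n) s0 Hs0); split.
  move=> i Hi; have [v Hv HGv] := tot i (proj2 (le_S _ _) Hi); exists v => //.
  apply/Es0; split; last by exists i => //; exists v.
  by apply/le_S; apply: pairs_le; [apply/le_S|left].
move=> i Hi i' Hi' v Hv /Es0 [_ [j Hj [u Hu [/pairs_inj [-> ->] H1]]]] /Es0 [_ [j' Hj' [u' Hu' [/pairs_inj [-> E] H2]]]].
by apply: (inj j j' u) => //; [apply/le_S|apply/le_S|rewrite E].
Qed.

End Arith3.

(** * The upper bound in a model *)

Section Upper.
Variable S : struc.
Hypothesis modS : EFAmodel S.
Implicit Types (x y z t u s q v : S).
Local Open Scope m_scope.
Local Notation "0" := (@zer S) : m_scope.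
Local Notation "1" := (@uno S) : m_scope.
Local Notation "x + y" := (@add S x y) : m_scope.
Local Notation "x * y" := (@mul S x y) : m_scope.
Local Notation "x < y" := (@ltr S x y) : m_scope.
Local Notation "x <= y" := (@le S x y) : m_scope.
Local Notation "2" := (two S) : m_scope.
Local Notation p2 := (@pow S (two S)).
Local Notation num := (num S).
Local Notation env := (nat -> S).
Let addxC := @addxC S modS. Let addxA := @addxA S modS.
Let addx0 := @addx0 S modS. Let addxS := @addxS S modS.
Let le_trans := @le_trans S modS. Let lt_le_trans := @lt_le_trans S modS.
Let le_lt_trans := @le_lt_trans S modS. Let lt_trans := @lt_trans S modS.
Let le0 := @le0 S modS. Let lt0S := @lt0S S modS. Let p2_lt := @p2_lt S modS.
Let ltxS' := @ltxS' S modS.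
Add Ring S_ring4 : (S_semiring modS).

Definition tw j q := iter j p2 q.

Lemma tw_add j x y : tw j x + y <= tw j (x + y).
Proof.
elim: j => [|j IH]; first exact: le_refl.
apply: le_trans (p2_le modS IH); rewrite (p2_add modS).
have /(lt_ex modS) [z ->] := p2_gt modS y; have /(gt0_ex modS) [u Eu] := p2_gt0 modS (tw j x).
have -> : tw j.+1 x = u + 1 by exact: Eu.
rewrite Eu; apply/(le_ex modS).
by exists (u * y + u * z + z); ring.
Qed.

Lemma log_ex z q : z <= p2 q -> exists2 y, y <= q & logg z y.
Proof.
move=> Hz; case: (zeroVsucc modS z) => [->|[u Eu]].
  by exists 0; [apply: le0|left; split; apply/(eqS modS)].
have [||y Hy [H1 H2]] := greatest modS (P := fun y => p2 y <= z) (b := q + 1).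
- by d0.
- exists 0; first exact: lt0S.
  by rewrite (p2_0 modS) Eu; apply/(le_ex modS); exists u; ring.
exists y; first by apply/(le_S modS).
right; split; first by apply/(leeE modS).
move/(ltxS modS): Hy => [/(lt_S modS)/(le_S modS) Hy|->].
  have := H2 _ Hy (ltxS' y); by case: (ltVle modS z (p2 (y + 1))) => // H /(_ H).
by apply: le_lt_trans Hz _ => //; apply: p2_lt => //; apply: ltxS'.
Qed.

Lemma logiter_ex j q x : x <= tw j q -> exists2 y, y <= q & logiter j x y.
Proof.
elim: j q x => [|j IH] q x; first by exists x => //; apply/(eqS modS).
rewrite /tw iterSr => /IH [z /log_ex [y Hy Hl] Hz]; exists y => //; exists z => //.
Qed.

Lemma width_ex c a : exists w, c * w + a < p2 w.
Proof.
(* Here [p2 w] is the square of [2 * p2 m], so at least [4 * (m + 1) ^ 2], while [c * w + a] is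
   below [2 * (m + 1) ^ 2]. *)
pose m := c + a; exists (m + 1 + (m + 1)); rewrite (p2_add modS) (p2_S modS).
have /(lt_ex modS) [z ->] := p2_gt modS m; apply/(lt_ex modS).
exists (2 * 2 * (m + z + 1) * z + 2 * m * m + 2 * a * m + (2 + 2 + 2) * m + a +
  (1 + 2) + 2 * 2 * (m + 1) * z).
rewrite /m /two; ring.
Qed.

Lemma num_lt i j : (i < j)%N -> num i < num j.
Proof.
elim: j => // j IH; rewrite ltnS leq_eqVlt => /orP [/eqP ->|/IH H]; first exact: ltxS'.
by apply: lt_trans H (ltxS' _).
Qed.

Lemma lt_num x n : x < num n -> exists2 j, (j < n)%N & x = num j.
Proof.
elim: n => [|n IH] /=; first by move/(ltx0 modS).
by move/(ltxS modS) => [/IH [j Hj ->]|->]; [exists j => //; apply: ltnW|exists n].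
Qed.

Lemma num_inj i j : num i = num j -> i = j.
Proof. by case: (ltngtP i j) => // /num_lt /(lt_neq modS) H E; case: H. Qed.

Lemma inc_le x xs R : increasing x xs R -> x <= R.
Proof.
elim: xs x => [|y xs IH] x /=; first by move/(leeE modS).
by move=> [H /IH H2]; left; apply: lt_le_trans H H2.
Qed.

Lemma simplex_nth (a : S) xs R : simplex a xs R ->
  (forall i, (i < size xs)%N -> a <= nth 0 xs i /\ nth 0 xs i <= R) /\
  (forall i j, (i < j < size xs)%N -> nth 0 xs i < nth 0 xs j).
Proof.
case: xs => [|x xs]; first by split=> // i j; rewrite ltn0 andbF.
move=> [/(leeE modS) Hax H].
have lb : forall i, (i < size xs)%N -> x < nth 0 xs i.
  elim: xs x H {Hax} => // y xs IH x [xy /IH H] [|i] //= Hi.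
  by apply: lt_trans xy (H i Hi).
split.
  move=> i Hi; split.
    by case: i Hi => // i Hi; left; apply: le_lt_trans Hax (lb _ Hi).
  elim: xs x H i Hi {lb Hax} => [|y xs IH] x H [|i] // Hi; try exact: inc_le H.
  by case: H => _ H; apply: (IH y H i).
move=> i j; elim: xs x H i j lb {Hax} => [|y xs IH] x H i [|j] //; rewrite ?andbF //=.
move: H => [xy H]; case: i => [|i] lb Hij; first exact: lb.
apply: (IH y H i j) => // t Ht; elim: xs y H t Ht {IH lb xy Hij} => // z xs IH y [yz H] [|t] //= Ht.
by apply: lt_trans yz (IH z H t Ht).
Qed.

Lemma simplex_take (a : S) xs R m : simplex a xs R -> simplex a (take m xs) R.
Proof.
case: xs m => [|x xs] [|m] // [H1 H2]; split=> //.
elim: xs x m H2 {H1} => [|y xs IH] x m // H; case: m => [|m] /=.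
  by apply/(leeE modS); apply: inc_le H.
by case: H => H1 H2; split=> //; apply: IH.
Qed.

Lemma simplex_drop (a : S) xs R : simplex a xs R -> simplex a (drop 1 xs) R.
Proof.
case: xs => // x [|y xs] // [/(leeE modS) H1 [H2 H3]]; split=> //=.
by apply/(leeE modS); left; apply: le_lt_trans H1 H2.
Qed.

Lemma simplex_cons (a : S) y x xs R : a <= y -> y < x -> simplex a (x :: xs) R -> simplex a (y :: x :: xs) R.
Proof. by move=> H1 H2 [_ H]; split; [apply/(leeE modS)|split]. Qed.

(** ** Definability for tuples *)

Implicit Types (f g : env -> S) (fs : seq (env -> S)).

Definition TmL fs := forall f, List.In f fs -> Tm f.
Definition vals fs (e : env) : seq S := map (fun f => f e) fs.
Definition shift fs : seq (env -> S) := map (fun f e => f (etail e)) fs.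

Lemma TmL_shift fs : TmL fs -> TmL (shift fs).
Proof. by move=> H f /List.in_map_iff [g [<- /H Hg]]; apply: Tm_tail. Qed.

Lemma vals_shift fs e : vals (shift fs) e = vals fs (etail e).
Proof. by rewrite /vals /shift -map_comp. Qed.

Lemma TmL_nth fs i : TmL fs -> Tm (fun e => nth 0 (vals fs e) i).
Proof.
elim: fs i => [|f fs IH] [|i] H /=; try exact: Tm_cst.
  by apply: H; left.
by apply: IH => g Hg; apply: H; right.
Qed.

Lemma D0_app C fs g : TmL fs -> Tm g -> D0 (fun e => app C (vals fs e) (g e)).
Proof.
move=> Hfs Hg; apply: D0_inset => //; last exact: Tm_cst.
elim: fs Hfs => [|f fs IH] H //=.
have Hf : Tm f by apply: H; left.
have H2 : Tm (fun e => foldr (pairs (S := S)) (g e) (vals fs e)).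
  by apply: IH => g' Hg'; apply: H; right.
by rewrite /pairs; tm.
Qed.

(** The range is standard, so the quantifier unfolds to a finite conjunction. *)
Lemma D0_mall n (P : nat -> env -> Prop) : (forall j, (j < n)%N -> D0 (P j)) ->
  D0 (fun e => forall j, (j < n)%N -> P j e).
Proof.
elim: n => [|n IH] H; first by apply: (D0_ext _ (D0_true S True)) => e; split.
apply: (D0_ext (P := fun e => (forall j, (j < n)%N -> P j e) /\ P n e)).
  move=> e; split=> [[H1 H2] j|H1]; last by split=> [j Hj|]; apply: H1 => //; apply: ltnW.
  by rewrite ltnS leq_eqVlt => /orP [/eqP ->|/H1].
by apply: D0_and; [apply: IH => j Hj; apply: H; apply: ltnW|apply: H].
Qed.

Lemma D0_mex n (P : nat -> env -> Prop) : (forall j, (j < n)%N -> D0 (P j)) ->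
  D0 (fun e => exists2 j, (j < n)%N & P j e).
Proof.
elim: n => [|n IH] H; first by apply: (D0_ext _ (D0_bot S)) => e; split => // -[].
apply: (D0_ext (P := fun e => (exists2 j, (j < n)%N & P j e) \/ P n e)).
  move=> e; split=> [[[j Hj Hp]|Hp]|[j]]; first by exists j => //; apply: ltnW.
    by exists n.
  by rewrite ltnS leq_eqVlt => /orP [/eqP ->|Hj] Hp; [right|left; exists j].
by apply: D0_or; [apply: IH => j Hj; apply: H; apply: ltnW|apply: H].
Qed.

(** ** Monochromatic paths *)

Section Coloring.
Variables (r : nat) (C c a w R : S).
Hypothesis HC : coloring r.+1 C c a R.
Hypothesis r_gt0 : (0 < r)%N.
Let k := p2 w.
(** Bounds the elements of the codes of all paths with at most [k] windows; fixed in advance, it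
    makes [reach] a bounded relation. *)
Let Bd := pairs (k + num r) R + 1.

Section Path.
Variables (s v : S).

(** One bounded quantifier for each entry of a window, so that definability follows the
    recursion. *)
Fixpoint allwin m i (pre : seq S) : Prop :=
  if m is m'.+1 then forall x, x < R + 1 -> inset (pairs i x) s -> allwin m' (i + 1) (rcons pre x)
  else app C pre v.

Lemma allwinP m i pre : allwin m i pre <-> forall xs, size xs = m ->
  (forall j, (j < m)%N -> nth 0 xs j < R + 1 /\ inset (pairs (i + num j) (nth 0 xs j)) s) ->
  app C (pre ++ xs) v.
Proof.
elim: m i pre => [|m IH] i pre /=.
  by split=> [H [] // _ _|/(_ [::] erefl)]; rewrite cats0 //; apply.
split=> H.
  case=> // x xs [Hs] Hx; rewrite -cat_rcons; have [Hx0 Hx1] := Hx 0%N isT.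
  rewrite /= addx0 in Hx1; apply: (proj1 (IH _ _) (H x Hx0 Hx1)) => // j Hj.
  have [H1 H2] := Hx j.+1 Hj; split=> //; move: H2; congr (inset (pairs _ _) _) => /=; ring.
move=> x Hx0 Hx1; apply/IH => xs Hs Hx; rewrite cat_rcons; apply: H; rewrite /= ?Hs //.
case=> [|j] Hj; first by rewrite /= addx0.
have [H1 H2] := Hx j Hj; split=> //; move: H2; congr (inset (pairs _ _) _) => /=; ring.
Qed.

(** [s] codes an increasing sequence of length [e + r] in the interval [a, R] that ends
    in the tuple [sg] and all of whose [e] windows have color [v]. *)
Definition path (e : S) (sg : seq S) :=
  [/\ (forall i, i < e + num r -> exists2 h, h < R + 1 &
          [/\ a <= h, inset (pairs i h) s & forall h', h' < s -> inset (pairs i h') s -> h' = h]),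
      (forall i, i < e + num r -> forall j, j < e + num r -> i < j -> forall x, x < R + 1 ->
          forall y, y < R + 1 -> inset (pairs i x) s -> inset (pairs j y) s -> x < y),
      (forall i, i < e + num r -> i + num r < e + num r -> allwin r.+1 i [::]) &
      (forall j, (j < r)%N -> inset (pairs (e + num j) (nth 0 sg j)) s)].

(** An entry is at most its pair, which is below [s]; so uniqueness among the numbers below [s] is
    uniqueness. *)
Lemma path_uniq (e : S) sg i h h' : path e sg -> i < e + num r ->
  inset (pairs i h) s -> inset (pairs i h') s -> h = h' /\ h < R + 1.
Proof.
move=> [H _ _ _] /H [h0 Hh0 [_ _ U]] H1 H2.
have lt x : inset (pairs i x) s -> x < s.
  move=> /(inset_lt modS); apply: le_lt_trans => //; rewrite /pairs.
  case: (zeroVsucc modS x) => [->|[u ->]]; first exact: le0.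
  by apply/(le_ex modS); exists (i * i + u * u + u + (1 + 1) * i * (u + 1) + i); ring.
by rewrite (U h (lt _ H1) H1) (U h' (lt _ H2) H2).
Qed.

End Path.

Lemma D0_allwin m f g h fs : Tm f -> Tm g -> Tm h -> TmL fs ->
  D0 (fun e => allwin (f e) (g e) m (h e) (vals fs e)).
Proof.
elim: m f g h fs => [|m IH] f g h fs Hf Hg Hh Hfs /=; first exact: D0_app.
apply: D0_ball; first by tm.
apply: D0_imp; first by apply: (D0_pairs modS); [apply: (Tm_tail Hh)|tm|apply: (Tm_tail Hf)].
have Hr : TmL (rcons (shift fs) (fun e => e 0%N)).
  move=> f'; rewrite -cats1 => /List.in_app_iff [/(TmL_shift Hfs) //|/= [<-|//]].
  exact: Tm_var.
apply: D0_ext (IH (fun e => f (etail e)) (fun e => g (etail e)) (fun e => h (etail e) + 1) _ _ _ _ Hr).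
- by move=> e; rewrite /vals map_rcons /shift -map_comp.
- exact: Tm_tail.
- exact: Tm_tail.
- by apply: Tm_add; [apply: Tm_tail|apply: Tm_cst].
Qed.

Definition reach v (e : S) sg := exists2 s, s < p2 Bd & path s v e sg.

Lemma D0_reach f g fs : Tm f -> Tm g -> TmL fs -> D0 (fun e => reach (f e) (g e) (vals fs e)).
Proof.
move=> Hf Hg Hfs; apply: D0_bex; first by tm.
have Hf' := Tm_tail Hf; have Hg' := Tm_tail Hg.
apply: (D0_ext (P := fun e => (forall i, i < g (etail e) + num r -> exists2 h, h < R + 1 &
          a <= h /\ (inset (pairs i h) (e 0%N) /\ forall h', h' < e 0%N -> inset (pairs i h') (e 0%N) -> h' = h)) /\
      ((forall i, i < g (etail e) + num r -> forall j, j < g (etail e) + num r -> i < j -> forall x, x < R + 1 ->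
          forall y, y < R + 1 -> inset (pairs i x) (e 0%N) -> inset (pairs j y) (e 0%N) -> x < y) /\
      ((forall i, i < g (etail e) + num r -> i + num r < g (etail e) + num r -> allwin (e 0%N) (f (etail e)) r.+1 i (vals [::] e)) /\
      (forall j, (j < r)%N -> inset (pairs (g (etail e) + num j) (nth 0 (vals (shift fs) e) j)) (e 0%N)))))).
  move=> e; rewrite vals_shift; split=> [[H1 [H2 [H3 H4]]]|[H1 H2 H3 H4]].
    by split=> // i /H1 [h Hh [? [? ?]]]; exists h.
  by do !split=> //; move=> i /H1 [h Hh [? ? ?]]; exists h.
have g1 := Tm_tail Hg; have g2 := Tm_tail g1; have g3 := Tm_tail g2.
have f2 := Tm_tail (Tm_tail Hf).
apply: D0_and.
  apply: D0_ball; first by tm.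
  apply: D0_bex; first by tm.
  apply: D0_and; first by d0.
  apply: D0_and; first by apply: (D0_pairs modS); tm.
  apply: D0_ball; first by tm.
  by apply: D0_imp; [apply: (D0_pairs modS); tm|d0].
apply: D0_and.
  apply: D0_ball; first by tm.
  apply: D0_ball; first by apply: Tm_add; [exact: g2|tm].
  apply: D0_imp; first by d0.
  apply: D0_ball; first by tm.
  apply: D0_ball; first by tm.
  apply: D0_imp; first by apply: (D0_pairs modS); tm.
  by apply: D0_imp; [apply: (D0_pairs modS); tm|d0].
apply: D0_and.
  apply: D0_ball; first by tm.
  apply: D0_imp.
    by apply: D0_lt; [tm|apply: Tm_add; [exact: g2|tm]].
  apply: (D0_allwin r.+1 (f := fun e => e 1%N) (g := fun e => f (etail (etail e))) (h := fun e => e 0%N) (fs := [::])).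
  - exact: Tm_var.
  - exact: f2.
  - exact: Tm_var.
  - by [].
apply: D0_mall => j _; apply: (D0_pairs modS); [by tm| |exact: Tm_var].
by apply: TmL_nth; apply: TmL_shift.
Qed.

Lemma lt_R1 x : x <= R -> x < R + 1. Proof. by move/(le_S modS). Qed.

Lemma reach0 sg v : size sg = r -> simplex a sg R -> reach v 0 sg.
Proof.
move=> Hs /simplex_nth [H1 H2].
have [|s Hs1 Es] := comprehension modS (P := fun p => exists2 j, (j < r)%N & p = pairs (num j) (nth 0 sg j)) Bd.
  by apply: D0_mex => j _; rewrite /pairs; d0.
have in_s i h : inset (pairs i h) s -> exists2 j, (j < r)%N & i = num j /\ h = nth 0 sg j.
  by move=> /Es [_ [j Hj /(pairs_inj modS) [-> ->]]]; exists j.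
have num_in j : (j < r)%N -> inset (pairs (num j) (nth 0 sg j)) s.
  move=> Hj; apply/Es; split; last by exists j.
  apply/(ltxS modS)/or_comm; rewrite or_comm; apply: (pairs_le modS).
    by apply: le_trans (le_addl modS _ _); left; apply: num_lt.
  by case: (H1 j); rewrite ?Hs.
exists s => //; rewrite /path (add0x modS); split.
- move=> i /lt_num [j Hj ->]; have Hj' : (j < size sg)%N by rewrite Hs.
  have [A1 A2] := H1 j Hj'; exists (nth 0 sg j); first exact: lt_R1.
  split=> //; first exact: num_in.
  by move=> h' _ /in_s [j' Hj2 [/num_inj -> ->]].
- move=> i _ j _ Hij x _ y _ /in_s [i' Hi' [Ei Ex]] /in_s [j' Hj' [Ej Ey]].
  rewrite Ex Ey; apply: H2; rewrite Hs Hj' andbT ltnNge; apply/negP.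
  rewrite leq_eqVlt => /orP [/eqP E|/num_lt H].
    by apply: (ltxx modS (x := i)); rewrite {2}Ei -E -Ej.
  by apply: (le_gtF modS (ltW Hij)); rewrite Ei Ej.
- by move=> i _ H; case: (le_gtF modS (le_addl modS (num r) i)).
- by move=> j Hj; rewrite (add0x modS); apply: num_in.
Qed.

(** The last entry of [xs] is appended to the path; [e < k] keeps the new code within its bound. *)
Lemma reachS xs v (e : S) : size xs = r.+1 -> simplex a xs R -> app C xs v -> e < k ->
  reach v e (take r xs) -> reach v (e + 1) (drop 1 xs).
Proof.
move=> Hs Hx Hv ek [s Hs1 Hp]; have [X1 X2] := simplex_nth Hx.
set l := e + num r; set y := nth 0 xs r.
have [P1 P2 P3 P4] := Hp.
have yR : y < R + 1 by apply: lt_R1; case: (X1 r); rewrite ?Hs.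
have ya : a <= y by case: (X1 r); rewrite ?Hs.
have [|s' Hs1' Es] := comprehension modS (P := fun p => (exists2 i, i < l & exists2 h, h < R + 1 &
    p = pairs i h /\ inset (pairs i h) s) \/ p = pairs l y) Bd.
  apply: D0_or; last by rewrite /pairs; d0.
  apply: D0_bex; first by tm.
  apply: D0_bex; first by tm.
  by apply: D0_and; [rewrite /pairs; d0|apply: (D0_pairs modS); tm].
have lk : l <= k + num r by apply: le_add => //; [left|right].
have inA i h : i < l -> inset (pairs i h) s' <-> inset (pairs i h) s.
  move=> Hi; split.
    move=> /Es [_ [[i' _ [h' _ [/(pairs_inj modS) [-> ->] //]]]|/(pairs_inj modS) [E _]]].
    by case: (lt_neq modS Hi).
  move=> H; have [_ hR] := path_uniq Hp Hi H H.
  apply/Es; split; last by left; exists i => //; exists h.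
  apply/(le_S modS); apply: (pairs_le modS); last exact/(le_S modS).
  by apply: le_trans lk; left.
have inB h : inset (pairs l h) s' <-> h = y.
  split=> [/Es [_ [[i' Hi [h' _ [/(pairs_inj modS) [E _] _]]]|/(pairs_inj modS) [] //]]|->].
    by case: (lt_neq modS Hi).
  apply/Es; split; last by right.
  by apply/(le_S modS); apply: (pairs_le modS) => //; apply/(le_S modS).
have l1 : e + 1 + num r = l + 1 by rewrite /l; ring.
have last_s : inset (pairs (e + num r.-1) (nth 0 xs r.-1)) s.
  by rewrite -(@nth_take r _ 0 r.-1) ?ltn_predL //; apply: P4; rewrite ltn_predL.
have el : e + num r.-1 + 1 = l by rewrite /l -{2}(prednK r_gt0) /=; ring.
have lt_y i x : i < l -> inset (pairs i x) s -> x < y.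
  move=> Hi Hix; have xr : nth 0 xs r.-1 < y by apply: X2; rewrite Hs ltn_predL r_gt0 /=.
  have Hl : e + num r.-1 < l by rewrite -el; apply: ltxS'.
  move: (Hi); rewrite -{1}el => /(ltxS modS) [Hi'|Ei].
    apply: lt_trans xr; apply: (P2 i Hi _ Hl Hi' x _ _ _ Hix last_s).
      by case: (path_uniq Hp Hi Hix Hix).
    by case: (path_uniq Hp Hl last_s last_s).
  by move: Hix; rewrite Ei => Hix; case: (path_uniq Hp Hl Hix last_s) => ->.
exists s' => //; split; rewrite ?l1.
- move=> i /(ltxS modS) [Hi|->]; last first.
    by exists y => //; split=> //; [apply/inB|move=> h' _ /inB].
  have [h Hh [A1 A2 _]] := P1 i Hi; exists h => //; split=> //; first exact/inA.
  by move=> h' _ /(inA _ _ Hi) H; case: (path_uniq Hp Hi H A2).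
- move=> i /(ltxS modS) Hi j /(ltxS modS) Hj ij x xR z zR Hix Hjz.
  case: Hi => [Hi|Ei]; last first.
    by case: Hj => [Hj|Ej]; rewrite Ei in ij;
      [case: (le_gtF modS (ltW Hj) ij)|rewrite Ej in ij; case: (ltxx modS ij)].
  move/(inA _ _ Hi): Hix => Hix.
  case: Hj => [Hj|Ej]; last by move: Hjz; rewrite Ej => /inB ->; apply: lt_y Hix.
  by move/(inA _ _ Hj): Hjz => Hjz; apply: (P2 i Hi j Hj ij x xR z zR).
- move=> i Hi /(ltxS modS) Hir; apply/allwinP => ys Hys Hy; rewrite cat0s.
  have le_j j : (j < r.+1)%N -> i + num j <= i + num r.
    by rewrite ltnS leq_eqVlt => /orP [/eqP ->|/num_lt H]; [right|left; apply: (le_lt_add modS) => //; right].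
  case: Hir => [Hir|Ei].
    have Hil : i < l by apply: le_lt_trans Hir; apply: (le_addr modS).
    have /allwinP W := P3 i Hil Hir.
    rewrite -[ys]cat0s; apply: W => // j Hj; have [B1 B2] := Hy j Hj; split=> //.
    by apply/inA => //; apply: le_lt_trans Hir; apply: le_j.
  (* The only new window starts at [e], and uniqueness of the entries identifies it with [xs]. *)
  have {}Ei : i = e by apply: (@add_inj S modS (num r)).
  subst i; suff -> : ys = xs by [].
  apply: (@eq_from_nth _ 0); rewrite ?Hys ?Hs // => j Hj; have [_ B2] := Hy j Hj.
  move: (Hj); rewrite ltnS leq_eqVlt => /orP [/eqP Ej|Hjr].
    by move: B2; rewrite Ej => /inB.
  have Hjl : e + num j < l by apply: (le_lt_add modS); [right|apply: num_lt].
  move/(inA _ _ Hjl): B2 => B2.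
  have := P4 j Hjr; rewrite nth_take // => B3.
  by case: (path_uniq Hp Hjl B2 B3).
- move=> j Hj; rewrite nth_drop add1n.
  have -> : e + 1 + num j = e + num j.+1 by rewrite /=; ring.
  move: (Hj); rewrite leq_eqVlt => /orP [/eqP Ej|Hj1].
    by rewrite Ej; apply/inB.
  apply/inA; first by apply: (le_lt_add modS); [right|apply: num_lt].
  by rewrite -(@nth_take r _ 0 j.+1) //; apply: P4.
Qed.

Variable q : S.
Hypotheses (HR : R <= tw r q) (Hq : q < k).

Definition goal := exists H l s,
  [/\ subint H a R, enumerates s l H, wkhom r.+1 C s l & large (logiter r) H l].

(** The entries of the path form the required set: there are at least [k > q] of them, while the
    least one is at most [R <= tw r q] and has [r]-fold logarithm at most [q]. *)
Lemma reach_goal sg v : reach v k sg -> goal.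
Proof.
move=> [s _ Hp]; have [P1 P2 P3 P4] := Hp; set l := k + num r in P1 P2 P3.
have [|H _ EH] := comprehension modS (P := fun h => exists2 i, i < l & inset (pairs i h) s) (R + 1).
  by apply: D0_bex; [tm|apply: (D0_pairs modS); tm].
have inH h : inset h H <-> exists2 i, i < l & inset (pairs i h) s.
  rewrite EH; split=> [[]//|[i Hi Hih]]; split; last by exists i.
  by case: (path_uniq Hp Hi Hih Hih).
have kl : k <= l by apply: (le_addr modS).
have val i h : i < l -> inset (pairs i h) s -> value s [:: i] h.
  move=> Hi Hih u; split=> [Hu|/(eqS modS) ->] //.
  by apply/(eqS modS); case: (path_uniq Hp Hi Hu Hih).
have l0 : 0 < l by apply: lt_le_trans kl; apply: (p2_gt0 modS).
exists H, l, s; split.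
- move=> x /inH [i Hi Hix]; have [h _ [A1 A2 _]] := P1 i Hi.
  have [E xR] := path_uniq Hp Hi Hix A2; split; apply/(leeE modS); first by rewrite E.
  exact/(le_S modS).
- split.
  + move=> i Hi; have [h _ [_ A2 _]] := P1 i Hi; exists h; split; last exact: val.
    by apply/inH; exists i.
  + move=> i j x y Hij Hj Hx Hy; have Hi := lt_trans Hij Hj.
    apply: (P2 i Hi j Hj Hij x _ y _ Hx Hy); first by case: (path_uniq Hp Hi Hx Hx).
    by case: (path_uniq Hp Hj Hy Hy).
  + by move=> x /inH [i Hi Hix]; exists i.
- move=> i xs Hs Hi Hx; exists v.
  have lt_i j : (j < r.+2)%N -> i + num j < l.
    rewrite ltnS leq_eqVlt => /orP [/eqP -> //|/num_lt H'].
    by apply: lt_trans Hi; apply: (le_lt_add modS); [right|].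
  have Hx' j : (j < r.+2)%N -> nth 0 xs j < R + 1 /\ inset (pairs (i + num j) (nth 0 xs j)) s.
    move=> Hj; have := Hx j Hj; rewrite (set_nth_default 0) ?Hs // => H'; split=> //.
    by case: (path_uniq Hp (lt_i j Hj) H' H').
  have il : i < l by have := lt_i 0%N isT; rewrite /= addx0.
  split.
    have /allwinP W := P3 i il (lt_i r (leqnSn _)).
    rewrite -[take _ _]cat0s; apply: W; first by rewrite size_takel // Hs.
    by move=> j Hj; rewrite nth_take //; apply: Hx'; apply: ltnW.
  have E j : i + 1 + num j = i + num j.+1 by rewrite /=; ring.
  have il1 : i + 1 < l by have := lt_i 1%N isT; rewrite /= (add0x modS).
  have /allwinP W : allwin s v r.+1 (i + 1) [::] by apply: P3 => //; rewrite E; apply: lt_i.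
  rewrite -[drop _ _]cat0s; apply: W; first by rewrite size_drop Hs subn1.
  by move=> j Hj; rewrite nth_drop add1n E; apply: Hx'.
have [h _ [A1 A2 _]] := P1 0 l0; have [_ hR] := path_uniq Hp l0 A2 A2.
have [y Hy Hl] : exists2 y, y <= q & logiter r h y.
  by apply: logiter_ex; apply: le_trans HR; apply/(le_S modS).
exists h, y; split=> //; last by apply: lt_le_trans kl; apply: le_lt_trans Hy Hq.
split; first by apply/inH; exists 0.
move=> x /inH [i Hi Hix]; apply/(leeE modS).
case: (zeroVsucc modS i) => [Ei|[u Eu]].
  by right; rewrite Ei in Hix; case: (path_uniq Hp l0 A2 Hix).
left; apply: (P2 0 l0 i Hi _ h hR x _ A2 Hix); first by rewrite Eu; apply: lt0S.
by case: (path_uniq Hp Hi Hix Hix).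
Qed.

(** ** Proper colorings of shift graphs *)

Definition longest sg v (e : S) :=
  e < k /\ (reach v e sg /\ forall e' : S, e' < k -> e < e' -> ~ reach v e' sg).

Lemma D0_longest f g fs : Tm f -> Tm g -> TmL fs -> D0 (fun e => longest (vals fs e) (f e) (g e)).
Proof.
move=> Hf Hg Hfs; apply: D0_and; first by apply: D0_lt; [|exact: Tm_cst].
apply: D0_and; first exact: D0_reach.
apply: D0_ball; first exact: Tm_cst.
apply: D0_imp; first by apply: D0_lt; [exact: (Tm_tail Hg)|exact: Tm_var].
apply: D0_not.
apply: (D0_ext (P := fun e => reach (f (etail e)) (e 0%N) (vals (shift fs) e))).
  by move=> e; rewrite vals_shift.
by apply: D0_reach; [apply: Tm_tail|apply: Tm_var|apply: TmL_shift].
Qed.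

Lemma longest_uniq sg v (e e' : S) : longest sg v e -> longest sg v e' -> e = e'.
Proof.
move=> [H1 [H2 H3]] [H1' [H2' H3']]; case: (ltVle modS e e') => [H|[H|//]].
  by case: (H3 _ H1' H).
by case: (H3' _ H1 H).
Qed.

Lemma longest_ex sg v : size sg = r -> simplex a sg R -> exists e, longest sg v e.
Proof.
move=> Hs Hx.
have [||e He [H1 H2]] := greatest modS (P := fun e => reach v e sg) (b := k).
- have := @D0_reach (fun=> v) (fun e => e 0%N) (map (fun x (_ : env) => x) sg) (Tm_cst v) (Tm_var S 0).
  rewrite (_ : (fun e => reach _ _ _) = (fun e => reach v (e 0%N) sg)); last first.
    by apply: funext => e; rewrite /vals -map_comp map_id.
  by apply => f /List.in_map_iff [x [<- _]]; apply: Tm_cst.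
- by exists 0; [apply: (p2_gt0 modS)|apply: reach0].
by exists e.
Qed.

(** [z] codes the color of the [(r - i)]-tuple [t]: for [i = 0] the function assigning
    to [v] the binary expansion of the length of a longest path, and then the set of
    colors of the extensions of [t] on the left. *)
Fixpoint K i (t : seq S) (z : S) : Prop :=
  if i is i'.+1 then
    z < p2 (tw i'.+1 (c * w)) /\ forall b, b < tw i'.+1 (c * w) ->
      (inset b z <-> exists2 y, y < nth 0 t 0 & a <= y /\ K i' (y :: t) b)
  else z < p2 (c * w) /\ forall v, v < c -> forall j, j < w ->
    (inset (v * w + j) z <-> exists2 e, e < k & longest t v e /\ inset j e).

Lemma D0_K i f fs : Tm f -> TmL fs -> D0 (fun e => K i (vals fs e) (f e)).
Proof.
elim: i f fs => [|i IH] f fs Hf Hfs /=.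
  apply: D0_and; first by apply: D0_lt; [|exact: Tm_cst].
  apply: D0_ball; first exact: Tm_cst.
  apply: D0_ball; first exact: Tm_cst.
  apply: D0_iff.
    by apply: (D0_inset modS); [tm|exact: (Tm_tail (Tm_tail Hf))].
  apply: D0_bex; first exact: Tm_cst.
  apply: D0_and; last by apply: (D0_inset modS); tm.
  apply: (D0_ext (P := fun e => longest (vals (shift (shift (shift fs))) e) (e 2%N) (e 0%N))).
    by move=> e; rewrite !vals_shift.
  by apply: D0_longest; [tm|tm|do !apply: TmL_shift].
apply: D0_and; first by apply: D0_lt; [|exact: Tm_cst].
apply: D0_ball; first exact: Tm_cst.
apply: D0_iff; first by apply: (D0_inset modS); [tm|exact: (Tm_tail Hf)].
apply: D0_bex; first exact: (Tm_tail (TmL_nth 0 Hfs)).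
apply: D0_and; first by d0.
apply: (D0_ext (P := fun e => K i (vals ((fun e => e 0%N) :: shift (shift fs)) e) (e 1%N))).
  by move=> e; rewrite /vals /= -/(vals _ _) !vals_shift.
apply: IH; first by tm.
by move=> g /= [<-|/(TmL_shift (TmL_shift Hfs)) //]; apply: Tm_var.
Qed.

Lemma D0_K1 i (t : seq S) : D0 (fun e => K i (e 0%N :: t) (e 1%N)).
Proof.
apply: (D0_ext (P := fun e => K i (vals ((fun e => e 0%N) :: map (fun x (_ : env) => x) t) e) (e 1%N))).
  by move=> e; rewrite /vals /= -map_comp map_id.
apply: D0_K; first by tm.
by move=> g /= [<-|/List.in_map_iff [x [<- _]]]; [apply: Tm_var|apply: Tm_cst].
Qed.

Hypothesis no : ~ goal.

Lemma K_ex i (t : seq S) : (i < r)%N -> size t = (r - i)%N -> simplex a t R ->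
  exists2 z, z < tw i.+1 (c * w) & K i t z.
Proof.
case: i => [|i] Hi Hs Hx.
  have [|z Hz Ez] := comprehension modS (P := fun p => exists2 v, v < c & exists2 j, j < w &
      p = v * w + j /\ exists2 e, e < k & longest t v e /\ inset j e) (c * w).
    apply: D0_bex; first by tm.
    apply: D0_bex; first by tm.
    apply: D0_and; first by d0.
    apply: D0_bex; first exact: Tm_cst.
    apply: D0_and; last by apply: (D0_inset modS); tm.
    apply: (D0_ext (P := fun e => longest (vals (map (fun x (_ : env) => x) t) e) (e 2%N) (e 0%N))).
      by move=> e; rewrite /vals -map_comp map_id.
    by apply: D0_longest; [tm|tm|move=> g /List.in_map_iff [x [<- _]]; apply: Tm_cst].
  exists z => //; split=> // v Hv j Hj; rewrite Ez; split.
    by move=> [_ [v' Hv' [j' Hj' [/(div_uniq modS Hj Hj') [-> ->]]]]].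
  move=> H; split; last by exists v => //; exists j.
  apply: lt_le_trans (_ : (v + 1) * w <= c * w); last first.
    by apply: (le_mul modS); [apply/(lt_S modS)|right].
  by rewrite (_ : (v + 1) * w = v * w + w); [apply: (le_lt_add modS) => //; right|ring].
have [|z Hz Ez] := comprehension modS (P := fun b => exists2 y, y < nth 0 t 0 & a <= y /\ K i (y :: t) b) (tw i.+1 (c * w)).
  apply: D0_bex; first exact: Tm_cst.
  by apply: D0_and; [d0|apply: D0_K1].
exists z => //; split=> // b Hb; rewrite Ez; split=> [[]//|H].
by split.
Qed.

(** In the inductive step the tuple [xs] extends its tail on the left, so the color of [xs] belongs
    to the set [z] of the tail. If [z] is also the set of the head, some [y] extends the head with
    that color, and [y :: xs] contradicts the previous level. *)
Lemma K_proper i xs z : (i < r)%N -> size xs = (r - i).+1 -> simplex a xs R ->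
  K i (take (r - i) xs) z -> K i (drop 1 xs) z -> False.
Proof.
elim: i xs z => [|i IH] xs z Hi; last first.
  have Eri : (r - i = (r - i.+1).+1)%N by rewrite subnSK // ltnW.
  move=> Hs Hx [_ K1] [_ K2].
  have [m Em] : exists m, (r - i.+1 = m.+1)%N by exists (r - i.+1).-1; rewrite prednK // subn_gt0.
  have Hxs : size xs = (r - i)%N by rewrite Hs Eri.
  have [b Hb Kb] := K_ex (ltnW Hi) Hxs Hx.
  case: xs Hs Hx K1 K2 Kb Hxs => [|x0 [|x1 xs]]; rewrite ?Em // => Hs Hx K1 K2 Kb Hxs.
  have /= Hin := K2 b Hb; rewrite ?drop0 in Hin.
  have [X1 X2] := simplex_nth Hx.
  have bz : inset b z.
    apply/Hin; exists x0; first by apply: (X2 0%N 1%N).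
    by split; first by case: (X1 0%N isT).
  have /= [H _] := K1 b Hb; have [y Hy [ay Ky]] := H bz.
  apply: (IH (y :: x0 :: x1 :: xs) b (ltnW Hi)).
  - by rewrite /= Eri Em; move: Hs => /= ->.
  - exact: simplex_cons.
  - by move: Ky; rewrite Eri Em.
  - by rewrite /= ?drop0.
rewrite subn0 => Hs Hx [_ K1] [_ K2].
have [v [Hv Hval]] := HC Hs Hx; have Hc : app C xs v by apply/Hval/(eqS modS).
have Hx1 := simplex_take r Hx; have Hx2 := simplex_drop Hx.
have [||e He] := @longest_ex (take r xs) v; [by rewrite size_takel // Hs|by []|].
have [||e' He'] := @longest_ex (drop 1 xs) v; [by rewrite size_drop Hs subn1|by []|].
have [ek [Re _]] := He; have [ek' [Re' M']] := He'.
have Re1 := reachS Hs Hx Hc ek Re.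
(* Reaching [k] windows would give the goal, so the longer path still counts for [longest]. *)
have e1k : e + 1 < k.
  by case: (proj1 (lt_S modS _ _) ek) => // E; rewrite E in Re1; case: no; apply: reach_goal Re1.
have ne : e' <> e.
  by move=> E; apply: (M' _ e1k _ Re1); rewrite E; apply: ltxS'.
apply: ne; apply: (ext modS ek' ek) => j Hj.
have side (t : seq S) (d : S) : longest t v d -> (exists2 e, e < k & longest t v e /\ inset j e) <-> inset j d.
  move=> Hd; split=> [[d' _ [Hd' Hj']]|Hj']; first by rewrite (longest_uniq Hd Hd').
  by exists d => //; case: Hd.
by rewrite -(side _ _ He) -(side _ _ He') -(K1 v Hv j Hj) -(K2 v Hv j Hj).
Qed.

End Coloring.

(** At level [r.-1] the colors of the points [a + i] with [i <= n] are distinct and below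
    [n = tw r (c * w)]; [tw_add] places all these points in the interval. *)
Theorem wph_upper r : (0 < r)%N -> wph (S := S) r.+1 (logiter r).
Proof.
move=> r0 c a; have [w Hw] := width_ex c a.
exists (tw r (c * w + a)) => C HC; apply: contrapT => no.
set R := tw r (c * w + a) in HC no.
have RR : R <= R := le_refl R.
have Hr1 : (r.-1 < r)%N by rewrite prednK.
have Er : (r - r.-1 = 1)%N by case: (r) r0 => // r' _; rewrite subSnn.
pose n := tw r (c * w).
have bnd i : i <= n -> a + i <= R.
  move=> Hi; apply: le_trans (tw_add r (c * w) a); rewrite addxC.
  by apply: (le_add modS) => //; right.
have sx i : i <= n -> simplex a [:: a + i] R.
  by move=> /bnd H; split; apply/(leeE modS) => //; apply: (le_addr modS).
pose Kr := K r C c a w R r.-1.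
apply: (php modS (G := fun i v => Kr [:: a + i] v) (n := n)).
- have := D0_K1 r C c a w R r.-1 [::] => H.
  apply: (D0_app2 (P := fun x z => Kr [:: x] z) H); last exact: Tm_var.
  by tm.
- move=> i Hi; have [||z Hz Kz] := @K_ex r C c a w R r.-1 [:: a + i] Hr1.
  + by rewrite Er.
  + exact: sx.
  + by exists z => //; move: Hz; rewrite prednK.
have half i i' v : i <= n -> i' <= n -> Kr [:: a + i] v -> Kr [:: a + i'] v -> ~ (i < i').
  move=> Hi Hi' H1 H2 lt; apply: (K_proper HC r0 RR Hw no (i := r.-1) (xs := [:: a + i; a + i']) (z := v)) => //.
  - by rewrite Er.
  - split; first by apply/(leeE modS); apply: (le_addr modS).
    split; first by apply: (le_lt_add modS) => //; right.
    by apply/(leeE modS); apply: bnd.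
  - by rewrite Er.
move=> i i' v Hi Hi' _ H1 H2; case: (ltVle modS i i') => [/(half _ _ _ Hi Hi' H1 H2) //|[|//]].
by move/(half _ _ _ Hi' Hi H2 H1).
Qed.

End Upper.

Lemma EFA_provable d : (0 < d)%N -> proves EFA (WPH d.+1 (@LogIter false d)).
Proof.
move=> d0; apply: completeness => S eqS setS TS e E.
have modS : EFAmodel S by split.
rewrite (ev_WPH (g := logiter d)); first exact: wph_upper.
by move=> *; apply: ev_LogIter.
Qed.

Theorem theorem24 (d : nat) (hd : 1 < d) :
  (proves RCA0star (WPH d (@LogIter true d.-1))
   /\ forall n : nat,
        ~ proves (theory_union RCA0star (@ISigma true d.-1))
                 (WPH d (@RootLogIter true n d.-2)))
  /\
  (proves EFA (WPH d (@LogIter false d.-1))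
   /\ forall n : nat,
        ~ proves (theory_union EFA (@ISigma false d.-1))
                 (WPH d (@RootLogIter false n d.-2))).
Proof.
case: d hd => [|[|d]] // _; have H := EFA_provable (ltn0Sn d).
by do !split=> //; [apply: EFA_RCA0star|apply: RCA_unprovable|apply: EFA_unprovable].
Qed.
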